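(* Let $0\le j<k\le n-1$. Then $R_H$ is a linear bounded operator from $L^1_{n-k}(\Gamma_H(n,j))$ to $L^1_{n-j}(\Gamma_H(n,k))$. In particular, for $f\in L^1_\lambda(\Gamma_H(n,j))$, the Radon transform $(R_Hf)(\mathfrak z)$ exists for almost all $\mathfrak z\in\Gamma_H(n,k)$ in the Lebesgue sense provided that $\lambda\ge n-k$, where the bound $n-k$ is sharp.
   Context: $n\ge2$; functions are complex-valued; $\sigma_{m-1}=2\pi^{m/2}/\Gamma(m/2)$ is the area of $S^{m-1}$. $\mathbb E^{n,1}$ is $\mathbb R^{n+1}$ with the form $[x,y]=-x_1y_1-\dots-x_ny_n+x_{n+1}y_{n+1}$, with unit vectors $e_1,\dots,e_{n+1}$; $\mathbb H^n=\{x:[x,x]=1,x_{n+1}>0\}$ with distance $d(x,y)=\cosh^{-1}[x,y]$; $\tilde o=e_{n+1}$. $\Gamma_H(n,d)$, $0\le d\le n-1$, is the set of $d$-dimensional totally geodesic submanifolds of $\mathbb H^n$, i.e. nonempty intersections of $\mathbb H^n$ with $(d+1)$-dimensional linear subspaces (for $d=0$, the points of $\mathbb H^n$); $\|\mathfrak t\|$ is the geodesic distance from $\tilde o$ to $\mathfrak t$. $\mathbb H^d=\mathbb H^n\cap\mathrm{span}(e_{n-d+1},\dots,e_{n+1})$; $g_{i,n+1}(r)$ is the linear map with $e_i\mapsto e_i\cosh r+e_{n+1}\sinh r$, $e_{n+1}\mapsto e_i\sinh r+e_{n+1}\cosh r$, fixing the other $e_l$; $K=SO(n)$ acts on the first $n$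 coordinates, with Haar probability measure $d\alpha$. The invariant measure on $\Gamma_H(n,d)$ is normalized by $$\int_{\Gamma_H(n,d)}\psi(\mathfrak t)\,d\mathfrak t=\sigma_{n-d-1}\int_0^\infty(\sinh r)^{n-d-1}(\cosh r)^d\int_K\psi(\alpha g_{n-d,n+1}(r)\mathbb H^d)\,d\alpha\,dr,$$ and $L^1_\lambda(\Gamma_H(n,d))=\{f:\|f\|_{1,\lambda}=\int_{\Gamma_H(n,d)}|f(\mathfrak t)|(\cosh\|\mathfrak t\|)^{-\lambda}\,d\mathfrak t<\infty\}$. Definition of $R_H$: let $\mathbb R^k=\mathrm{span}(e_{n-k+1},\dots,e_n)$. Each $\mathfrak z\in\Gamma_H(n,k)$ is the intersection of $\mathbb H^n$ with the smallest linear subspace containing $\eta+v+e_{n+1}$, for a unique $k$-dimensional linear subspace $\eta\subset\mathbb R^n$ and $v\in\eta^\perp\subset\mathbb R^n$, $|v|<1$. With $r=\|\mathfrak z\|$, choose $\gamma\in K$ with $\gamma\mathbb R^k=\eta$ and $\gamma e_{n-k}=v/|v|$ (the latter if $v\ne0$). Then $(R_Hf)(\mathfrak z)=\int_{\mathfrak t\subset\mathfrak z}f(\mathfrak t)$ is defined by $$(R_Hf)(\mathfrak z)=\int_{\Gamma_H(k,j)}f\big(\gamma g_{n-k,n+1}(r)\,\mathfrak t\big)\,dm(\mathfrak t),$$ where $\Gamma_H(k,j)$ is the set of $j$-dimensional totally geodesic submanifolds of the hyperboloid $\mathbb H^k$ and $dm$ is its canonical invariant measure: for $j=0$ the Riemannian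 measure on $\mathbb H^k$, and for $k\ge2$ $$\int_{\Gamma_H(k,j)}\psi\,dm=\sigma_{k-j-1}\int_0^\infty(\sinh\rho)^{k-j-1}(\cosh\rho)^j\int_{SO(k)}\psi\big(\alpha g_{n-j,n+1}(\rho)\mathbb H^j\big)\,d\alpha\,d\rho,$$ with $SO(k)$ acting on $\mathbb R^k$ and carrying Haar probability measure.
   Formalization: The condition λ ≥ n−k is replaced by λ ≤ n−k, with sharpness meaning failure for every λ > n−k: with the weight (cosh‖t‖)^{−λ} the printed direction is false (n=2, j=0, k=1, λ=2, f=1 has finite norm but infinite integral over every geodesic). *)

(* Defs.v *)
(* Coordinates of R^(n+1) are 0-based, so that
   e_1, ..., e_(n+1) are delta_mx i 0 for i : 'I_n.+1 of value 0, ..., n. *)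
From HB Require Import structures.
From mathcomp Require Import all_boot all_order all_algebra.
From mathcomp Require Import complex.
From mathcomp Require Import all_classical all_reals all_analysis.
From mathcomp Require Import measurable_realfun.

Set Implicit Arguments.
Unset Strict Implicit.
Unset Printing Implicit Defensive.
Import Order.TTheory GRing.Theory Num.Theory.
Import numFieldNormedType.Exports.
Local Open Scope classical_set_scope.
Local Open Scope ring_scope.

Section functions.
Variable R : realType.

Definition cosh (x : R) : R := (expR x + expR (- x)) / 2.
Definition sinh (x : R) : R := (expR x - expR (- x)) / 2.
Definition arcosh (x : R) : R := ln (x + Num.sqrt (x ^+ 2 - 1)).

Definition Gamma (s : R) : R :=
  Rintegral (@lebesgue_measure R) `]0, +oo[%classic
    (fun t => t `^ (s - 1) * expR (- t)).

(* sphere_area m is the area of S^(m-1), written sigma_(m-1) on paper *)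
Definition sphere_area (m : nat) : R :=
  2 * pi `^ (m%:R / 2) / Gamma (m%:R / 2).

End functions.

Section complex_integral.
Context d (T : measurableType d) (R : realType).
Implicit Types (mu : {measure set T -> \bar R}) (f : T -> R[i]).

Definition cmeasurable f :=
  measurable_fun setT (fun t => complex.Re (f t)) /\
  measurable_fun setT (fun t => complex.Im (f t)).

Definition cabs (z : R[i]) : R := ComplexField.Normc.normc z.

Definition cintegrable mu f :=
  cmeasurable f /\ (\int[mu]_t (cabs (f t))%:E < +oo)%E.

Definition cintegral mu f : R[i] :=
  Complex (Rintegral mu setT (fun t => complex.Re (f t)))
          (Rintegral mu setT (fun t => complex.Im (f t))).

End complex_integral.

Section hyperbolic_space.
Variables (R : realType) (n : nat).
Local Notation vec := 'cV[R]_n.+1.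
Local Notation mat := 'M[R]_n.+1.
Implicit Types (x y v : vec) (A : mat).

Definition e (i : 'I_n.+1) : vec := delta_mx i 0.

Definition lform x y : R :=
  x ord_max 0 * y ord_max 0 - \sum_(i < n.+1 | i != ord_max) x i 0 * y i 0.

Definition hyperboloid : set vec :=
  [set x | lform x x = 1 /\ 0 < x ord_max 0].

Definition hdist x y : R := arcosh (lform x y).

Definition coordspan (P : pred 'I_n.+1) : {vspace vec} :=
  <<[seq e i | i <- enum P]>>%VS.

(* {A in SO(n) : A fixes every e_i outside span(e_(n-m+1), ..., e_n)},
   i.e. SO(m) acting on R^m inside R^(n+1) *)
Definition SO (m : nat) : set mat :=
  [set A | [/\ A^T *m A = 1%:M, \det A = 1 &
    forall i : 'I_n.+1, ~~ (n - m <= i < n)%N -> A *m e i = e i]].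

(* the identity component SO_0(n,1) of the group preserving lform *)
Definition SO1 : set mat :=
  [set A | [/\ forall x y, lform (A *m x) (A *m y) = lform x y,
               \det A = 1 & 0 < A ord_max ord_max]].

(* hrot i r is g_(i+1,n+1)(r), for i != ord_max *)
Definition hrot (i : 'I_n.+1) (r : R) : mat :=
  \matrix_(a, b)
    if a == b then (if (a == i) || (a == ord_max) then cosh r else 1)
    else if ((a == i) && (b == ord_max)) || ((a == ord_max) && (b == i))
         then sinh r else 0.

Definition is_geodesic (d : nat) : set (set vec) :=
  [set T | T !=set0 /\ exists2 V : {vspace vec},
    \dim V = d.+1 & T = hyperboloid `&` [set x | x \in V]].

Definition Hsub (d : nat) : set vec :=
  hyperboloid `&` [set x | x \in coordspan (fun i => (n - d <= i)%N)].

(* Borel sets of matrices, as the product sigma-algebra of the entries *)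
Definition entry_sets : set (set mat) :=
  [set S | exists a b, exists2 B : set R,
    measurable B & S = (fun A : mat => A a b) @^-1` B].

Definition matB := g_sigma_algebraType entry_sets.

Definition is_haar (m : nat) (mu : probability matB R) :=
  mu (SO m) = 1%E /\
  forall (A : mat) (B : set matB), SO m A -> measurable B ->
    mu ((fun X : mat => A *m X) @^-1` B) = mu B.

End hyperbolic_space.

Arguments hyperboloid : clear implicits.
Arguments SO : clear implicits.
Arguments SO1 : clear implicits.
Arguments is_geodesic : clear implicits.
Arguments Hsub : clear implicits.
Arguments entry_sets : clear implicits.

Section geodesics.
Variables (R : realType) (n : nat).
Local Notation vec := 'cV[R]_n.+1.
Local Notation mat := 'M[R]_n.+1.
Local Notation last := (@ord_max n).

Lemma e_inj : injective (@e R n).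
Proof.
move=> a b /matrixP/(_ a 0); rewrite !mxE !eqxx andbT.
by case: eqP => // _ /eqP; rewrite oner_eq0.
Qed.

Lemma e_free : free [seq e R i | i <- enum 'I_n.+1].
Proof.
have -> : [seq e R i | i <- enum 'I_n.+1] = [tuple e R i | i < n.+1].
  by [].
apply/freeP => k hk i; have /matrixP/(_ i 0) := hk.
rewrite mxE summxE (bigD1 i) // big1 => [|l li]; last first.
  by rewrite -tnth_nth tnth_mktuple !mxE eq_sym (negbTE li) mulr0.
by rewrite -tnth_nth tnth_mktuple !mxE !eqxx /= mulr1 addr0.
Qed.

Lemma dim_coordspan (P : pred 'I_n.+1) : \dim (coordspan R P) = #|P|.
Proof.
have fP : free [seq e R i | i <- enum P].
  have /perm_free <- : perm_eq
      [seq v <- [seq e R i | i <- enum 'I_n.+1] | v \in [seq e R i | i <- enum P]]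
      [seq e R i | i <- enum P].
    have U := free_uniq e_free.
    apply: uniq_perm; first exact: filter_uniq.
      by rewrite (map_inj_uniq e_inj) enum_uniq.
    move=> v; rewrite mem_filter andbC; case: (boolP (v \in [seq e R i | i <- enum P])).
      by move=> /mapP[a _ ->]; rewrite map_f ?mem_enum.
    by rewrite andbF.
  exact/filter_free/e_free.
by rewrite /coordspan (eqP fP) size_map cardE.
Qed.

Lemma Hsub_geodesic (d : 'I_n) : is_geodesic R n d (Hsub R n d).
Proof.
have dn := ltn_ord d.
split.
  exists (e R ord_max); split; last first.
    by apply/memv_span/map_f; rewrite mem_enum unfold_in /= leq_subr.
  split; last by rewrite mxE !eqxx ltr01.
  rewrite /lform mxE !eqxx mulr1 big1 ?subr0// => i im.
  by rewrite mxE (negbTE im) mul0r.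
exists (coordspan R (fun i => (n - d <= i)%N)) => //.
rewrite dim_coordspan -sum1_card.
rewrite -(big_geq_mkord _ _ predT (fun=> 1%N)).
by rewrite sum_nat_const_nat muln1 subnBA ?(ltnW dn)// addnC addnS -addSn addnK.
Qed.

Definition GammaH (d : 'I_n) : Type :=
  {T : set vec | T \in is_geodesic R n d}.

HB.instance Definition _ (d : 'I_n) := SubChoice.on (GammaH d).

Definition Hsub_pt (d : 'I_n) : GammaH d :=
  exist _ (Hsub R n d) (mem_set (Hsub_geodesic d)).

HB.instance Definition _ (d : 'I_n) := isPointed.Build (GammaH d) (Hsub_pt d).

(* The image A t of t under A in SO_0(n,1), which is again in GammaH d.
   For other matrices the value is t, by convention. *)
Definition act (d : 'I_n) (A : mat) (t : GammaH d) : GammaH d :=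
  if A \in SO1 R n then insubd t ((fun x : vec => A *m x) @` \val t) else t.

(* Borel sets of GammaH d as the homogeneous space of SO_0(n,1): the
   sigma-algebra coinduced by the orbit map A |-> A H^d *)
Definition GammaH_measurable (d : 'I_n) : set (set (GammaH d)) :=
  [set S | measurable ((fun A => act A (Hsub_pt d)) @^-1` S : set (matB R n))].

Lemma GammaH_measurable0 d : @GammaH_measurable d set0.
Proof. by rewrite /GammaH_measurable /= preimage_set0; exact: measurable0. Qed.

Lemma GammaH_measurableC d S :
  @GammaH_measurable d S -> @GammaH_measurable d (~` S).
Proof.
by rewrite /GammaH_measurable /= preimage_setC => ?; exact: measurableC.
Qed.

Lemma GammaH_measurable_bigcup d (F : (set (GammaH d))^nat) :
  (forall i, GammaH_measurable (F i)) -> GammaH_measurable (\bigcup_i F i).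
Proof.
move=> mF; rewrite /GammaH_measurable /= preimage_bigcup.
by apply: bigcup_measurable => i _; exact: mF.
Qed.

HB.instance Definition _ (d : 'I_n) :=
  @isMeasurable.Build default_measure_display (GammaH d)
    (@GammaH_measurable d) (@GammaH_measurable0 d)
    (@GammaH_measurableC d) (@GammaH_measurable_bigcup d).

Lemma measurable_orbit (d : 'I_n) :
  measurable_fun setT (fun A : matB R n => act A (Hsub_pt d)).
Proof. by move=> _ S mS; rewrite setTI; exact: mS. Qed.

Lemma measurable_entry (a b : 'I_n.+1) :
  measurable_fun setT (fun A : matB R n => (A : mat) a b).
Proof.
move=> _ B mB; rewrite setTI; apply: sub_sigma_algebra.
by exists a, b, B.
Qed.

Lemma measurable_toMat d0 (T : measurableType d0) (F : T -> matB R n) :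
  (forall a b, measurable_fun setT (fun t => (F t : mat) a b)) ->
  measurable_fun setT F.
Proof.
move=> mF; refine (@measurability _ _ _ (matB R n) setT F (entry_sets R n) erefl _).
move=> _ [_ [a [b [B mB ->]]] <-].
by have := mF a b measurableT B mB; rewrite !setTI.
Qed.

Lemma measurable_cosh : measurable_fun setT (@cosh R).
Proof.
apply: measurable_funM; last exact: measurable_cst.
apply: measurable_funD; first exact: measurable_expR.
by apply: (measurableT_comp (@measurable_expR R)).
Qed.

Lemma measurable_sinh : measurable_fun setT (@sinh R).
Proof.
apply: measurable_funM; last exact: measurable_cst.
apply: measurable_funB; first exact: measurable_expR.
by apply: (measurableT_comp (@measurable_expR R)).
Qed.

Lemma measurable_hrot (i : 'I_n.+1) :
  measurable_fun setT (fun r : R => hrot i r : matB R n).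
Proof.
apply: measurable_toMat => a b; under eq_fun do rewrite mxE.
case: (a == b).
  case: (_ || _); [exact: measurable_cosh | exact: measurable_cst].
case: (_ || _); [exact: measurable_sinh | exact: measurable_cst].
Qed.

(* e_(n-d), as a 0-based index *)
Definition idx (d : 'I_n) : 'I_n.+1 := widen_ord (leqnSn n) (rev_ord d).

Definition polar_map (d : 'I_n) (p : R * matB R n) : GammaH d :=
  act ((p.2 : mat) *m hrot (idx d) p.1) (Hsub_pt d).

Lemma measurable_polar_map (d : 'I_n) : measurable_fun setT (@polar_map d).
Proof.
pose F := fun p : R * matB R n => ((p.2 : mat) *m hrot (idx d) p.1 : matB R n).
suff mF : measurable_fun setT F.
  exact: (measurableT_comp (@measurable_orbit d) mF).
apply: measurable_toMat => a b; under eq_fun do rewrite mxE.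
apply: measurable_sum => l; apply: measurable_funM.
  exact: (measurableT_comp (measurable_entry a l) measurable_snd).
apply: (measurableT_comp (measurable_entry l b)).
exact: (measurableT_comp (measurable_hrot (idx d)) measurable_fst).
Qed.

Definition radial_weight (m d : nat) (r : R) : R :=
  sphere_area R (m - d) * sinh r ^+ (m - d - 1) * cosh r ^+ d.

Lemma sphere_area_ge0 m : 0 <= sphere_area R m.
Proof.
rewrite /sphere_area divr_ge0 ?mulr_ge0 ?powR_ge0//.
by apply: Rintegral_ge0 => t _; rewrite mulr_ge0 ?powR_ge0 ?expR_ge0.
Qed.

Lemma radial_weight_ge0 m d r : 0 <= r -> 0 <= radial_weight m d r.
Proof.
move=> r0; have cr : 0 <= cosh r by rewrite /cosh divr_ge0// addr_ge0 ?expR_ge0.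
have sr : 0 <= sinh r.
  by rewrite /sinh divr_ge0// subr_ge0 ler_expR (le_trans _ r0)// oppr_le0.
apply: mulr_ge0; last exact: exprn_ge0.
by apply: mulr_ge0; [exact: sphere_area_ge0 | exact: exprn_ge0].
Qed.

Lemma measurable_radial_weight m d : measurable_fun setT (radial_weight m d).
Proof.
apply: measurable_funM; last by apply: measurable_funX; exact: measurable_cosh.
apply: measurable_funM; first exact: measurable_cst.
by apply: measurable_funX; exact: measurable_sinh.
Qed.

Definition radial (m d : nat) (A : set R) : \bar R :=
  (\int[@lebesgue_measure R]_(r in A `&` `[0%R, +oo[) (radial_weight m d r)%:E)%E.

Let radial0 m d : radial m d set0 = 0%E.
Proof. by rewrite /radial set0I integral_set0. Qed.

Let radial_ge0 m d A : (0 <= radial m d A)%E.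
Proof.
apply: integral_ge0 => r [_ /=]; rewrite in_itv/= andbT => r0.
by rewrite lee_fin radial_weight_ge0.
Qed.

Let radial_sigma_additive m d : semi_sigma_additive (radial m d).
Proof.
move=> F mF tF mUF; rewrite /radial setI_bigcupl ge0_integral_bigcup//=.
- apply: is_cvg_ereal_nneg_natsum_cond => i _ _; exact: (radial_ge0 m d).
- by move=> i; apply: measurableI => //; exact: mF.
- apply/measurable_EFinP; apply: measurable_funTS; exact: measurable_radial_weight.
- by move=> r [i _ [_ /=]]; rewrite in_itv/= andbT => r0; rewrite lee_fin radial_weight_ge0.
- exact: trivIset_setIr.
Qed.

HB.instance Definition _ m d := isMeasure.Build _ _ _
  (radial m d) (radial0 m d) (@radial_ge0 m d) (@radial_sigma_additive m d).

(* The measure on GammaH d carried by the d-dimensional geodesic submanifolds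
   of H^m (H^n when m = n):
     int psi = sigma_(m-d-1) int_0^oo (sinh r)^(m-d-1) (cosh r)^d
                 int_SO(m) psi(alpha g_(n-d,n+1)(r) H^d) dalpha dr *)
Definition polar_measure (m : nat) (d : 'I_n) (haar : probability (matB R n) R)
  : set (GammaH d) -> \bar R :=
  pushforward (radial m d \x haar)%E (@polar_map d).
Arguments polar_measure : clear implicits.

Section polar_measure_instance.
Variables (m : nat) (d : 'I_n) (haar : probability (matB R n) R).

Let polar0 : polar_measure m d haar set0 = 0%E.
Proof. by rewrite /polar_measure /pushforward preimage_set0 measure0. Qed.

Let polar_ge0 (A : set (GammaH d)) : (0 <= polar_measure m d haar A)%E.
Proof. by apply: measure_ge0; exact: measurable_polar_map. Qed.

Let polar_sigma_additive :
  semi_sigma_additive (polar_measure m d haar).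
Proof.
by apply: measure_semi_sigma_additive; exact: measurable_polar_map.
Qed.

HB.instance Definition _ := isMeasure.Build _ _ _
  (polar_measure m d haar)
  polar0 polar_ge0 polar_sigma_additive.

End polar_measure_instance.

(* the normalized invariant measure on GammaH d, given Haar measure on SO(n) *)
Definition dt (d : 'I_n) (haar : probability (matB R n) R)
  : {measure set (GammaH d) -> \bar R} := polar_measure n d haar.

(* For d = 0: the arc length of H^1, transported from the unit-speed
   parametrization rho |-> g_(n,n+1)(rho) e_(n+1), rho in R *)
Definition line_map (d : 'I_n) (rho : measurableTypeR R) : GammaH d :=
  act (hrot (idx d) rho) (Hsub_pt d).

Lemma measurable_line_map (d : 'I_n) : measurable_fun setT (@line_map d).
Proof.
exact: (measurableT_comp (@measurable_orbit d) (measurable_hrot (idx d))).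
Qed.

Definition line_measure (d : 'I_n) : set (GammaH d) -> \bar R :=
  pushforward (@lebesgue_measure R) (@line_map d).

Section line_measure_instance.
Variable d : 'I_n.

Let line0 : @line_measure d set0 = 0%E.
Proof. by rewrite /line_measure /pushforward preimage_set0 measure0. Qed.

Let line_ge0 (A : set (GammaH d)) : (0 <= line_measure A)%E.
Proof. by apply: measure_ge0; exact: measurable_line_map. Qed.

Let line_sigma_additive : semi_sigma_additive (@line_measure d).
Proof.
by apply: measure_semi_sigma_additive; exact: measurable_line_map.
Qed.

HB.instance Definition _ := isMeasure.Build _ _ _ (@line_measure d)
  line0 line_ge0 line_sigma_additive.

End line_measure_instance.

(* dm on the j-dimensional geodesic submanifolds of H^k, j < k.  When k = 1,
   hence j = 0, the polar formula fails because SO(1) is trivial. *)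
Definition dm (k j : 'I_n) (haar : probability (matB R n) R)
  : {measure set (GammaH j) -> \bar R} :=
  if k == 1%N :> nat then @line_measure j : {measure set (GammaH j) -> \bar R}
  else polar_measure k j haar : {measure set (GammaH j) -> \bar R}.

Definition gdist (d : 'I_n) (t : GammaH d) : R :=
  inf [set hdist (e R last) x | x in \val t].

Definition wnorm (d : 'I_n) (mu : {measure set (GammaH d) -> \bar R})
    (lam : R) (f : GammaH d -> R[i]) : \bar R :=
  (\int[mu]_t (cabs (f t) * cosh (gdist t) `^ (- lam))%:E)%E.

Definition L1 (d : 'I_n) (mu : {measure set (GammaH d) -> \bar R})
    (lam : R) : set (GammaH d -> R[i]) :=
  [set f | cmeasurable f /\ (wnorm mu lam f < +oo)%E].

(* R^n is embedded in R^(n+1) as the vectors with last coordinate 0 *)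
Definition dot (x y : vec) : R := (x^T *m y) 0 0.
Definition enorm (x : vec) : R := Num.sqrt (dot x x).

Definition Rk (k : nat) : {vspace vec} :=
  coordspan R (fun i => (n - k <= i < n)%N).

(* gamma is admissible in the definition of (R_H f)(z) *)
Definition is_frame (k : 'I_n) (z : GammaH k) : set mat :=
  [set gamma | SO R n n gamma /\ exists (eta : {vspace vec}) (v : vec),
    [/\ \dim eta = k,
        forall x, x \in eta -> x last 0 = 0 /\ dot x v = 0,
        v last 0 = 0 /\ enorm v < 1,
        \val z = hyperboloid R n `&`
          [set x | forall W : {vspace vec},
             (forall y, y \in eta -> y + v + e R last \in W) -> x \in W] &
        (fun x : vec => gamma *m x) @` [set x | x \in Rk k] =
          [set x | x \in eta] /\
        (v != 0 -> gamma *m e R (idx k) = (enorm v)^-1 *: v)]].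

(* R_H f does not depend on the admissible gamma, so any choice serves *)
Definition frame (k : 'I_n) (z : GammaH k) : mat := xget 1%:M (is_frame z).

Section radon.
Variables (k j : 'I_n) (haar : probability (matB R n) R).

Definition pullback (f : GammaH j -> R[i]) (z : GammaH k) : GammaH j -> R[i] :=
  fun t => f (act (frame z *m hrot (idx k) (gdist z)) t).

Definition RH_exists (f : GammaH j -> R[i]) (z : GammaH k) : Prop :=
  cintegrable (dm k j haar) (pullback f z).

Definition RH (f : GammaH j -> R[i]) (z : GammaH k) : R[i] :=
  cintegral (dm k j haar) (pullback f z).

End radon.

End geodesics.

(* Main.v *)
(* In polar coordinates, the point nearest to the origin of a j-dimensional t
   inside z, where t is at distance s from the base point of z and ||z|| = r,
   lies at distance q with cosh q = cosh r cosh s: a product of two boosts is a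
   rotation times one boost.  Averaging |f| over K and using the invariance of
   Haar measure, the weighted norm of R_H |f| becomes a double integral of
   Phi (cosh r cosh s), where Phi (cosh q) is the mean of |f| over ||t|| = q.
   With tanh s = u sinh r one has tanh q = tanh r sqrt (1 + u^2), so that the
   variables separate, and discarding the constraint on u leaves the weighted
   norm of f times the integral of 1 / (1 + u^2), which is pi / 2.
   For the sharpness, f t = (cosh ||t||)^(1 - k) has a finite norm for every
   lambda > n - k, but its integral over z has a radial density behaving like
   (tanh s)^(k - j - 1), which is not integrable at infinity. *)
Require Import Defs.
From HB Require Import structures.
From mathcomp Require Import all_boot all_order all_algebra.
From mathcomp Require Import complex.
From mathcomp Require Import all_classical all_reals all_analysis.
From mathcomp Require Import measurable_realfun.
From mathcomp Require Import ring lra zify.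
Set Implicit Arguments.
Unset Strict Implicit.
Unset Printing Implicit Defensive.
Import Order.TTheory GRing.Theory Num.Theory.
Import numFieldNormedType.Exports.
Local Open Scope classical_set_scope.
Local Open Scope ring_scope.

(** * Hyperbolic functions and the radial inequality *)

(** Two obstacles lie outside the radial estimate. [RH haark f z] uses a frame picked by [xget],
    with no regularity, so its measurability in z is not visible from the definition. It holds
    because [dm k j haark] is invariant under every h in K preserving R^k ([dm_stab]): the chosen
    frame may be replaced by any [aligned] matrix, and [align] produces one by an explicit
    measurable formula. Such an h may act on R^k with determinant -1, and [is_haar] grants left
    invariance only; right invariance and invariance under conjugation by a reflection come from
    [haar_twist]. The other obstacle is that the constants contain [Gamma], a [Rintegral], whose
    value is 0 when the integral diverges; dividing by sigma_(n-j-1) requires that this integral be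
    finite and positive. The case k = 1, where [dm] is arc length, is treated in parallel. The
    factor 2 in the final constant comes from bounding |z| by |Re z| + |Im z|. *)

Section hyperbolic_functions.
Context {R : realType}.
Implicit Types r x : R.

Lemma cosh_sqrE r : cosh r ^+ 2 = 1 + sinh r ^+ 2.
Proof.
have e : expR r * expR (- r) = 1 by rewrite -expRD subrr expR0.
rewrite /cosh /sinh; set a := expR r in e *; set b := expR (- r) in e *.
transitivity (a * b + ((a - b) / 2) ^+ 2); last by rewrite e.
lra.
Qed.

Lemma sinh0 : sinh 0 = 0 :> R.
Proof. by rewrite /sinh oppr0 subrr mul0r. Qed.

Lemma cosh0 : cosh 0 = 1 :> R.
Proof. by rewrite /cosh oppr0 expR0; field. Qed.

Lemma sinhN r : sinh (- r) = - sinh r.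
Proof. by rewrite /sinh opprK -mulNr opprB. Qed.

Lemma coshN r : cosh (- r) = cosh r.
Proof. by rewrite /cosh opprK addrC. Qed.

Lemma cosh_gt0 r : 0 < cosh r.
Proof. by rewrite /cosh divr_gt0// addr_gt0// expR_gt0. Qed.

Lemma cosh_ge0 r : 0 <= cosh r.
Proof. exact/ltW/cosh_gt0. Qed.

Lemma cosh_ge1 r : 1 <= cosh r.
Proof.
rewrite -(@ler_pXn2r _ 2)// ?nnegrE ?cosh_ge0//.
by rewrite expr1n cosh_sqrE lerDl sqr_ge0.
Qed.

Lemma cosh_neq0 r : cosh r != 0.
Proof. by rewrite gt_eqF// cosh_gt0. Qed.

Lemma sinh_ge0 r : 0 <= r -> 0 <= sinh r.
Proof.
move=> r0; rewrite /sinh divr_ge0// subr_ge0 ler_expR; lra.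
Qed.

Lemma sinh_gt0 r : 0 < r -> 0 < sinh r.
Proof.
move=> r0; rewrite /sinh divr_gt0// subr_gt0 ltr_expR; lra.
Qed.

Lemma cosh_le_expR r : 0 <= r -> cosh r <= expR r.
Proof.
move=> r0; have : expR (- r) <= expR r by rewrite ler_expR; lra.
rewrite /cosh; lra.
Qed.

Lemma norm_sinh_le_cosh r : `|sinh r| <= cosh r.
Proof.
have c0 := cosh_ge0 r.
by rewrite -(ger0_norm c0) -ler_sqr ?nnegrE// !real_normK ?num_real// cosh_sqrE lerDr.
Qed.

Lemma coshK r : 0 <= r -> arcosh (cosh r) = r.
Proof.
move=> r0; rewrite /arcosh cosh_sqrE addrAC subrr add0r sqrtr_sqr.
rewrite ger0_norm ?sinh_ge0//.
rewrite (_ : _ + _ = expR r) ?expRK// /cosh /sinh; lra.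
Qed.

Lemma arcosh_ge0 x : 1 <= x -> 0 <= arcosh x.
Proof.
move=> x1; rewrite /arcosh ln_ge0//.
by rewrite (le_trans x1)// lerDl sqrtr_ge0.
Qed.

Lemma arcoshK x : 1 <= x -> cosh (arcosh x) = x.
Proof.
move=> x1; rewrite /arcosh /cosh expRN lnK; last first.
  by rewrite posrE (lt_le_trans ltr01)// (le_trans x1)// lerDl sqrtr_ge0.
have x21 : 0 <= x ^+ 2 - 1 by rewrite subr_ge0 -[leLHS](expr1n _ 2) ler_sqr// nnegrE; lra.
have := sqrtr_ge0 (x ^+ 2 - 1); have := sqr_sqrtr x21; move: (Num.sqrt _) => s s2 s0.
have xs : x + s != 0 by rewrite gt_eqF//; lra.
rewrite (_ : (x + s)^-1 = x - s); first by field.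
apply: (mulfI xs); rewrite divff//.
lra.
Qed.

Lemma ler_arcosh x y : 1 <= x -> x <= y -> arcosh x <= arcosh y.
Proof.
move=> x1 xy; rewrite /arcosh ler_ln ?posrE.
- apply: lerD => //; apply: ler_wsqrtr; rewrite lerD2r ler_sqr// nnegrE; lra.
- by rewrite ltr_pwDl ?sqrtr_ge0//; lra.
- by rewrite ltr_pwDl ?sqrtr_ge0//; lra.
Qed.

(** The point (x, y) of the hyperbola has parameter ln (x + y), a genuine logarithm because |x| <
    y. *)
Lemma arcosh_exist x y : y ^+ 2 = 1 + x ^+ 2 -> 0 < y ->
  exists r, sinh r = x /\ cosh r = y.
Proof.
move=> yx y0; exists (ln (x + y)).
have xy : 0 < y + x.
  have : - x < y; last by lra.
  rewrite (le_lt_trans (ler_norm _))// normrN.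
  by rewrite -[ltRHS]gtr0_norm// -ltr_sqr ?nnegrE// !real_normK ?num_real// yx ltrDr.
have e1 : expR (ln (x + y)) = x + y by rewrite lnK// posrE addrC.
have e2 : expR (- ln (x + y)) = y - x.
  rewrite expRN e1; apply: (mulfI (lt0r_neq0 xy)).
  have -> : (y + x) * (y - x) = y ^+ 2 - x ^+ 2 by ring.
  by rewrite addrC divff ?yx 1?addrC ?gt_eqF// 1?addrC//; ring.
by rewrite /sinh /cosh e1 e2; split; lra.
Qed.

Definition tanh r := sinh r / cosh r.

Lemma sub1_tanh_sqr r : 1 - tanh r ^+ 2 = (cosh r ^+ 2)^-1.
Proof.
have := cosh_sqrE r; have := cosh_neq0 r.
rewrite /tanh; set s := sinh r; set c := cosh r => c0 cs.
have -> : 1 - (s / c) ^+ 2 = (c ^+ 2 - s ^+ 2) / c ^+ 2 by field.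
by rewrite cs addrK mul1r.
Qed.

Lemma tanh_lt1 r : tanh r < 1.
Proof.
rewrite /tanh ltr_pdivrMr ?cosh_gt0// mul1r /sinh /cosh.
have := expR_gt0 (- r); lra.
Qed.

Lemma tanh_ge0 r : 0 <= r -> 0 <= tanh r.
Proof. by move=> r0; rewrite /tanh divr_ge0 ?sinh_ge0// ltW// cosh_gt0. Qed.

Lemma tanh_gt0 r : 0 < r -> 0 < tanh r.
Proof. by move=> r0; rewrite /tanh divr_gt0 ?sinh_gt0// cosh_gt0. Qed.

Lemma measurable_tanh : measurable_fun setT tanh.
Proof.
rewrite (_ : tanh = fun r => sinh r * (cosh r)^-1)//.
apply: measurable_funM; first exact: measurable_sinh.
apply: (measurable_comp (F := [set x : R | x != 0])) => //.
- by apply: open_measurable; exact: open_neq.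
- by move=> _ [r _ <-]; exact: cosh_neq0.
- apply: open_continuous_measurable_fun; first exact: open_neq.
  by move=> x; rewrite inE /= => x0; exact: inv_continuous.
- exact: measurable_cosh.
Qed.

#[global] Instance is_derive_sinh r : is_derive r (1 : R) (@sinh R) (cosh r).
Proof.
rewrite /sinh /cosh; apply: is_derive_eq; rewrite /GRing.scale/=; ring.
Qed.

#[global] Instance is_derive_cosh r : is_derive r (1 : R) (@cosh R) (sinh r).
Proof.
rewrite /sinh /cosh; apply: is_derive_eq; rewrite /GRing.scale/=; ring.
Qed.

#[global] Instance is_derive_tanh r : is_derive r (1 : R) tanh (cosh r ^- 2).
Proof.
have c0 := cosh_neq0 r.
have dV : is_derive r (1 : R) (fun x => (cosh x)^-1) (- (cosh r) ^- 2 *: sinh r).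
  exact: is_deriveV.
rewrite /tanh; apply: is_derive_eq; rewrite /GRing.scale/=.
have cs := cosh_sqrE r.
transitivity ((cosh r ^+ 2 - sinh r ^+ 2) / cosh r ^+ 2); first by field.
by rewrite cs addrK mul1r.
Qed.

End hyperbolic_functions.

(** * Integration against a density *)

Section integration.
Local Open Scope ereal_scope.

Import HBNNSimple.

(** On indicators this is the hypothesis on [nu]; simple functions and monotone convergence do the
    rest. It serves for the sech^2 measure in [tanh_substitution] and for the radial part of the
    polar measures. *)
Lemma ge0_integral_density d (T : measurableType d) (R : realType)
    (mu nu : {measure set T -> \bar R}) (D : set T) (w : T -> R) :
  measurable D -> measurable_fun D w -> (forall x, D x -> (0 <= w x)%R) ->
  (forall A, measurable A -> nu A = \int[mu]_(x in A `&` D) (w x)%:E) ->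
  forall f, measurable_fun setT f -> (forall x, 0 <= f x) ->
  \int[nu]_x f x = \int[mu]_(x in D) (f x * (w x)%:E).
Proof.
move=> mD mw w0 nuE f mf f0.
have nuI A : measurable A ->
    \int[nu]_x (\1_A x)%:E = \int[mu]_(x in D) ((\1_A x)%:E * (w x)%:E).
  move=> mA; rewrite integral_indic// setIT nuE// setIC integral_mkcondr.
  by apply: eq_integral => x _; rewrite /patch indicE; case: ifP => _ /=; rewrite ?mul1e ?mul0e.
have nuS (h : {nnsfun T >-> R}) :
    \int[nu]_x (h x)%:E = \int[mu]_(x in D) ((h x)%:E * (w x)%:E).
  under [LHS]eq_integral do rewrite fimfunE -fsumEFin//.
  rewrite [LHS]ge0_integral_fsum//; last 2 first.
    - by move=> r; exact/measurable_EFinP/measurableT_comp.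
    - by move=> n x _; rewrite EFinM nnfun_muleindic_ge0.
  under [RHS]eq_integral.
    move=> x xD; rewrite fimfunE -fsumEFin// ge0_mule_fsuml; last first.
      by move=> r; rewrite EFinM nnfun_muleindic_ge0.
    over.
  rewrite [RHS]ge0_integral_fsum//; last 2 first.
    - move=> r; apply: emeasurable_funM; last exact/measurable_EFinP.
      exact/measurable_EFinP/measurableT_comp.
    - by move=> n x /w0 ?; rewrite mule_ge0// EFinM nnfun_muleindic_ge0.
  apply: eq_fsbigr => r _; rewrite (integralZl_indic _ (fun r => h @^-1` [set r]))//; last first.
    by move=> r0; rewrite preimage_nnfun0.
  rewrite nuI//.
  have [r0|r0] := leP 0%R r; last first.
    by rewrite preimage_nnfun0// !integral0_eq ?mule0// => x _; rewrite indic0 ?mulr0 ?mul0e.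
  under [RHS]eq_integral do rewrite EFinM -muleA.
  rewrite ge0_integralZl//.
    apply: emeasurable_funM; last exact/measurable_EFinP.
    exact/measurable_EFinP/measurable_funTS.
  by move=> x /w0 ?; rewrite mule_ge0// lee_fin.
pose f_ := nnsfun_approx measurableT mf.
transitivity (limn (fun n => \int[nu]_x (f_ n x)%:E)).
  rewrite -monotone_convergence//=.
  - by apply: eq_integral => x _; apply/esym/cvg_lim => //=; apply: cvg_nnsfun_approx.
  - by move=> n; exact/measurable_EFinP/measurable_funTS.
  - by move=> n x _; rewrite lee_fin.
  - by move=> x _ m n mn; rewrite lee_fin; exact/lefP/nd_nnsfun_approx.
under eq_fun do rewrite nuS.
rewrite -monotone_convergence//=.
- apply: eq_integral => x /[!inE] Dx; apply/cvg_lim => //=.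
  by apply: cvgeZr => //; apply: cvg_nnsfun_approx.
- move=> n; apply: emeasurable_funM; last exact/measurable_EFinP.
  exact/measurable_EFinP/measurable_funTS.
- by move=> n x /w0 wx; rewrite mule_ge0// lee_fin.
- by move=> x /w0 wx m n mn; rewrite lee_wpmul2r// lee_fin; exact/lefP/nd_nnsfun_approx.
Qed.

Section density_measure.
Context d (T : measurableType d) (R : realType).
Variables (mu : {measure set T -> \bar R}) (D : set T) (w : T -> R).
Hypotheses (mD : measurable D) (mw : measurable_fun setT w) (w0 : forall x, (0 <= w x)%R).

(** The three hypotheses are arguments of the definition so that a measure structure can be attached
    to the term itself. *)
Definition density_measure & measurable D & measurable_fun setT w
    & (forall x, (0 <= w x)%R) : set T -> \bar R :=
  fun A => \int[mu]_(x in A `&` D) (w x)%:E.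

Local Notation nu := (density_measure mD mw w0).

Let nu0 : nu set0 = 0.
Proof. by rewrite /density_measure set0I integral_set0. Qed.

Let nu_ge0 A : 0 <= nu A.
Proof. by apply: integral_ge0 => x _; rewrite lee_fin. Qed.

Let nu_sigma_additive : semi_sigma_additive nu.
Proof.
move=> F mF tF mUF; rewrite /density_measure setI_bigcupl ge0_integral_bigcup//=.
- apply: is_cvg_ereal_nneg_natsum_cond => i _ _; exact: nu_ge0.
- by move=> i; apply: measurableI => //; exact: mF.
- exact/measurable_EFinP/measurable_funTS.
- by move=> x _; rewrite lee_fin.
- exact: trivIset_setIr.
Qed.

HB.instance Definition _ := isMeasure.Build _ _ _ nu nu0 nu_ge0 nu_sigma_additive.

End density_measure.

End integration.

(** * The substitutions x = tanh r and x = c u in Lebesgue integrals *)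

Section tanh_substitution.
Context {R : realType}.
Local Notation lambda := (@lebesgue_measure R).

Lemma cvg_tanh : tanh r @[r --> +oo] --> (1 : R).
Proof.
apply: (@squeeze_cvgr _ _ _ _ (fun r => 1 - expR (- r)) (cst 1)).
(* The lower bound 1 - exp (-r) <= tanh r follows from cosh r - sinh r = exp (-r) and cosh r >=
   1. *)
- near=> r; apply/andP; split; last exact/ltW/tanh_lt1.
  have c1 := cosh_ge1 r; have c0 := cosh_gt0 r.
  rewrite /tanh ler_pdivlMr// mulrBl mul1r lerBlDr.
  have := expR_gt0 (- r) => e0.
  have : cosh r = sinh r + expR (- r) by rewrite /cosh /sinh; lra.
  have : expR (- r) <= expR (- r) * cosh r by rewrite ler_peMr// ltW.
  lra.
- rewrite -[X in _ --> X]subr0; apply: cvgB; first exact: cvg_cst.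
  exact: cvgr_expR.
- exact: cvg_cst.
Unshelve. all: by end_near. Qed.

(** The witness has sinh r = x / sqrt (1 - x^2) and cosh r = 1 / sqrt (1 - x^2). *)
Lemma tanh_exist (x : R) : 0 <= x -> x < 1 -> exists2 r, 0 <= r & tanh r = x.
Proof.
move=> x0 x1.
have q0 : 0 < 1 - x ^+ 2 by rewrite subr_gt0 exprn_ilt1.
set q := 1 - x ^+ 2 in q0 *.
have sq0 : 0 < Num.sqrt q by rewrite sqrtr_gt0.
have e : (Num.sqrt q)^-1 ^+ 2 = 1 + (x / Num.sqrt q) ^+ 2.
  have : Num.sqrt q ^+ 2 = q by rewrite sqr_sqrtr// ltW.
  move: (Num.sqrt q) sq0 => t t0 t2.
  have tn : t != 0 by rewrite gt_eqF.
  have -> : 1 + (x / t) ^+ 2 = (t ^+ 2 + x ^+ 2) / t ^+ 2 by field.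
  by rewrite t2 {1}/q subrK mul1r exprVn t2.
have vq0 : 0 < (Num.sqrt q)^-1 by rewrite invr_gt0.
have [r [sr cr]] := arcosh_exist e vq0.
exists r.
  rewrite leNgt; apply/negP => r0.
  have : 0 < sinh (- r) by rewrite sinh_gt0// oppr_gt0.
  by rewrite sinhN sr oppr_gt0 ltNge divr_ge0// sqrtr_ge0.
by rewrite /tanh sr cr invrK mulfVK// gt_eqF.
Qed.

Lemma ltr_tanh : {homo @tanh R : x y / x < y}.
Proof.
move=> x y xy; rewrite /tanh ltr_pdivrMr ?cosh_gt0// mulrAC ltr_pdivlMr ?cosh_gt0//.
rewrite -subr_gt0.
have -> : sinh y * cosh x - sinh x * cosh y = sinh (y - x).
  rewrite /sinh /cosh opprB !expRD; lra.
by rewrite sinh_gt0// subr_gt0.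
Qed.

Lemma continuous_cosh : continuous (@cosh R).
Proof. by move=> x; apply/differentiable_continuous/derivable1_diffP. Qed.

Lemma continuous_tanh : continuous (@tanh R).
Proof. by move=> x; apply/differentiable_continuous/derivable1_diffP. Qed.

Lemma continuous_sech_sqr : continuous (fun x : R => cosh x ^- 2).
Proof.
move=> x; under eq_fun do rewrite expr2.
apply: cvgV; first by rewrite mulf_neq0// cosh_neq0.
by apply: cvgM; exact: continuous_cosh.
Qed.

Lemma integral_sech_sqr (a : R) :
  (\int[lambda]_(x in `[a, +oo[) (cosh x ^- 2)%:E = 1 - (tanh a)%:E)%E.
Proof.
rewrite (@ge0_continuous_FTC2y _ _ (@tanh R) a 1)//.
- by move=> x _; rewrite invr_ge0 exprn_ge0// cosh_ge0.
- exact/continuous_subspaceT/continuous_sech_sqr.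
- exact: cvg_tanh.
- apply: cvg_at_right_filter; exact: continuous_tanh.
- by move=> x _; rewrite derive1E; exact: derive_val.
Qed.

(** The measure with density sech^2 on [0, +oo[ has Lebesgue measure on [0, 1[ as its image under
    tanh: both give the half-line [x, +oo[ the mass 1 - max (x, 0) for x < 1 and 0 otherwise, and
    half-lines form a generating pi-system. No continuity of G is assumed, since G will be built
    from means of an arbitrary measurable function. *)
Lemma tanh_substitution (G : R -> \bar R) :
  measurable_fun setT G -> (forall x, (0 <= G x)%E) ->
  (\int[lambda]_(x in `[0%R, +oo[) (G (tanh x) * (cosh x ^- 2)%:E) =
   \int[lambda]_(x in `[0%R, 1%R[) G x)%E.
Proof.
move=> mG G0.
have w0 (x : R) : 0 <= cosh x ^- 2 by rewrite invr_ge0 exprn_ge0// cosh_ge0.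
have mw : measurable_fun setT (fun x : R => cosh x ^- 2).
  by apply: continuous_measurable_fun; exact: continuous_sech_sqr.
have mD : measurable (`[0, +oo[%classic : set (measurableTypeR R)) by [].
have mD1 : measurable (`[0, 1[%classic : set (measurableTypeR R)) by [].
pose nu := density_measure lambda mD mw w0.
transitivity (\int[nu]_x G (tanh x))%E.
  rewrite (@ge0_integral_density _ _ _ lambda nu `[0, +oo[%classic (fun x => cosh x ^- 2))//.
  - exact: measurable_funTS.
  - by apply: (measurableT_comp mG); exact: measurable_tanh.
have mt : measurable_fun (setT : set (measurableTypeR R)) (@tanh R : _ -> measurableTypeR R).
  exact: measurable_tanh.
transitivity (\int[pushforward nu (@tanh R : _ -> measurableTypeR R)]_x G x)%E.
  by rewrite ge0_integral_pushforward.
transitivity (\int[mrestr lambda mD1]_x G x)%E; last first.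
  rewrite (@ge0_integral_density _ _ _ lambda (mrestr lambda mD1) `[0, 1[%classic (cst 1%R))//.
  - by apply: eq_integral => x _; rewrite mule1.
  - move=> A mA; have mAD : measurable (A `&` `[0%R, 1%R[%classic) by exact: measurableI.
    by rewrite (eq_integral (cst 1%E))// integral_cst// mul1e.
pose GG : set (set (measurableTypeR R)) := @RGenCInfty.G R.
pose g (n : nat) : set (measurableTypeR R) := `[- n%:R, +oo[%classic.
have nuE (a : R) : 0 <= a -> nu `[a, +oo[%classic = (1 - (tanh a)%:E)%E.
  move=> a0; rewrite -integral_sech_sqr /nu /= /density_measure setIidl//.
  by move=> x /=; rewrite !in_itv/= !andbT; exact: le_trans.
have ray (x : R) : pushforward nu (@tanh R : _ -> measurableTypeR R) `[x, +oo[%classic =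
    mrestr lambda mD1 `[x, +oo[%classic.
  have [x1|x1] := ltP x 1; last first.
    transitivity (0%E : \bar R).
      rewrite /pushforward (_ : _ @^-1` _ = set0) ?measure0// -subset0 => r /=.
      by rewrite in_itv/= andbT leNgt (lt_le_trans (tanh_lt1 r) x1).
    rewrite /mrestr (_ : _ `&` _ = set0) ?measure0// -subset0 => r [] /=.
    rewrite !in_itv/= andbT => xr /andP[_].
    by rewrite ltNge (le_trans x1 xr).
  have m0 : 0 <= Num.max x 0 by rewrite le_max lexx orbT.
  have m1 : Num.max x 0 < 1 by rewrite gt_max x1 ltr01.
  have [a a0 ta] := tanh_exist m0 m1.
  transitivity (1 - (Num.max x 0)%:E)%E; last first.
    rewrite /mrestr (_ : _ `&` _ = `[Num.max x 0, 1[%classic); last first.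
      apply/seteqP; split => r/=; rewrite !in_itv/= andbT ge_max.
        by move=> [-> /andP[-> ->]].
      by move=> /andP[/andP[-> ->] ->].
    by rewrite lebesgue_measure_itv/= lte_fin m1.
  rewrite -ta -nuE// /pushforward /nu /= /density_measure.
  congr integral; apply/seteqP; split => r /=; rewrite !in_itv/= !andbT.
    move=> [xr r0]; split => //.
    rewrite leNgt; apply/negP => /ltr_tanh; rewrite ta.
    by rewrite lt_max !ltNge xr tanh_ge0.
  move=> [ar r0]; split => //.
  have : tanh a <= tanh r by move: ar; rewrite le_eqVlt => /predU1P[->//|/ltr_tanh/ltW].
  by rewrite ta; apply: le_trans; rewrite le_max lexx.
apply: eq_measure_integral => //= A mA _.
apply: (@measure_unique _ _ (measurableTypeR R) GG g) => //.
- exact: RGenCInfty.measurableE.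
- move=> _ _ [x ->] [y ->]; exists (Num.max x y).
  apply/seteqP; split => r /=; rewrite !in_itv/= !andbT ge_max.
    by move=> [-> ->].
  by move=> /andP.
- by move=> n; exists (- n%:R).
- apply/seteqP; split => // x _.
  exists (Num.Def.archi_bound x) => //; rewrite /g /= in_itv/= andbT.
  by rewrite lerNl ltW// unstable.ltrNbound.
- by move=> _ [x ->]; exact: ray.
- move=> n; have : (mrestr lambda mD1 (g n) < +oo)%E; last by rewrite -[X in (X < _)%E]ray.
  rewrite /mrestr (@le_lt_trans _ _ (lambda `[0%R, 1%R[%classic))//.
    by apply: le_measure; rewrite ?inE//; apply: measurableI => //; exact: measurable_itv.
  by rewrite lebesgue_measure_itv/= lte_fin ltr01 -EFinB ltry.
Qed.

(** Lebesgue measure equals c times its image under multiplication by c, by uniqueness on half-open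
    intervals. *)
Lemma scaling_substitution (G : R -> \bar R) (c : R) : 0 < c ->
  measurable_fun setT G -> (forall x, (0 <= G x)%E) ->
  (\int[lambda]_(x in `[0%R, +oo[) (G (c * x)%R * c%:E) =
   \int[lambda]_(x in `[0%R, +oo[) G x)%E.
Proof.
move=> c0 mG G0.
pose phi := ( *%R c : measurableTypeR R -> measurableTypeR R).
have mphi : measurable_fun setT phi by exact: measurable_funM.
have c0' : 0 <= c by exact: ltW.
pose nu' := mscale (NngNum c0') (pushforward lambda phi); pose nu := nu' mphi.
have nuE A : measurable A -> lambda A = nu A.
  apply: lebesgue_measure_unique => _ [[a b]] _ <-.
  transitivity (c%:E * lambda (phi @^-1` `]a, b]%classic))%E; last by [].
  have -> : phi @^-1` `]a, b]%classic = `]a / c, b / c]%classic.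
    apply/seteqP; split => r/=; rewrite /phi/= !in_itv/=;
      by rewrite ltr_pdivrMr// ler_pdivlMr// mulrC.
  rewrite !lebesgue_measure_itv/= !lte_fin ltr_pM2r ?invr_gt0//.
  case: ifPn => _; last by rewrite mule0.
  by rewrite -!EFinB -EFinM -mulrBl mulrC divfK// gt_eqF.
have mD : measurable (`[0, +oo[%classic : set (measurableTypeR R)) by [].
rewrite [RHS](eq_measure_integral nu)//; last by move=> A mA _; exact: nuE.
rewrite [RHS]ge0_integral_mscale//; last exact: measurable_funTS.
rewrite [in RHS]ge0_integral_pushforward//; last exact: measurable_funTS.
rewrite ge0_integralZr//.
- rewrite muleC; congr (_ * _)%E.
  rewrite (_ : phi @^-1` _ = `[0, +oo[%classic)//.
  apply/seteqP; split => r/=; rewrite /phi/= !in_itv/= !andbT.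
    by rewrite pmulr_rge0.
  exact/mulr_ge0/ltW.
- apply: measurable_funTS; exact: (measurableT_comp mG mphi).
Qed.

End tanh_substitution.

(** The formula x^-1 = x (x^2)^-1 also holds at 0, where the inverse is 0 by convention, and it
    reduces the claim to real powers. *)
Lemma measurable_inv (R : realType) : measurable_fun setT (@GRing.inv R).
Proof.
rewrite (_ : @GRing.inv R = fun x => x * (x ^+ 2) `^ (-1)).
  apply: measurable_funM => //.
  have m2 : measurable_fun setT (fun x : R => x ^+ 2) by exact: measurable_funX.
  exact: (measurableT_comp (@measurable_powR R (-1)) m2).
apply/funext => x; rewrite powR_inv1 ?sqr_ge0//.
have [->|x0] := eqVneq x 0; first by rewrite invr0 mul0r.
by rewrite expr2 invfM mulrA divff// mul1r.
Qed.

(** * Tonelli on measurable rectangles *)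

Section restricted_tonelli.
Local Open Scope ereal_scope.
Context d1 d2 (T1 : measurableType d1) (T2 : measurableType d2) (R : realType).
Variables (m1 : {sigma_finite_measure set T1 -> \bar R})
  (m2 : {sigma_finite_measure set T2 -> \bar R}) (D1 : set T1) (D2 : set T2).
Hypotheses (mD1 : measurable D1) (mD2 : measurable D2).
Variable f : T1 * T2 -> \bar R.
Hypotheses (mf : measurable_fun setT f) (f0 : forall x, 0 <= f x).

Let g := f \_ (D1 `*` D2).

Let mg : measurable_fun setT g.
Proof.
apply/(measurable_restrictT _ _).1; first exact: measurableX.
exact: measurable_funTS.
Qed.

Let g0 x : 0 <= g x.
Proof. by rewrite /g patchE; case: ifP. Qed.

Let gE1 x : \int[m2]_y g (x, y) = ((fun x => \int[m2]_(y in D2) f (x, y)) \_ D1) x.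
Proof.
rewrite /g patchE; case: ifPn => xD.
  rewrite [RHS]integral_mkcond; apply: eq_integral => y _.
  by rewrite !patchE in_setX xD.
by apply: integral0_eq => y _; rewrite patchE in_setX (negbTE xD).
Qed.

Let gE2 y : \int[m1]_x g (x, y) = ((fun y => \int[m1]_(x in D1) f (x, y)) \_ D2) y.
Proof.
rewrite /g patchE; case: ifPn => yD.
  rewrite [RHS]integral_mkcond; apply: eq_integral => x _.
  by rewrite !patchE in_setX yD andbT.
by apply: integral0_eq => x _; rewrite patchE in_setX (negbTE yD) andbF.
Qed.

Lemma fubini_tonelli_in :
  \int[m1]_(x in D1) \int[m2]_(y in D2) f (x, y) =
  \int[m2]_(y in D2) \int[m1]_(x in D1) f (x, y).
Proof.
rewrite [LHS]integral_mkcond [RHS]integral_mkcond.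
under eq_integral do rewrite -gE1.
under [RHS]eq_integral do rewrite -gE2.
exact: fubini_tonelli.
Qed.

End restricted_tonelli.

Lemma measurable_integral_in d1 d2 (T1 : measurableType d1) (T2 : measurableType d2)
    (R : realType) (m2 : {sigma_finite_measure set T2 -> \bar R}) (D2 : set T2)
    (f : T1 * T2 -> \bar R) :
  measurable D2 -> measurable_fun setT f -> (forall x, (0 <= f x)%E) ->
  measurable_fun setT (fun x => \int[m2]_(y in D2) f (x, y))%E.
Proof.
move=> mD2 mf f0.
rewrite (_ : (fun x => _) = (fun x => \int[m2]_y (f \_ (setT `*` D2)) (x, y))%E).
  apply: measurable_fun_fubini_tonelli_F.
    apply/(measurable_restrictT _ _).1; first exact: measurableX.
    exact: measurable_funTS.
  by move=> x; rewrite patchE; case: ifP.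
apply/funext => x; rewrite integral_mkcond; apply: eq_integral => y _.
by rewrite !patchE in_setX in_setT.
Qed.

(** * The one-dimensional inequality behind the norm bound *)

Section polar_bound.
Context {R : realType}.
Local Notation lambda := (@lebesgue_measure R).
Local Notation D := (`[0%R, +oo[%classic : set R).

(** This is cosh r as a function of x = tanh r. For |x| >= 1 its value is 0, by the conventions for
    square roots and inverses. *)
Definition sech_inv (x : R) : R := (Num.sqrt (1 - x ^+ 2))^-1.

Lemma sech_inv_tanh (r : R) : sech_inv (tanh r) = cosh r.
Proof.
rewrite /sech_inv sub1_tanh_sqr -exprVn sqrtr_sqr ger0_norm ?invrK//.
by rewrite invr_ge0 cosh_ge0.
Qed.

Lemma measurable_sech_inv : measurable_fun setT sech_inv.
Proof.
apply: (measurableT_comp (@measurable_inv R)).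
apply: (measurableT_comp (continuous_measurable_fun (@sqrt_continuous R))).
by apply: measurable_funB => //; exact: measurable_funX.
Qed.

Lemma integral_inv1Dsqr :
  (\int[lambda]_(u in D) ((1 + u ^+ 2)^-1)%:E = (pi / 2)%:E)%E.
Proof.
rewrite (@ge0_continuous_FTC2y _ _ (@atan R) 0 (pi / 2)) ?atan0 ?sube0//.
- by move=> x _; rewrite invr_ge0 addr_ge0// sqr_ge0.
- apply: continuous_subspaceT => x; apply: cvgV.
    by rewrite gt_eqF// ltr_pwDl// sqr_ge0.
  by apply: cvgD; [exact: cvg_cst|exact: exprn_continuous].
- exact: cvgy_atan.
- by apply: cvg_at_right_filter; rewrite -[X in _ --> X]atan0; exact: continuous_atan.
- by move=> x _; rewrite derive1_atan.
Qed.

(** In the variable T = tanh of the distance to the origin, both sides are governed by one function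
    H on [0, 1[. With a = n - k - 1 and b = k - j - 1, the separated factor is u^b / (1 + u^2)^((a +
    b + 2) / 2), which is at most 1 / (1 + u^2) whatever the dimensions. *)
Lemma polar_bound (n k j : nat) (Phi : R -> \bar R) : (j < k < n)%N ->
  measurable_fun setT Phi -> (forall x, (0 <= Phi x)%E) ->
  (\int[lambda]_(r in D) ((\int[lambda]_(s in D)
      (Phi (cosh r * cosh s)%R * (sinh s ^+ (k - j - 1) * cosh s ^+ j)%:E)) *
      (sinh r ^+ (n - k - 1) * cosh r ^+ k / cosh r ^+ (n - j))%:E) <=
   (pi / 2)%:E * \int[lambda]_(s in D)
      (Phi (cosh s) * (sinh s ^+ (n - j - 1) * cosh s ^+ j / cosh s ^+ (n - k))%:E))%E.
Proof.
move=> /andP[jk kn] mPhi Phi0.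
have [a an] : exists a, n = (k + a.+1)%N by exists (n - k - 1)%N; lia.
have [b bk] : exists b, k = (j + b.+1)%N by exists (k - j - 1)%N; lia.
have -> : (n - k - 1 = a)%N by lia.
have -> : (k - j - 1 = b)%N by lia.
have -> : (n - k = a.+1)%N by lia.
have -> : (n - j = (a + b).+2)%N by lia.
have -> : ((a + b).+2 - 1 = (a + b).+1)%N by lia.
clear an n kn; subst k.
have c0 (x : R) : 0 <= sech_inv x by rewrite invr_ge0 sqrtr_ge0.
pose I01 (x : R) : R := \1_(`[0%R, 1%R[%classic) x.
have mI01 : measurable_fun setT I01 by apply: measurable_indic.
have I010 x : 0 <= I01 x by rewrite /I01 indicE.
have I011 x : 0 <= x -> x < 1 -> I01 x = 1.
  by move=> x0 x1; rewrite /I01 indicE mem_set//= in_itv/= x0.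
have I01_0 x : 1 <= x -> I01 x = 0.
  by move=> x1; rewrite /I01 indicE memNset//= in_itv/= ltNge x1 andbF.
(* The absolute value and the indicator make the weight nonnegative and measurable on the whole
   line, as the substitution lemmas require, and do not change it on [0, 1[. *)
pose pw (N : nat) (x : R) := (`|x| ^+ N * sech_inv x ^+ (j + b.+1).+1 * I01 x)%R.
have mpw N : measurable_fun setT (pw N).
  apply: measurable_funM => //; apply: measurable_funM; apply: measurable_funX.
    exact: normr_measurable.
  exact: measurable_sech_inv.
have pw0 N x : 0 <= pw N x.
  by rewrite /pw; apply: mulr_ge0 => //; apply: mulr_ge0; apply: exprn_ge0.
(* H (tanh s) sech^2 s is the integrand of the right-hand side. *)
pose H T := (Phi (sech_inv T) * (pw (a + b).+1 T)%:E)%E.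
have H0 T : (0 <= H T)%E by rewrite mule_ge0// lee_fin.
have mH : measurable_fun setT H.
  apply: emeasurable_funM; last exact/measurable_EFinP.
  exact: (measurableT_comp mPhi measurable_sech_inv).
pose JH := (\int[lambda]_(x in `[0%R, 1%R[) H x)%E.
have JE : (\int[lambda]_(s in D)
      (Phi (cosh s) * (sinh s ^+ (a + b).+1 * cosh s ^+ j / cosh s ^+ a.+1)%:E) = JH)%E.
  rewrite /JH -tanh_substitution//; apply: eq_integral => s.
  rewrite inE/= in_itv/= andbT => s0.
  rewrite /H sech_inv_tanh -muleA -EFinM; congr (_ * _%:E)%E.
  rewrite /pw I011 ?tanh_ge0 ?tanh_lt1// mulr1 ger0_norm ?tanh_ge0//.
  rewrite sech_inv_tanh /tanh.
  have cn := cosh_neq0 s; move: (cosh s) (sinh s) cn => c t cn.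
  have -> : (j + b.+1).+1 = (j + (b + 2))%N by lia.
  rewrite !exprS !exprD !exprMn !exprVn; field.
  by rewrite ?expf_neq0// cn.
rewrite JE.
have ms1 : measurable_fun setT (fun p : R * R => sinh p.1).
  exact: (measurableT_comp (@measurable_sinh R) (@measurable_fst _ _ R R)).
have mc1 : measurable_fun setT (fun p : R * R => cosh p.1).
  exact: (measurableT_comp (@measurable_cosh R) (@measurable_fst _ _ R R)).
have ms2 : measurable_fun setT (fun p : R * R => sinh p.2).
  exact: (measurableT_comp (@measurable_sinh R) (@measurable_snd _ _ R R)).
have mc2 : measurable_fun setT (fun p : R * R => cosh p.2).
  exact: (measurableT_comp (@measurable_cosh R) (@measurable_snd _ _ R R)).
pose B r z := (Phi (cosh r * sech_inv z)%R * (pw b z)%:E)%E.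
have mB : measurable_fun setT (fun p : R * R => B p.1 p.2).
  apply: emeasurable_funM; last first.
    by apply/measurable_EFinP; exact: (measurableT_comp (mpw b) measurable_snd).
  apply: (measurableT_comp mPhi); apply: measurable_funM.
    exact: mc1.
  exact: (measurableT_comp measurable_sech_inv (@measurable_snd _ _ R R)).
have B0 r z : (0 <= B r z)%E by rewrite mule_ge0// lee_fin.
have mBr r : measurable_fun setT (B r).
  exact: (measurableT_comp mB (measurable_pair1 r)).
(* Two substitutions in a row: z = tanh s, then z = u sinh r. *)
have inner r : 0 < r ->
   (\int[lambda]_(s in D) (Phi (cosh r * cosh s)%R * (sinh s ^+ b * cosh s ^+ j)%:E) =
    \int[lambda]_(u in D) (B r (sinh r * u)%R * (sinh r)%:E))%E.
  move=> r0; rewrite scaling_substitution ?sinh_gt0//.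
  transitivity (\int[lambda]_(x in `[0%R, 1%R[) B r x)%E; last first.
    rewrite [LHS]integral_mkcond [RHS]integral_mkcond; apply: eq_integral => x _.
    rewrite !patchE !mem_setE !in_itv/= andbT; case: leP => //= x0; case: ltP => // x1.
    by rewrite /B /pw I01_0// mulr0 mule0.
  rewrite -tanh_substitution//; apply: eq_integral => s.
  rewrite inE/= in_itv/= andbT => s0.
  rewrite /B sech_inv_tanh -muleA -EFinM; congr (_ * _%:E)%E.
  rewrite /pw I011 ?tanh_ge0 ?tanh_lt1// mulr1 ger0_norm ?tanh_ge0//.
  rewrite sech_inv_tanh /tanh.
  have cn := cosh_neq0 s; move: (cosh s) (sinh s) cn => c t cn.
  have -> : (j + b.+1).+1 = (j + (b + 2))%N by lia.
  rewrite !exprD !exprMn !exprVn; field.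
  by rewrite ?expf_neq0// cn.
pose K (p : R * R) := (B p.1 (sinh p.1 * p.2)%R *
  (`|sinh p.1| ^+ a.+1 * cosh p.1 ^+ (j + b.+1) / cosh p.1 ^+ (a + b).+2)%:E)%E.
have K0 p : (0 <= K p)%E.
  rewrite mule_ge0// lee_fin.
  by apply: divr_ge0; [apply: mulr_ge0|]; apply: exprn_ge0 => //; exact: cosh_ge0.
have mK : measurable_fun setT K.
  apply: emeasurable_funM.
    have mq : measurable_fun setT (fun p : R * R => (p.1, sinh p.1 * p.2)).
      by apply: measurable_fun_pair => //; exact: measurable_funM.
    exact: (measurableT_comp mB mq).
  apply/measurable_EFinP; apply: measurable_funM.
    apply: measurable_funM; apply: measurable_funX => //.
    exact: (measurableT_comp (@normr_measurable _ setT) ms1).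
  apply: (measurableT_comp (@measurable_inv R)); exact: measurable_funX.
have step1 : (\int[lambda]_(r in D)
     (\int[lambda]_(s in D) (Phi (cosh r * cosh s)%R * (sinh s ^+ b * cosh s ^+ j)%:E) *
      (sinh r ^+ a * cosh r ^+ (j + b.+1) / cosh r ^+ (a + b).+2)%:E) =
   \int[lambda]_(r in `]0%R, +oo[) \int[lambda]_(u in D) K (r, u))%E.
  (* Dropping the null point r = 0 makes sinh r positive, as the rescaling in [inner] requires. *)
  rewrite -integral_itv_obnd_cbnd.
    apply: eq_integral => r; rewrite inE/= in_itv/= andbT => r0.
    rewrite inner// -ge0_integralZr//.
    - apply: eq_integral => u _; rewrite /K/= -muleA -EFinM gtr0_norm ?sinh_gt0//.
      by rewrite (exprS _ a) !mulrA.
    - apply: measurable_funTS; apply: emeasurable_funM => //.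
      apply: (measurableT_comp (mBr r)); exact: measurable_funM.
    - by move=> u _; rewrite mule_ge0// lee_fin sinh_ge0// ltW.
    - rewrite lee_fin; apply: divr_ge0; [apply: mulr_ge0|]; apply: exprn_ge0;
        rewrite ?cosh_ge0//; exact/sinh_ge0/ltW.
  apply: measurable_funTS; apply: emeasurable_funM.
    pose f (p : R * R) := (Phi (cosh p.1 * cosh p.2)%R * (`|sinh p.2| ^+ b * cosh p.2 ^+ j)%:E)%E.
    have mf : measurable_fun setT f.
      apply: emeasurable_funM.
        by apply: (measurableT_comp mPhi); apply: measurable_funM.
      apply/measurable_EFinP; apply: measurable_funM; apply: measurable_funX => //.
      exact: (measurableT_comp (@normr_measurable _ setT) ms2).
    have f0 p : (0 <= f p)%E.
      rewrite mule_ge0// lee_fin.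
      by apply: mulr_ge0; apply: exprn_ge0 => //; exact: cosh_ge0.
    rewrite (_ : (fun x => _) = (fun x => \int[lambda]_(y in D) f (x, y))%E).
      exact: measurable_integral_in.
    apply/funext => x; apply: eq_integral => s; rewrite inE/= in_itv/= andbT => s0.
    by rewrite /f/= ger0_norm// sinh_ge0.
  apply/measurable_EFinP; apply: measurable_funM.
    apply: measurable_funM; apply: measurable_funX.
      exact: measurable_sinh.
    exact: measurable_cosh.
  apply: (measurableT_comp (@measurable_inv R)); apply: measurable_funX.
  exact: measurable_cosh.
rewrite step1 fubini_tonelli_in//.
have HI : (\int[lambda]_(x in D) H x)%E = JH.
  rewrite /JH [LHS]integral_mkcond [RHS]integral_mkcond; apply: eq_integral => x _.
  rewrite !patchE !mem_setE !in_itv/= andbT; case: leP => //= x0; case: ltP => // x1.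
  by rewrite /H /pw I01_0// mulr0 mule0.
have JH0 : (0 <= JH)%E by exact: integral_ge0.
pose q (u : R) := Num.sqrt (1 + u ^+ 2).
have Dq u : 0 < 1 + u ^+ 2 :> R by rewrite ltr_pwDl// sqr_ge0.
have q0 u : 0 < q u by rewrite sqrtr_gt0.
have q2 u : q u ^+ 2 = 1 + u ^+ 2 by rewrite sqr_sqrtr// ltW.
pose kap (u : R) := u ^+ b / q u ^+ (a + b).+1.
(* The separation rests on 1 - (q tanh r)^2 = (1 - (u sinh r)^2) / (cosh r)^2, where q = sqrt (1 +
   u^2). It also shows that q tanh r and u sinh r reach 1 together, so that both sides vanish
   simultaneously. *)
have KE r u : 0 < r -> 0 <= u ->
    K (r, u) = ((kap u)%:E * (H (q u * tanh r)%R * (cosh r ^- 2)%:E))%E.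
  move=> r0 u0; have s0 := sinh_gt0 r0; have cr := cosh_neq0 r.
  have cg := cosh_gt0 r.
  rewrite /K /B /H /=.
  have qt0 : 0 <= q u * tanh r by apply: mulr_ge0; [exact: ltW|exact/tanh_ge0/ltW].
  have su0 : 0 <= sinh r * u by apply: mulr_ge0 => //; exact: ltW.
  have e2 : 1 - (q u * tanh r) ^+ 2 = (1 - (sinh r * u) ^+ 2) / cosh r ^+ 2.
    have := cosh_sqrE r; rewrite /tanh.
    move: (cosh r) (sinh r) cr => y x yn yx.
    have -> : 1 - (q u * (x / y)) ^+ 2 = (y ^+ 2 - q u ^+ 2 * x ^+ 2) / y ^+ 2 by field.
    by rewrite q2 {1}yx; congr (_ / _); ring.
  have lt_iff : (q u * tanh r < 1) = (sinh r * u < 1).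
    rewrite -[LHS](@ltr_pXn2r _ 2)// ?nnegrE// -[RHS](@ltr_pXn2r _ 2)// ?nnegrE//.
    rewrite !expr1n -subr_gt0 -[RHS]subr_gt0 e2 pmulr_lgt0// invr_gt0 exprn_gt0//.
  have [su1|su1] := ltP (sinh r * u) 1; last first.
    rewrite /pw !I01_0//; last by rewrite leNgt lt_iff -leNgt.
    by rewrite !mulr0 !mule0 !mul0e mule0.
  have cE : sech_inv (q u * tanh r) = cosh r * sech_inv (sinh r * u).
    rewrite /sech_inv e2 sqrtrM; last by rewrite subr_ge0 -[leRHS](@expr1n _ 2) ler_pXn2r ?nnegrE// ltW.
    by rewrite sqrtrV ?sqr_ge0// sqrtr_sqr ger0_norm ?ltW// invfM invrK mulrC.
  rewrite cE -!muleA [RHS]muleCA -!EFinM; congr (_ * _%:E)%E.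
  rewrite /pw !I011 ?lt_iff// !mulr1 (ger0_norm qt0) (ger0_norm su0) (gtr0_norm s0) cE /kap /tanh.
  have qn : q u != 0 by rewrite gt_eqF.
  move: (sech_inv (sinh r * u)) (q u) qn => g q1 qn.
  move: (cosh r) (sinh r) cr => y x yn.
  rewrite !exprS !exprMn !exprD !exprVn !exprS; field.
  by rewrite ?expf_neq0// yn qn.
have inner_le u : 0 <= u ->
    (\int[lambda]_(r in `]0%R, +oo[) K (r, u) <= ((1 + u ^+ 2)^-1)%:E * JH)%E.
  move=> u0.
  have kq0 : 0 <= kap u / q u.
    by apply: divr_ge0; [apply: divr_ge0; apply: exprn_ge0|] => //; exact: ltW.
  have mHq : measurable_fun setT (fun x => H (q u * x)).
    by apply: (measurableT_comp mH); exact: measurable_funM.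
  apply: (@le_trans _ _ (\int[lambda]_(r in D)
      ((kap u / q u)%:E * ((q u)%:E * H (q u * tanh r)%R * (cosh r ^- 2)%:E)))%E).
    have -> : (\int[lambda]_(r in `]0%R, +oo[) K (r, u) = \int[lambda]_(r in `]0%R, +oo[)
        ((kap u / q u)%:E * ((q u)%:E * H (q u * tanh r)%R * (cosh r ^- 2)%:E)))%E.
      apply: eq_integral => r; rewrite inE/= in_itv/= andbT => r0; rewrite KE//.
      by rewrite !muleA -EFinM divfK// gt_eqF.
    apply: ge0_subset_integral => //.
    - apply: measurable_funTS; apply: emeasurable_funM => //; apply: emeasurable_funM.
        apply: emeasurable_funM => //; exact: (measurableT_comp mHq measurable_tanh).
      by apply/measurable_EFinP; apply: continuous_measurable_fun; exact: continuous_sech_sqr.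
    - move=> r _; rewrite mule_ge0 ?lee_fin// mule_ge0// ?mule_ge0 ?lee_fin//.
        exact: ltW.
      by rewrite invr_ge0 exprn_ge0// cosh_ge0.
    - by move=> r /=; rewrite !in_itv/= !andbT; exact: ltW.
  have mqH : measurable_fun setT (fun x => (q u)%:E * H (q u * x)%R)%E.
    exact: emeasurable_funM.
  have qH0 x : (0 <= (q u)%:E * H (q u * x)%R)%E.
    by rewrite mule_ge0// lee_fin ltW.
  rewrite ge0_integralZl//; last 2 first.
    - apply: measurable_funTS; apply: emeasurable_funM.
        exact: (measurableT_comp mqH measurable_tanh).
      by apply/measurable_EFinP; apply: continuous_measurable_fun; exact: continuous_sech_sqr.
    - by move=> r _; rewrite mule_ge0// lee_fin invr_ge0 exprn_ge0// cosh_ge0.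
  rewrite (tanh_substitution mqH)//.
  (* The range [0, 1[ of tanh r is enlarged to the half-line, on which multiplication by q u is a
     change of variable. *)
  have le1 : (\int[lambda]_(x in `[0%R, 1%R[) ((q u)%:E * H (q u * x)%R) <= JH)%E.
    rewrite -HI -(scaling_substitution (q0 u))//.
    under eq_integral do rewrite muleC.
    apply: ge0_subset_integral => //.
    - by apply: measurable_funTS; exact: emeasurable_funM.
    - by move=> x _; rewrite mule_ge0// lee_fin ltW.
    - by move=> x /=; rewrite !in_itv/= => /andP[->].
  apply: lee_pmul => //.
    by apply: integral_ge0 => x _.
  (* The remaining factor is u^b / (q u)^(a + b + 2); it is at most (q u)^-2 because u <= q u and 1
     <= q u. *)
  rewrite lee_fin /kap -mulrA -invfM -exprSr -q2.
  have uq : u <= q u.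
    rewrite -(@ler_pXn2r _ 2)// ?nnegrE// ?q2 ?lerDr//; exact: ltW.
  have q1 : 1 <= q u.
    rewrite -(@ler_pXn2r _ 2)// ?nnegrE// ?q2 ?expr1n ?lerDl ?sqr_ge0//; exact: ltW.
  rewrite ler_pdivrMr ?exprn_gt0// mulrC ler_pdivlMr ?exprn_gt0//.
  have -> : (a + b).+2 = (b + (2 + a))%N by lia.
  rewrite exprD; apply: ler_pM => //.
  - exact: exprn_ge0.
  - by rewrite exprn_ge0// ltW.
  - by apply: lerXn2r => //; rewrite nnegrE// ltW.
  - rewrite exprD ler_peMr//.
      by rewrite exprn_ge0// ltW.
    exact: exprn_ege1.
rewrite -integral_inv1Dsqr -ge0_integralZr//; last 2 first.
- apply/measurable_EFinP/measurable_funTS; apply: (measurableT_comp (@measurable_inv R)).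
  by apply: measurable_funD => //; exact: measurable_funX.
- by move=> u _; rewrite lee_fin invr_ge0 ltW.
apply: ge0_le_integral => //.
- by move=> u _; exact: integral_ge0.
- apply: measurable_funTS.
  have mK' : measurable_fun setT (fun p : R * R => K (p.2, p.1)).
    have msw : measurable_fun setT (fun p : R * R => (p.2, p.1)).
      by apply: measurable_fun_pair.
    exact: (measurableT_comp mK msw).
  pose K' (p : R * R) := K (p.2, p.1).
  rewrite (_ : (fun u => _) = fun u => \int[lambda]_(r in `]0%R, +oo[) K' (u, r))%E//.
  by apply: measurable_integral_in => // p; exact: K0.
- apply: emeasurable_funM => //.
  apply/measurable_EFinP/measurable_funTS; apply: (measurableT_comp (@measurable_inv R)).
  by apply: measurable_funD => //; exact: measurable_funX.
- by move=> u; rewrite /= in_itv/= andbT; exact: inner_le.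
Qed.

End polar_bound.

(** Expanding the sum of (q a_i - S b_i)^2 gives q (q p - S^2); when q = 0 every b_i vanishes. *)
Lemma sum_cauchy_schwarz (R : realFieldType) (I : finType) (P : pred I) (a b : I -> R) :
  (\sum_(i | P i) a i * b i) ^+ 2 <= (\sum_(i | P i) a i ^+ 2) * \sum_(i | P i) b i ^+ 2.
Proof.
set S := \sum_(i | P i) a i * b i; set p := \sum_(i | P i) a i ^+ 2.
set q := \sum_(i | P i) b i ^+ 2.
have : 0 <= \sum_(i | P i) (q * a i - S * b i) ^+ 2.
  by apply: sumr_ge0 => i _; exact: sqr_ge0.
have -> : \sum_(i | P i) (q * a i - S * b i) ^+ 2 = q * (q * p - S ^+ 2).
  transitivity (\sum_(i | P i) (q ^+ 2 * a i ^+ 2 + - (2 * q * S) * (a i * b i) + S ^+ 2 * b i ^+ 2)).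
    by apply: eq_bigr => i _; ring.
  by rewrite !big_split/= -!mulr_sumr -/p -/q -/S; ring.
have q0 : 0 <= q by apply: sumr_ge0 => i _; exact: sqr_ge0.
have [qE _|qn] := eqVneq q 0; last first.
  by rewrite pmulr_rge0 ?lt0r ?qn// subr_ge0 mulrC.
have b0 i : P i -> b i = 0.
  move=> Pi; apply/eqP; rewrite -sqrf_eq0; move/eqP: qE.
  by rewrite psumr_eq0 => [/allP/(_ i)|j _]; [rewrite mem_index_enum Pi => /(_ isT)|exact: sqr_ge0].
rewrite /S big1 ?expr0n ?qE ?mulr0// => i Pi.
by rewrite b0// mulr0.
Qed.

(** * The group SO_0(n,1) and its action on totally geodesic submanifolds *)

Section lorentz.
Variables (R : realType) (n : nat).
Local Notation vec := 'cV[R]_n.+1.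
Local Notation mat := 'M[R]_n.+1.
Local Notation last := (@ord_max n).
Local Notation el := (e R last).
Implicit Types (x y : vec) (A B : mat).

(** The Gram matrix of [lform]: diagonal, with entry 1 in the time direction and -1 elsewhere. *)
Definition lorentz_mx : mat := 2 *: (el *m el^T) - 1%:M.

Lemma coord_e (i a : 'I_n.+1) : e R i a 0 = (a == i)%:R.
Proof. by rewrite mxE eqxx andbT. Qed.

Lemma mulmx_e p (A : 'M[R]_(p, n.+1)) i a : (A *m e R i) a 0 = A a i.
Proof.
rewrite mxE (bigD1 i)//= coord_e eqxx mulr1 big1 ?addr0// => l li.
by rewrite coord_e (negbTE li) mulr0.
Qed.

Lemma cV_sum_e x : x = \sum_i x i 0 *: e R i.
Proof.
apply/matrixP => a b; rewrite (ord1 b) summxE (bigD1 a)//= mxE coord_e eqxx mulr1.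
by rewrite big1 ?addr0// => l la; rewrite mxE coord_e eq_sym (negbTE la) mulr0.
Qed.

Lemma eq_mulmx_e A B : (forall i, A *m e R i = B *m e R i) -> A = B.
Proof.
by move=> AB; apply/matrixP => a b; rewrite -!mulmx_e AB.
Qed.

Lemma eq_mulmx_cV A B : (forall x, A *m x = B *m x) -> A = B.
Proof. by move=> AB; apply: eq_mulmx_e => i; exact: AB. Qed.

Lemma lorentz_mxE a b : lorentz_mx a b = if a == b then (if a == last then 1 else -1) else 0.
Proof.
rewrite !mxE big_ord1 !mxE !eqxx !andbT.
have [<-|ab] := eqVneq a b.
  by case: (a == last) => /=; ring.
have [al|al] := eqVneq a last; last by rewrite mul0r mulr0 subr0.
have [bl|bl] := eqVneq b last; last by rewrite mulr0 mulr0 subr0.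
by rewrite al bl eqxx in ab.
Qed.

Lemma mul_lorentz_mxE p (X : 'M[R]_(n.+1, p)) a b :
  (lorentz_mx *m X) a b = (if a == last then 1 else -1) * X a b.
Proof.
rewrite mxE (bigD1 a)//= lorentz_mxE eqxx big1 ?addr0// => l la.
by rewrite lorentz_mxE eq_sym (negbTE la) mul0r.
Qed.

Lemma lorentz_mx_sqr : lorentz_mx *m lorentz_mx = 1%:M.
Proof.
apply/matrixP => a b; rewrite mul_lorentz_mxE lorentz_mxE [RHS]mxE.
by case: eqP; case: eqP => *; rewrite ?mulr0 ?mulr1 ?mulrNN ?mulr1.
Qed.

Lemma lorentz_mx_tr : lorentz_mx^T = lorentz_mx.
Proof.
apply/matrixP => a b; rewrite mxE !lorentz_mxE eq_sym.
by case: eqP => // ->.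
Qed.

Lemma lorentz_mx_el : lorentz_mx *m el = el.
Proof.
apply/matrixP => a b; rewrite mul_lorentz_mxE (ord1 b) coord_e.
by case: eqP; rewrite ?mulr1 ?mulr0.
Qed.

Lemma lformE x y : lform x y = (x^T *m lorentz_mx *m y) 0 0.
Proof.
rewrite -mulmxA mxE (bigD1 last)//= mul_lorentz_mxE eqxx mul1r mxE; congr (_ + _).
rewrite -sumrN; apply: eq_bigr => i il.
by rewrite mul_lorentz_mxE (negbTE il) mxE; ring.
Qed.

Lemma lform_entry A a b :
  lform (A *m e R a) (A *m e R b) = (A^T *m lorentz_mx *m A) a b.
Proof.
rewrite lformE trmx_mul !mulmxA mulmx_e -!mulmxA.
have -> : (e R a)^T *m (A^T *m (lorentz_mx *m A)) = ((A^T *m (lorentz_mx *m A))^T *m e R a)^T.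
  by rewrite trmx_mul trmxK.
by rewrite mxE mulmx_e mxE.
Qed.

Definition lorentz A := A^T *m lorentz_mx *m A = lorentz_mx.

Lemma lorentzP A : (forall x y, lform (A *m x) (A *m y) = lform x y) <-> lorentz A.
Proof.
split=> [h|h x y].
  apply/matrixP => a b; rewrite -lform_entry h.
  by rewrite -{1}(mul1mx (e R a)) -{1}(mul1mx (e R b)) lform_entry trmx1 mul1mx mulmx1.
by rewrite !lformE trmx_mul -!mulmxA !(mulmxA A^T) !(mulmxA _ A) h !mulmxA.
Qed.

(** For a Lorentz matrix this is the inverse, in a form whose entries are those of A up to sign and
    transposition. It is locked so that rewriting by associativity does not take it apart. *)
Definition linv A : mat := locked (lorentz_mx *m A^T *m lorentz_mx).

Lemma linv_def A : linv A = lorentz_mx *m A^T *m lorentz_mx.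
Proof. by rewrite /linv -lock. Qed.

Lemma lorentz_linvl A : lorentz A -> linv A *m A = 1%:M.
Proof. by move=> h; rewrite linv_def -!mulmxA (mulmxA A^T) h lorentz_mx_sqr. Qed.

Lemma lorentz_linvr A : lorentz A -> A *m linv A = 1%:M.
Proof. by move=> h; apply: mulmx1C; exact: lorentz_linvl. Qed.

(** A left inverse of a square matrix is a right inverse, so rows obey the same relations as
    columns. [lorentz_row] reads off the corner entry. *)
Lemma lorentz_tr A : lorentz A -> A *m lorentz_mx *m A^T = lorentz_mx.
Proof.
move=> /lorentz_linvr/(congr1 (mulmx^~ lorentz_mx)).
by rewrite linv_def -!mulmxA lorentz_mx_sqr mulmx1 mul1mx.
Qed.

Lemma lorentzM A B : lorentz A -> lorentz B -> lorentz (A *m B).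
Proof.
by rewrite /lorentz => hA hB; rewrite trmx_mul -!mulmxA (mulmxA A^T) (mulmxA _ A) hA !mulmxA hB.
Qed.

Lemma linvE A a b : linv A a b =
  (if a == last then 1 else -1) * (if b == last then 1 else -1) * A b a.
Proof.
rewrite linv_def -mulmxA mul_lorentz_mxE -mulrA; congr (_ * _).
have -> : A^T *m lorentz_mx = (lorentz_mx *m A)^T by rewrite trmx_mul lorentz_mx_tr.
by rewrite mxE mul_lorentz_mxE.
Qed.

Lemma lorentz_det_sqr A : lorentz A -> \det A ^+ 2 = 1.
Proof.
move=> /lorentz_linvl/(congr1 (@determinant R n.+1)).
rewrite linv_def !det_mulmx det_tr det1.
have : \det lorentz_mx * \det lorentz_mx = 1 by rewrite -det_mulmx lorentz_mx_sqr det1.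
move: (\det lorentz_mx) (\det A) => d a h <-.
have -> : d * a * d * a = (d * d) * a ^+ 2 by ring.
by rewrite h mul1r.
Qed.

Lemma lorentz_row A : lorentz A ->
  A last last ^+ 2 = 1 + \sum_(i < n.+1 | i != last) A last i ^+ 2.
Proof.
move=> /lorentz_tr/matrixP/(_ last last); rewrite lorentz_mxE !eqxx => h.
apply/eqP; rewrite -subr_eq -{}h; apply/eqP; rewrite -mulmxA mxE [RHS](bigD1 last)//=.
rewrite mul_lorentz_mxE eqxx mul1r mxE -expr2; congr (_ + _).
rewrite -sumrN; apply: eq_bigr => i il.
by rewrite mul_lorentz_mxE (negbTE il) mxE; ring.
Qed.

Lemma SO1P A : SO1 R n A <-> [/\ lorentz A, \det A = 1 & 0 < A last last].
Proof. by split=> -[/lorentzP h ? ?]; split => //; apply/lorentzP. Qed.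

Lemma hyperboloid_last x : hyperboloid R n x ->
  x last 0 ^+ 2 = 1 + \sum_(i < n.+1 | i != last) x i 0 ^+ 2.
Proof.
move=> [h _]; move: h; rewrite /lform -expr2 => /eqP; rewrite subr_eq => /eqP ->.
by congr (_ + _); apply: eq_bigr => i _; rewrite expr2.
Qed.

Lemma hyperboloid_ge1 x : hyperboloid R n x -> 1 <= x last 0.
Proof.
move=> Hx; have [_ x0] := Hx; rewrite -(@ler_pXn2r _ 2)// ?nnegrE//; last exact: ltW.
rewrite (hyperboloid_last Hx) expr1n lerDl.
by apply: sumr_ge0 => i _; exact: sqr_ge0.
Qed.

Lemma hyperboloid_el : hyperboloid R n el.
Proof.
split; last by rewrite coord_e eqxx ltr01.
rewrite /lform coord_e eqxx mulr1 big1 ?subr0// => i il.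
by rewrite coord_e (negbTE il) mul0r.
Qed.

(* Cauchy-Schwarz on the space coordinates *)
Lemma SO1_hyperboloid A x : SO1 R n A -> hyperboloid R n x -> hyperboloid R n (A *m x).
Proof.
move=> /SO1P[hA dA A0] Hx; have [hx x0] := Hx; split.
  by rewrite ((lorentzP A).2 hA).
rewrite mxE (bigD1 last)//=.
set S := \sum_(i < _ | _) _.
pose p := \sum_(i < n.+1 | i != last) A last i ^+ 2.
pose q := \sum_(i < n.+1 | i != last) x i 0 ^+ 2.
have q1 : x last 0 ^+ 2 = 1 + q by exact: hyperboloid_last.
have p1 : A last last ^+ 2 = 1 + p by exact: lorentz_row.
have p0 : 0 <= p by apply: sumr_ge0 => i _; exact: sqr_ge0.
have q0 : 0 <= q by apply: sumr_ge0 => i _; exact: sqr_ge0.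
have CS : S ^+ 2 <= p * q by exact: sum_cauchy_schwarz.
have pq : 0 <= p * q by exact: mulr_ge0.
have : `|S| < A last last * x last 0.
  have Ax : 0 < A last last * x last 0 by exact: mulr_gt0.
  rewrite -(gtr0_norm Ax) -ltr_sqr ?nnegrE// !real_normK ?num_real// exprMn p1 q1.
  lra.
rewrite ltr_norml => /andP[+ _]; lra.
Qed.

(** The corner entry of A B is the last coordinate of A (B e_(n+1)), which stays on the upper
    sheet. *)
Lemma SO1_mul A B : SO1 R n A -> SO1 R n B -> SO1 R n (A *m B).
Proof.
move=> SA SB; have /SO1P[hA dA _] := SA; have /SO1P[hB dB _] := SB.
apply/SO1P; split; first exact: lorentzM.
  by rewrite det_mulmx dA dB mulr1.
have [_] := SO1_hyperboloid SA (SO1_hyperboloid SB hyperboloid_el).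
by rewrite mulmxA mulmx_e.
Qed.

Lemma SO1_1 : SO1 R n 1%:M.
Proof.
apply/SO1P; split; first by rewrite /lorentz trmx1 mul1mx mulmx1.
  exact: det1.
by rewrite mxE eqxx.
Qed.

Lemma SO1_linv A : SO1 R n A -> SO1 R n (linv A).
Proof.
move=> /SO1P[hA dA A0]; apply/SO1P.
have h1 := lorentz_linvl hA.
split.
- rewrite /lorentz linv_def !trmx_mul trmxK lorentz_mx_tr -!mulmxA.
  rewrite (mulmxA lorentz_mx lorentz_mx) lorentz_mx_sqr mul1mx.
  rewrite (mulmxA lorentz_mx A^T) (mulmxA A) (mulmxA A) lorentz_tr//.
  by rewrite lorentz_mx_sqr mulmx1.
- by move/(congr1 (@determinant R n.+1)): h1; rewrite det_mulmx dA mulr1 det1.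
- by rewrite linvE eqxx !mul1r.
Qed.

Lemma SO1_linvl A : SO1 R n A -> linv A *m A = 1%:M.
Proof. by move=> /SO1P[hA _ _]; exact: lorentz_linvl. Qed.

Lemma SO1_linvr A : SO1 R n A -> A *m linv A = 1%:M.
Proof. by move=> /SO1P[hA _ _]; exact: lorentz_linvr. Qed.

Lemma SO_fix_el m A : SO R n m A -> A *m el = el.
Proof. by move=> [_ _]; apply; rewrite /= ltnn andbF. Qed.

(** An orthogonal matrix fixing e_(n+1) has a transpose fixing it too, hence preserves both terms of
    the Gram matrix 2 e e^T - 1. *)
Lemma SO_SO1 m A : SO R n m A -> SO1 R n A.
Proof.
move=> SA; have [AA dA _] := SA; have Ae := SO_fix_el SA.
have Ate : A^T *m el = el by rewrite -[in LHS]Ae mulmxA AA mul1mx.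
apply/SO1P; split => //.
  rewrite /lorentz /lorentz_mx mulmxBr mulmxBl mulmx1 AA -scalemxAr -scalemxAl.
  by rewrite mulmxA Ate -mulmxA -[X in _ *m X]trmxK trmx_mul trmxK Ate.
by rewrite -mulmx_e Ae coord_e eqxx.
Qed.

(** Writing the identity as 2 e e^T minus the Gram matrix turns the Lorentz relation into
    orthogonality. Thus K is the stabilizer of the origin. *)
Lemma SO1_fix_el A : SO1 R n A -> A *m el = el -> SO R n n A.
Proof.
move=> SA Ae; have /SO1P[hA dA _] := SA; split => //.
- have Ate : A^T *m el = el.
    have : linv A *m el = el by rewrite -[in LHS]Ae mulmxA SO1_linvl// mul1mx.
    rewrite linv_def -!mulmxA lorentz_mx_el => /(congr1 (mulmx lorentz_mx)).
    by rewrite mulmxA lorentz_mx_sqr mul1mx lorentz_mx_el.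
  have -> : A^T *m A = A^T *m (2 *: (el *m el^T) - lorentz_mx) *m A.
    by rewrite /lorentz_mx opprB addrC subrK mulmx1.
  rewrite mulmxBr mulmxBl hA -scalemxAr -scalemxAl mulmxA Ate -mulmxA.
  rewrite (_ : el^T *m A = el^T); last by rewrite -[LHS]trmxK trmx_mul trmxK Ate.
  by rewrite /lorentz_mx opprB addrC subrK.
- move=> i; rewrite subnn leq0n/= => ni.
  rewrite (_ : i = last)//; apply/val_inj/eqP => /=.
  by rewrite eqn_leq -ltnS ltn_ord leqNgt.
Qed.

End lorentz.

(** * Boosts and the stabilizers of coordinate subspaces *)

Section boosts.
Variables (R : realType) (n : nat).
Local Notation vec := 'cV[R]_n.+1.
Local Notation mat := 'M[R]_n.+1.
Local Notation last := (@ord_max n).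
Local Notation el := (e R last).
Implicit Types (x y : vec) (A B : mat) (i : 'I_n.+1) (r s : R).

Lemma coshD r s : cosh (r + s) = cosh r * cosh s + sinh r * sinh s.
Proof. rewrite /sinh /cosh opprD !expRD; lra. Qed.

Lemma sinhD r s : sinh (r + s) = sinh r * cosh s + cosh r * sinh s.
Proof. rewrite /sinh /cosh opprD !expRD; lra. Qed.

Lemma hrot_tr i r : (hrot i r)^T = hrot i r.
Proof.
apply/matrixP => a b; rewrite !mxE [b == a]eq_sym; case: (eqVneq a b) => [->//|_].
by rewrite orbC andbC [X in _ || X]andbC.
Qed.

Lemma mul_hrotE p (X : 'M[R]_(n.+1, p)) i r a b : i != last ->
  (hrot i r *m X) a b =
  if a == i then cosh r * X i b + sinh r * X last b
  else if a == last then sinh r * X i b + cosh r * X last b else X a b.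
Proof.
move=> il; rewrite mxE (bigD1 i)//= (bigD1 last)/=; last by rewrite eq_sym.
rewrite !mxE !eqxx/= !andbT.
have li : (last == i) = false by rewrite eq_sym (negbTE il).
have [->|ai] := eqVneq a i.
  rewrite (negbTE il) big1 ?addr0// => l /andP[ln ll].
  by rewrite mxE [i == l]eq_sym (negbTE ln) (negbTE ll) (negbTE il) andbF mul0r.
have [->|al] := eqVneq a last.
  rewrite ?li/= big1 ?addr0// => l /andP[ln ll].
  by rewrite mxE [last == l]eq_sym (negbTE ln) (negbTE ll) ?li ?eqxx ?andbF /= mul0r.
rewrite /= !mul0r !add0r (bigD1 a)/=; last by rewrite ai al.
rewrite mxE eqxx (negbTE ai) (negbTE al)/= mul1r big1 ?addr0// => l /andP[_ la].
by rewrite mxE [a == l]eq_sym (negbTE la) (negbTE ai) (negbTE al) mul0r.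
Qed.

Lemma mulr_hrotE p (X : 'M[R]_(p, n.+1)) i r a b : i != last ->
  (X *m hrot i r) a b =
  if b == i then cosh r * X a i + sinh r * X a last
  else if b == last then sinh r * X a i + cosh r * X a last else X a b.
Proof.
move=> il; have -> : X *m hrot i r = (hrot i r *m X^T)^T by rewrite trmx_mul trmxK hrot_tr.
by rewrite mxE mul_hrotE// !mxE.
Qed.

Lemma hrot0 i : hrot i 0 = 1%:M :> mat.
Proof.
apply/matrixP => a b; rewrite !mxE cosh0 sinh0.
by case: eqP => _; rewrite ?if_same//; case: ifP.
Qed.

Lemma hrotD i r s : i != last -> hrot i r *m hrot i s = hrot i (r + s) :> mat.
Proof.
move=> il; have li : (last == i) = false by rewrite eq_sym (negbTE il).
apply: eq_mulmx_cV => x; apply/matrixP => a b; rewrite -mulmxA !mul_hrotE// !eqxx li coshD sinhD.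
by case: (a == i); case: (a == last) => //; ring.
Qed.

Lemma lorentz_hrot i r : i != last -> lorentz (hrot i r : mat).
Proof.
move=> il; have li : (last == i) = false by rewrite eq_sym (negbTE il).
apply/lorentzP => x y; rewrite /lform !mul_hrotE// !eqxx li.
rewrite (bigD1 i)//= [in RHS](bigD1 i)//= !mul_hrotE// !eqxx.
rewrite (eq_bigr (fun l => x l 0 * y l 0)); last first.
  by move=> l /andP[/negbTE ll /negbTE ln]; rewrite !mul_hrotE// ln ll.
have := cosh_sqrE r; move: (cosh r) (sinh r) => c s cs.
set S := \sum_(l < _ | _) _.
transitivity ((c ^+ 2 - s ^+ 2) * (x last 0 * y last 0 - x i 0 * y i 0) - S); first by ring.
by rewrite cs addrK mul1r opprD addrA.
Qed.

Lemma SO1_hrot i r : i != last -> SO1 R n (hrot i r).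
Proof.
move=> il; apply/SO1P; split; first exact: lorentz_hrot.
(* A boost is the square of the boost by r / 2, and Lorentz determinants square to 1. *)
- have -> : r = r / 2 + r / 2 by lra.
  by rewrite -hrotD// det_mulmx -expr2; exact/lorentz_det_sqr/lorentz_hrot.
- by rewrite mxE eqxx orbT cosh_gt0.
Qed.

Lemma hrot_el i r : i != last -> hrot i r *m el = sinh r *: e R i + cosh r *: el.
Proof.
move=> il; apply/matrixP => a b; rewrite (ord1 b) mul_hrotE//.
have -> : (sinh r *: e R i + cosh r *: el) a 0 = sinh r * e R i a 0 + cosh r * el a 0.
  by rewrite mxE; congr (_ + _); rewrite mxE.
rewrite !coord_e eqxx (negbTE il).
have [->|ai] := eqVneq a i; first by rewrite (negbTE il); ring.
by case: (a == last) => /=; ring.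
Qed.

Lemma hrot_fix i r x : i != last -> x i 0 = 0 -> x last 0 = 0 -> hrot i r *m x = x.
Proof.
move=> il xi xl; apply/matrixP => a b; rewrite (ord1 b) mul_hrotE// xi xl !mulr0 addr0.
by case: eqVneq => [->//|_]; case: eqVneq => [->|].
Qed.

(* matrices mapping the coordinate subspace span(e_(n-d+1), ..., e_(n+1)) into itself *)
Definition stab (d : nat) A := forall a b : 'I_n.+1, (a < n - d <= b)%N -> A a b = 0.

Lemma stabP d A : stab d A <->
  (forall x, (forall a : 'I_n.+1, (a < n - d)%N -> x a 0 = 0) ->
     forall a : 'I_n.+1, (a < n - d)%N -> (A *m x) a 0 = 0).
Proof.
split=> [h x hx a ad|h a b /andP[ad db]].
  rewrite mxE big1// => b _; case: (leqP (n - d) b) => db; first by rewrite h ?mul0r// ad.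
  by rewrite hx// mulr0.
rewrite -mulmx_e; apply: h => // c cd; rewrite coord_e.
by case: eqP => // cb; rewrite -cb leqNgt cd in db.
Qed.

Lemma stab_mul d A B : stab d A -> stab d B -> stab d (A *m B).
Proof.
move=> /stabP hA /stabP hB; apply/stabP => x hx; rewrite -mulmxA.
by apply: hA; exact: hB.
Qed.

Lemma stab_hrot d i r : (n - d <= i)%N -> i != last -> stab d (hrot i r).
Proof.
move=> di il; apply/stabP => x hx a ad; rewrite mul_hrotE//.
case: eqP => [ai|_]; first by rewrite -ai leqNgt ad in di.
case: eqP => [al|_]; last exact: hx.
by move: ad; rewrite al /= ltnNge leq_subr.
Qed.

Lemma mem_coordspan (P : pred 'I_n.+1) x :
  x \in coordspan R P <-> (forall a, ~~ P a -> x a 0 = 0).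
Proof.
split=> [+ a Pa|hx].
  rewrite /coordspan; set s := [seq _ | _ <- _] => xs.
  rewrite (coord_span (X := in_tuple s) xs) summxE big1// => l _; rewrite mxE.
  have /mapP[c] : s`_l \in s by apply: mem_nth; case: l.
  rewrite mem_enum => Pc /= ->; rewrite coord_e.
  by case: eqP => [ac|_]; [rewrite ac in Pa; rewrite [P c](Pc) in Pa|rewrite mulr0].
rewrite (cV_sum_e x); apply: memv_suml => i _.
have [Pi|nPi] := boolP (P i); last by rewrite hx// scale0r mem0v.
by apply/memvZ/memv_span/map_f; rewrite mem_enum.
Qed.

Lemma HsubP (d : nat) x : (d <= n)%N ->
  Hsub R n d x <-> hyperboloid R n x /\ (forall a : 'I_n.+1, (a < n - d)%N -> x a 0 = 0).
Proof.
move=> dn; split=> -[Hx h]; split => //.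
  by move=> a ad; apply: (mem_coordspan _ _).1 h _ _; rewrite -ltnNge.
by apply/mem_coordspan => a; rewrite -ltnNge; exact: h.
Qed.

(** Injectivity and equality of dimensions force A to map the coordinate subspace onto itself. *)
Lemma SO_stab_linv d A : SO1 R n A -> stab d A -> stab d (linv A).
Proof.
move=> SA /stabP hA; apply/stabP => x hx.
pose V := coordspan R (fun i : 'I_n.+1 => (n - d <= i)%N).
have VP y : y \in V <-> (forall a : 'I_n.+1, (a < n - d)%N -> y a 0 = 0).
  by split=> [/mem_coordspan h a ad|h]; [apply: h; rewrite -ltnNge|apply/mem_coordspan => a; rewrite -ltnNge; exact: h].
pose f : 'Hom(vec, vec) := linfun (mulmx A).
have fE y : f y = A *m y by rewrite lfunE.
have sub : (f @: V <= V)%VS.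
  apply/subvP => _ /memv_imgP[y yV ->]; rewrite fE; apply/VP; apply: hA; exact/VP.
have kerf : lker f == 0%VS.
  apply/lker0P => y z; rewrite !fE => /(congr1 (mulmx (linv A))).
  by rewrite !mulmxA SO1_linvl// !mul1mx.
have : (f @: V == V)%VS by rewrite eqEdim sub (limg_dim_eq (eqP _))//= (eqP kerf) capv0.
move=> /eqP fV; have : x \in (f @: V)%VS by rewrite fV; apply/VP.
move=> /memv_imgP[y yV ->]; rewrite fE mulmxA SO1_linvl// mul1mx; exact/VP.
Qed.

End boosts.

(** * The action on geodesic submanifolds and their nearest points *)

Section action.
Variables (R : realType) (n : nat).
Local Notation vec := 'cV[R]_n.+1.
Local Notation mat := 'M[R]_n.+1.
Local Notation last := (@ord_max n).
Local Notation el := (e R last).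
Implicit Types (x y : vec) (A B : mat) (d : 'I_n).

Lemma geodesic_image (m : nat) A (T : set vec) : SO1 R n A ->
  is_geodesic R n m T -> is_geodesic R n m ((fun x => A *m x) @` T).
Proof.
move=> SA [[x0 Tx0] [V dV TV]]; split; first by exists (A *m x0); exists x0.
rewrite TV.
pose f : 'Hom(vec, vec) := linfun (mulmx A).
have fE y : f y = A *m y by rewrite lfunE.
have kerf : lker f == 0%VS.
  apply/lker0P => y z; rewrite !fE => /(congr1 (mulmx (linv A))).
  by rewrite !mulmxA SO1_linvl// !mul1mx.
exists (f @: V)%VS; first by rewrite limg_dim_eq// (eqP kerf) capv0.
apply/seteqP; split => [_ [y [Hy yV] <-]|z [Hz /= /memv_imgP[y yV zy]]].
  by split; [exact: SO1_hyperboloid|rewrite /= -fE memv_img].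
exists y; last by rewrite zy fE.
split => //; have -> : y = linv A *m z by rewrite zy fE mulmxA SO1_linvl// mul1mx.
by apply: SO1_hyperboloid => //; exact: SO1_linv.
Qed.

Lemma val_act d A (t : GammaH R d) : SO1 R n A ->
  \val (act A t) = (fun x => A *m x) @` \val t.
Proof.
move=> SA; rewrite /act mem_set// insubdK//.
by apply/mem_set/geodesic_image => //; apply/set_mem; exact: (valP t).
Qed.

Lemma act_mul d A B (t : GammaH R d) : SO1 R n A -> SO1 R n B ->
  act A (act B t) = act (A *m B) t.
Proof.
move=> SA SB; apply: val_inj; rewrite !val_act//; last exact: SO1_mul.
rewrite image_comp; apply/seteqP; split => _ [x tx <-]; exists x => //=;
  by rewrite mulmxA.
Qed.

Lemma act1 d (t : GammaH R d) : act 1%:M t = t.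
Proof.
apply: val_inj; rewrite val_act; last exact: SO1_1.
by apply/seteqP; split => [_ [x tx <-]|x tx]; [rewrite mul1mx|exists x; rewrite ?mul1mx].
Qed.

Lemma act_out d A (t : GammaH R d) : ~ SO1 R n A -> act A t = t.
Proof. by move=> nA; rewrite /act memNset. Qed.

Lemma act_stab d A : SO1 R n A -> stab d A -> act A (Hsub_pt R d) = Hsub_pt R d.
Proof.
move=> SA sA; apply: val_inj; rewrite val_act//= .
have dn : (d <= n)%N by exact/ltnW.
have sub B : SO1 R n B -> stab d B -> forall x, Hsub R n d x -> Hsub R n d (B *m x).
  move=> SB sB x /(HsubP _ dn)[Hx h]; apply/(HsubP _ dn).
  by split; [exact: SO1_hyperboloid|exact: (stabP _ _).1].
apply/seteqP; split => [_ [x Hx <-]|x Hx]; first exact: sub.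
exists (linv A *m x); last by rewrite mulmxA SO1_linvr// mul1mx.
by apply: sub => //; [exact: SO1_linv|exact: SO_stab_linv].
Qed.

Lemma Hsub_el d : Hsub R n d el.
Proof.
apply/HsubP; first exact/ltnW; split; first exact: hyperboloid_el.
by move=> a ad; rewrite coord_e; case: eqP => // al; move: ad; rewrite al /= ltnNge leq_subr.
Qed.

(** H^d contains e_(n+1) and its boost by 1 towards each space direction of its span, so the
    relevant columns of A can be read off from images of points. *)
Lemma stab_act d A : SO1 R n A -> act A (Hsub_pt R d) = Hsub_pt R d -> stab d A.
Proof.
move=> SA /(congr1 \val); rewrite val_act// => /seteqP[sub _].
have dn : (d <= n)%N by exact/ltnW.
have subx x : Hsub R n d x -> forall a : 'I_n.+1, (a < n - d)%N -> (A *m x) a 0 = 0.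
  by move=> Hx a ad; have /(HsubP _ dn)[_] := sub _ (ex_intro2 _ _ x Hx erefl); apply.
have el0 (a : 'I_n.+1) : (a < n - d)%N -> A a last = 0.
  by move=> ad; rewrite -mulmx_e; apply: subx => //; exact: Hsub_el.
move=> a b /andP[ad db].
have [->|bl] := eqVneq b last; first exact: el0.
have Hb : Hsub R n d (hrot b 1 *m el).
  have /(HsubP _ dn)[He h] := Hsub_el d.
  apply/HsubP => //; split; first by apply: SO1_hyperboloid => //; exact: SO1_hrot.
  by apply: (stabP _ _).1 h; exact: stab_hrot.
have := subx _ Hb _ ad; rewrite hrot_el// mulmxDr -!scalemxAr.
rewrite mxE ![(_ *: _ : vec) _ _]mxE !mulmx_e el0// mulr0 addr0 => /eqP.
by rewrite mulf_eq0 gt_eqF ?sinh_gt0//= => /eqP.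
Qed.

Lemma act_eqP d A B : SO1 R n A -> SO1 R n B ->
  act A (Hsub_pt R d) = act B (Hsub_pt R d) <-> stab d (linv A *m B).
Proof.
move=> SA SB; have SA' := SO1_linv SA; have SC := SO1_mul SA' SB.
split=> [AB|sC].
  apply: stab_act => //; rewrite -act_mul// -AB act_mul// SO1_linvl//; exact: act1.
by rewrite -[in LHS](act_stab SC sC) act_mul// mulmxA SO1_linvr// mul1mx.
Qed.

(* M e_(n+1) is then the point of M H^d closest to the origin e_(n+1) *)
Definition aligned (m : nat) A := forall b : 'I_n.+1, (n - m <= b < n)%N -> A last b = 0.

Lemma ord_lt_last (b : 'I_n.+1) : (b < n)%N = (b != last).
Proof. by rewrite -val_eqE/= ltn_neqAle -ltnS ltn_ord andbT. Qed.

Lemma aligned_last d A x : aligned d A -> Hsub R n d x ->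
  (A *m x) last 0 = A last last * x last 0.
Proof.
move=> hA /HsubP[]; first exact/ltnW.
move=> _ h; rewrite mxE (bigD1 last)//= big1 ?addr0// => b bl.
have [bd|db] := ltnP b (n - d)%N; first by rewrite h ?mulr0.
by rewrite hA ?mul0r// db/= ord_lt_last.
Qed.

(** On A H^d the last coordinate is that of A e_(n+1) multiplied by some x_(n+1) >= 1, so the
    infimum is attained at A e_(n+1). *)
Lemma gdist_aligned d A : SO1 R n A -> aligned d A ->
  gdist (act A (Hsub_pt R d)) = arcosh (A last last).
Proof.
move=> SA hA.
have A1 : 1 <= A last last.
  by rewrite -mulmx_e; apply/hyperboloid_ge1/SO1_hyperboloid => //; exact: hyperboloid_el.
have E x : hdist el x = arcosh (x last 0).
  rewrite /hdist /lform coord_e eqxx mul1r big1 ?subr0// => i il.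
  by rewrite coord_e (negbTE il) mul0r.
apply/eqP; rewrite eq_le; apply/andP; split.
  apply: ge_inf.
    exists 0 => _ [x xt <-]; rewrite E; apply: arcosh_ge0; move: xt; rewrite val_act//.
    move=> [y [Hy _] <-]; exact/hyperboloid_ge1/SO1_hyperboloid.
  exists (A *m el); last by rewrite E mulmx_e.
  by rewrite val_act//; exists el => //; exact: Hsub_el.
apply: lb_le_inf.
  exists (hdist el (A *m el)), (A *m el) => //.
  by rewrite val_act//; exists el => //; exact: Hsub_el.
move=> _ [x + <-]; rewrite val_act// => -[y Hy <-]; rewrite E (aligned_last hA Hy).
apply: ler_arcosh => //; rewrite ler_peMr ?(le_trans ler01)//.
by have [/hyperboloid_ge1] := Hy.
Qed.

Lemma idx_neq_last d : idx d != last.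
Proof. by rewrite -ord_lt_last; exact: ltn_ord (rev_ord d). Qed.

Lemma idxE d : (idx d : nat) = (n - d.+1)%N.
Proof. by []. Qed.

Lemma SO_last_row m A b : SO R n m A -> A last b = (b == last)%:R.
Proof.
move=> SA; have S1 := SO_SO1 SA.
have : linv A *m el = el by rewrite -[in LHS](SO_fix_el SA) mulmxA SO1_linvl// mul1mx.
move/matrixP => /(_ b 0); rewrite mulmx_e linvE eqxx coord_e mulr1.
case: (b == last); first by rewrite mul1r.
by rewrite mulN1r => /eqP; rewrite oppr_eq0 => /eqP.
Qed.

Lemma SO_mul m A B : SO R n m A -> SO R n m B -> SO R n m (A *m B).
Proof.
move=> [AA dA fA] [BB dB fB]; split.
- by rewrite trmx_mul -mulmxA (mulmxA _ A) AA mul1mx.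
- by rewrite det_mulmx dA dB mulr1.
- by move=> i hi; rewrite -mulmxA fB// fA.
Qed.

Lemma SO_linv m A : SO R n m A -> linv A = A^T.
Proof.
move=> SA; have [AA _ _] := SA; have S1 := SO_SO1 SA.
by rewrite -[LHS]mul1mx -AA -mulmxA SO1_linvr// mulmx1.
Qed.

Lemma SO_tr m A : SO R n m A -> SO R n m A^T.
Proof.
move=> SA; have [AA dA fA] := SA; split.
- by rewrite trmxK; exact: mulmx1C.
- by rewrite det_tr.
- by move=> i hi; rewrite -[in LHS](fA _ hi) mulmxA AA mul1mx.
Qed.

Lemma SO_widen m A : SO R n m A -> SO R n n A.
Proof. by move=> SA; apply: SO1_fix_el; [exact: SO_SO1 SA|exact: SO_fix_el SA]. Qed.

Lemma SO_stab m A : (m <= n)%N -> SO R n m A -> stab m A.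
Proof.
move=> mn SA a b /andP[am mb].
have [_ _ fA] := SO_tr SA.
have /matrixP/(_ b 0) : A^T *m e R a = e R a by apply: fA; rewrite negb_and -ltnNge am.
rewrite mulmx_e mxE => ->; rewrite coord_e; case: eqP => // ba.
by rewrite ba leqNgt am in mb.
Qed.

Lemma aligned_hrot m A d r : (m <= d)%N -> SO R n n A -> aligned m (A *m hrot (idx d) r).
Proof.
move=> md SA b /andP[mb bn]; rewrite mulr_hrotE ?idx_neq_last//.
rewrite !(SO_last_row _ SA) (negbTE (idx_neq_last d)) eqxx.
have bl : b != last by rewrite -ord_lt_last.
rewrite (negbTE bl); case: eqP => // bi; move: mb; rewrite bi idxE leqNgt.
by rewrite ltn_sub2l// (leq_trans _ (ltn_ord d)).
Qed.

Lemma gdist_polar d A r : SO R n n A -> 0 <= r ->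
  gdist (act (A *m hrot (idx d) r) (Hsub_pt R d)) = r.
Proof.
move=> SA r0; rewrite gdist_aligned.
- rewrite mulr_hrotE ?idx_neq_last// !(SO_last_row _ SA) eqxx.
  rewrite (negbTE (idx_neq_last d)) eq_sym (negbTE (idx_neq_last d)).
  by rewrite mulr0 add0r mulr1 coshK.
- by apply: SO1_mul; [exact: SO_SO1 SA|exact/SO1_hrot/idx_neq_last].
- exact: aligned_hrot.
Qed.

(** The nearest point is unique: if B e = A y and A e = B z with y, z in H^d, the last coordinates
    of y and z are at least 1 and have product 1, so y = e. *)
Lemma aligned_fix d A B : SO1 R n A -> SO1 R n B -> aligned d A -> aligned d B ->
  act A (Hsub_pt R d) = act B (Hsub_pt R d) -> A *m el = B *m el.
Proof.
move=> SA SB hA hB /(congr1 \val); rewrite !val_act// => AB.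
have [y Hy yE] : ((fun x => A *m x) @` \val (Hsub_pt R d)) (B *m el).
  by rewrite AB; exists el => //; exact: Hsub_el.
have [z Hz zE] : ((fun x => B *m x) @` \val (Hsub_pt R d)) (A *m el).
  by rewrite -AB; exists el => //; exact: Hsub_el.
have A0 : 0 < A last last by case/SO1P: SA.
have B0 : 0 < B last last by case/SO1P: SB.
have eB : A last last * y last 0 = B last last by rewrite -(aligned_last hA Hy) yE mulmx_e.
have eA : B last last * z last 0 = A last last by rewrite -(aligned_last hB Hz) zE mulmx_e.
have y1 := hyperboloid_ge1 Hy.1; have z1 := hyperboloid_ge1 Hz.1.
have ly : y last 0 = 1.
  apply/eqP; rewrite eq_le y1 andbT.
  have : B last last <= A last last by rewrite -eA ler_peMr// ltW.
  by rewrite -eB ger_pMr.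
rewrite -yE; congr (_ *m _).
have := hyperboloid_last Hy.1; rewrite ly expr1n => /esym/eqP.
rewrite -subr_eq0 addrAC subrr add0r psumr_eq0 => [/allP h|i _]; last exact: sqr_ge0.
apply/matrixP => a b; rewrite (ord1 b) coord_e.
have [->|al] := eqVneq a last; first by rewrite ly.
by have := h a; rewrite mem_index_enum al sqrf_eq0 => /(_ isT)/eqP.
Qed.

(** This h is all the ambiguity left in the choice of a frame; [dm_stab] later shows that it does
    not affect the integral. *)
Lemma aligned_stab d A B : SO1 R n A -> SO1 R n B -> aligned d A -> aligned d B ->
  act A (Hsub_pt R d) = act B (Hsub_pt R d) ->
  exists h, [/\ SO R n n h, stab d h & B = A *m h].
Proof.
move=> SA SB hA hB AB; have eAB := aligned_fix SA SB hA hB AB.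
have SA' := SO1_linv SA; exists (linv A *m B); split.
- apply: SO1_fix_el; first exact: SO1_mul.
  by rewrite -mulmxA -eAB mulmxA SO1_linvl// mul1mx.
- exact/act_eqP.
- by rewrite mulmxA SO1_linvr// mul1mx.
Qed.

End action.

(** * Reflections, rotations and products of boosts *)

Section rotations.
Variables (R : realType) (n : nat).
Local Notation vec := 'cV[R]_n.+1.
Local Notation mat := 'M[R]_n.+1.
Local Notation last := (@ord_max n).
Local Notation el := (e R last).
Implicit Types (x y u v w : vec) (A B : mat) (d : 'I_n).

Lemma SOn_intro A : A^T *m A = 1%:M -> \det A = 1 -> A *m el = el -> SO R n n A.
Proof.
move=> AA dA Ae; split=> // i; rewrite subnn leq0n/= => ni.
by rewrite (_ : i = last)//; apply/eqP; move: ni; rewrite ord_lt_last negbK.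
Qed.

Lemma dotE x y : dot x y = \sum_i x i 0 * y i 0.
Proof. by rewrite /dot mxE; apply: eq_bigr => i _; rewrite mxE. Qed.

Lemma dot_e x (i : 'I_n.+1) : dot x (e R i) = x i 0.
Proof. by rewrite /dot mulmx_e mxE. Qed.

Lemma dotDl x y z : dot (x + y) z = dot x z + dot y z.
Proof. by rewrite !dotE -big_split/=; apply: eq_bigr => i _; rewrite mxE mulrDl. Qed.

Lemma dotC x y : dot x y = dot y x.
Proof. by rewrite !dotE; apply: eq_bigr => i _; rewrite mulrC. Qed.

Lemma dotZl (c : R) x y : dot (c *: x) y = c * dot x y.
Proof. by rewrite !dotE mulr_sumr; apply: eq_bigr => i _; rewrite mxE mulrA. Qed.

Lemma dotDr x y z : dot z (x + y) = dot z x + dot z y.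
Proof. by rewrite dotC dotDl !(dotC z). Qed.

Lemma dotZr (c : R) x y : dot x (c *: y) = c * dot x y.
Proof. by rewrite dotC dotZl dotC. Qed.

Lemma dot_eq0 x : dot x x = 0 -> x = 0.
Proof.
rewrite dotE => /eqP; rewrite psumr_eq0 => [/allP h|i _]; last by rewrite -expr2 sqr_ge0.
apply/matrixP => a b; rewrite (ord1 b) mxE.
by have := h a; rewrite mem_index_enum -expr2 sqrf_eq0 => /(_ isT)/eqP.
Qed.

Lemma dot_orth A x y : A^T *m A = 1%:M -> dot (A *m x) (A *m y) = dot x y.
Proof. by move=> AA; rewrite /dot trmx_mul -mulmxA (mulmxA _ A) AA mul1mx. Qed.

(** The Householder reflection along w. For w = 0 the convention 2 / 0 = 0 makes it the identity,
    which keeps [reflection_swap] true when x = y. *)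
Definition reflection w : mat := 1%:M - (2 / dot w w) *: (w *m w^T).

Lemma mul_reflection w x : reflection w *m x = x - (2 / dot w w * dot w x) *: w.
Proof.
rewrite mulmxBl mul1mx -scalemxAl -mulmxA.
have -> : w^T *m x = (dot w x)%:M by apply/matrixP => a b; rewrite (ord1 a) (ord1 b) [RHS]mxE eqxx.
by rewrite mul_mx_scalar scalerA.
Qed.

Lemma reflection_tr w : (reflection w)^T = reflection w.
Proof. by rewrite /reflection linearB linearZ/= trmx1 trmx_mul trmxK. Qed.

Lemma reflectionK w : reflection w *m reflection w = 1%:M.
Proof.
apply: eq_mulmx_cV => x; rewrite -mulmxA mul1mx !mul_reflection.
have [w0|wn] := eqVneq (dot w w) 0; first by rewrite w0 invr0 mulr0 !mul0r !scale0r !subr0.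
have -> : dot w (x - (2 / dot w w * dot w x) *: w) = - dot w x.
  by rewrite -scaleNr dotDr dotZr; field.
by rewrite mulrN scaleNr opprK subrK.
Qed.

Lemma reflection_swap x y : dot x x = dot y y -> reflection (x - y) *m x = y.
Proof.
move=> xy; rewrite mul_reflection.
have E : dot (x - y) (x - y) = 2 * dot (x - y) x.
  by rewrite -scaleN1r !(dotDl, dotDr, dotZl, dotZr) -xy (dotC y x); ring.
have [w0|wn] := eqVneq (dot (x - y) (x - y)) 0.
  by rewrite w0 invr0 mulr0 mul0r scale0r subr0; apply/eqP; rewrite -subr_eq0 (dot_eq0 w0).
rewrite mulrAC E divff -?E// scale1r subKr//.
Qed.

Lemma reflection_e (l i : 'I_n.+1) :
  reflection (e R l) *m e R i = (if i == l then -1 else 1) *: e R i.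
Proof.
rewrite mul_reflection !dot_e !coord_e eqxx eq_sym; case: eqP => [->|_] /=.
  by rewrite divr1 mulr1 scaleN1r scaler_nat mulr2n opprD addrA subrr add0r.
by rewrite mulr0 scale0r subr0 scale1r.
Qed.

Lemma det_reflection_e (l : 'I_n.+1) : \det (reflection (e R l)) = -1.
Proof.
have -> : reflection (e R l) = diag_mx (\row_a (if a == l then -1 else 1)).
  apply: eq_mulmx_e => i; rewrite reflection_e; apply/matrixP => a b.
  rewrite mul_diag_mx !mxE; case: (eqVneq a i) => [->//|_].
  by rewrite /= !mulr0.
rewrite det_diag (bigD1 l)//= mxE eqxx big1 ?mulr1// => i il.
by rewrite mxE (negbTE il).
Qed.

(** The reflection exchanging e_(n-d) and u may have determinant -1; it is then composed with a
    coordinate reflection along a direction other than e_(n-d) and e_(n+1), available because n >=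
    2. If u lies in the span of the first n - d coordinates, both reflections preserve the span of
    the others. *)
Lemma SO_rotate d u : (2 <= n)%N -> u last 0 = 0 -> dot u u = 1 ->
  exists t, [/\ SO R n n t, t *m e R (idx d) = u &
    (forall a : 'I_n.+1, (n - d <= a)%N -> u a 0 = 0) -> stab d t].
Proof.
move=> n2 ul uu; pose w := e R (idx d) - u.
have ee : dot (e R (idx d)) (e R (idx d)) = 1 by rewrite dot_e coord_e eqxx.
have He : reflection w *m e R (idx d) = u := reflection_swap (etrans ee (esym uu)).
have wl : w last 0 = 0 by rewrite !mxE eq_sym (negbTE (idx_neq_last d)) ul subr0.
have Hl : reflection w *m el = el by rewrite mul_reflection dot_e wl mulr0 scale0r subr0.
have HH : (reflection w)^T *m reflection w = 1%:M by rewrite reflection_tr reflectionK.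
have Hs : (forall a : 'I_n.+1, (n - d <= a)%N -> u a 0 = 0) -> stab d (reflection w).
  move=> hu a b /andP[ad db].
  rewrite -mulmx_e mul_reflection dot_e.
  have -> : w b 0 = 0.
    rewrite mxE [(- u) b 0]mxE hu// oppr0 addr0 coord_e; case: eqP => // bi.
    by move: db; rewrite bi idxE leqNgt ltn_sub2l.
  rewrite mulr0 scale0r subr0 coord_e; case: eqP => // ab.
  by rewrite ab ltnNge db in ad.
have [l [li ll]] : exists l : 'I_n.+1, l != idx d /\ l != last.
  have [i0|i0] := eqVneq (idx d : nat) 0%N.
    have l1 : (1 < n.+1)%N by lia.
    exists (Ordinal l1); rewrite -!val_eqE /= -[X in _ != X]/(idx d : nat) i0; split=> //; lia.
  by exists ord0; rewrite -!val_eqE/= eq_sym; split => //; lia.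
pose D := reflection (e R l).
have De i : i != l -> D *m e R i = e R i.
  by move=> il; rewrite reflection_e (negbTE il) scale1r.
have dD : \det D = -1 := det_reflection_e l.
have DD : D^T *m D = 1%:M by rewrite reflection_tr reflectionK.
have sD : stab d D.
  move=> a b /andP[ad db]; rewrite -mulmx_e reflection_e mxE coord_e.
  by case: (eqVneq a b) => [ab|_]; [rewrite ab ltnNge db in ad|rewrite mulr0].
have : \det (reflection w) ^+ 2 = 1.
  by rewrite expr2 -[X in X * _]det_tr -det_mulmx HH det1.
move=> /eqP; rewrite sqrf_eq1 => /orP[/eqP d1|/eqP d1].
  by exists (reflection w); split => //; exact: SOn_intro.
exists (reflection w *m D); split.
- apply: SOn_intro.
  + by rewrite trmx_mul -mulmxA (mulmxA _ (reflection w)) HH mul1mx.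
  + by rewrite det_mulmx d1 dD mulrNN mulr1.
  + by rewrite -mulmxA De// eq_sym.
- by rewrite -mulmxA De// eq_sym.
- by move=> /Hs hs; exact: stab_mul.
Qed.

(** A rotation fixing e_i is the identity on the plane of the boost and preserves its orthogonal
    complement, where the boost is the identity. *)
Lemma hrot_comm A (i : 'I_n.+1) r : i != last -> SO R n n A -> A *m e R i = e R i ->
  A *m hrot i r = hrot i r *m A.
Proof.
move=> il SA Ai; have Al := SO_fix_el SA.
have [AA _ _] := SA.
have Ati : A^T *m e R i = e R i by rewrite -[in LHS]Ai mulmxA AA mul1mx.
have rowi b : A i b = (b == i)%:R.
  by rewrite -coord_e -Ati mulmx_e mxE.
have coli a : A a i = (a == i)%:R by rewrite -mulmx_e Ai coord_e.
have coll a : A a last = (a == last)%:R by rewrite -mulmx_e Al coord_e.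
apply/matrixP => a b; rewrite mulr_hrotE// mul_hrotE// !(SO_last_row _ SA) !rowi !coli !coll.
have li : (last == i) = false by rewrite eq_sym (negbTE il).
have [bi|/negbTE bi] := eqVneq b i.
  rewrite /= ?bi; have [ai|/negbTE ai] := eqVneq a i; first by rewrite /= ?ai ?(negbTE il) ?li /=; ring.
  by case: (a == last); rewrite ?bi ?coli ?ai ?li ?(negbTE il) /=; ring.
have [bl|/negbTE bl] := eqVneq b last.
  have [ai|/negbTE ai] := eqVneq a i; first by rewrite ?ai ?bl ?(negbTE il) /=; ring.
  by have [al|/negbTE al] := eqVneq a last; rewrite ?bl ?coll ?al ?ai ?eqxx ?(negbTE il) /=; ring.
case: (eqVneq a i) => [->|ai]; first by rewrite rowi bi /=; ring.
by case: (eqVneq a last) => [->|al] //; rewrite (SO_last_row _ SA) bl /=; ring.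
Qed.

(** The product sends e_(n+1) to v + cosh r cosh s e_(n+1), with v in the plane of e_(n-j) and
    e_(n-k). A rotation t taking e_(n-j) to the direction of v makes t g(q) agree with it at
    e_(n+1). Since j < k, the other basis vectors of the span of H^j are fixed by the boosts, and t
    preserves that span; hence the two images of H^j coincide, though the matrices may differ. *)
Lemma hrot_hrot (j k : 'I_n) r s : (2 <= n)%N -> (j < k)%N ->
  exists t q, [/\ SO R n n t, 0 <= q, cosh q = cosh r * cosh s &
    act (hrot (idx k) r *m hrot (idx j) s) (Hsub_pt R j) =
    act (t *m hrot (idx j) q) (Hsub_pt R j)].
Proof.
move=> n2 jk.
have [jl kl] := (idx_neq_last j, idx_neq_last k).
have jk' : (idx k == idx j) = false.
  by apply/negbTE; rewrite -val_eqE /= -[X in X != _]/(idx k : nat) -[X in _ != X]/(idx j : nat) !idxE; have := ltn_ord k; lia.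
pose M1 := hrot (idx k) r *m hrot (idx j) s.
have SM1 : SO1 R n M1 by apply: SO1_mul; exact: SO1_hrot.
pose v := sinh s *: e R (idx j) + (cosh s * sinh r) *: e R (idx k).
have M1el : M1 *m el = v + (cosh r * cosh s) *: el.
  rewrite /M1 -mulmxA hrot_el// mulmxDr -!scalemxAr hrot_el//.
  rewrite hrot_fix//; last 2 first.
    - by rewrite coord_e jk'.
    - by rewrite coord_e eq_sym (negbTE jl).
  by rewrite scalerDr !scalerA addrA (mulrC (cosh r)).
have vv : dot v v = sinh s ^+ 2 + cosh s ^+ 2 * sinh r ^+ 2.
  rewrite /v !(dotDl, dotDr, dotZl, dotZr) !dot_e !coord_e !eqxx jk' eq_sym jk'/=; ring.
have X1 : 1 <= cosh r * cosh s by rewrite mulr_ege1// cosh_ge1.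
pose q := arcosh (cosh r * cosh s).
have q0 : 0 <= q by exact: arcosh_ge0.
have cq : cosh q = cosh r * cosh s by exact: arcoshK.
have sq : sinh q ^+ 2 = dot v v.
  have : cosh q ^+ 2 = 1 + sinh q ^+ 2 by exact: cosh_sqrE.
  by rewrite cq exprMn vv (cosh_sqrE r) (cosh_sqrE s); lra.
have vb b : (b != idx j) -> b != idx k -> v b 0 = 0.
  move=> bj bk; rewrite mxE ![(_ *: _ : vec) _ _]mxE !coord_e (negbTE bj) (negbTE bk).
  by rewrite !mulr0 addr0.
(* When q = 0 the vector v vanishes and its direction is arbitrary; e_(n-j) is taken. *)
have [u [uu uv ub]] : exists u, [/\ dot u u = 1, sinh q *: u = v &
    forall b, b != idx j -> b != idx k -> u b 0 = 0].
  have [s0|sn] := eqVneq (sinh q) 0.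
    exists (e R (idx j)); split.
    - by rewrite dot_e coord_e eqxx.
    - by rewrite s0 scale0r; apply/esym/dot_eq0; rewrite -sq s0 expr0n.
    - by move=> b bj bk; rewrite coord_e (negbTE bj).
  exists ((sinh q)^-1 *: v); split.
  - by rewrite dotZl dotZr -sq; field.
  - by rewrite scalerA divff// scale1r.
  - by move=> b bj bk; rewrite mxE vb// mulr0.
have lt_idx (b : 'I_n.+1) : (n - j <= b)%N -> b != idx j /\ b != idx k.
  move=> jb; rewrite -!val_eqE /= -[X in _ != X /\ _]/(idx j : nat) -[X in _ /\ _ != X]/(idx k : nat) !idxE.
  have := ltn_ord k; lia.
have [t [St tu st]] : exists t, [/\ SO R n n t, t *m e R (idx j) = u &
    (forall a : 'I_n.+1, (n - j <= a)%N -> u a 0 = 0) -> stab j t].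
  by apply: SO_rotate => //; apply: ub; rewrite eq_sym.
have {}st : stab j t by apply: st => a /lt_idx[aj ak]; exact: ub.
have St1 := SO_SO1 St.
exists t, q; split => //.
pose M2 := t *m hrot (idx j) q.
have SM2 : SO1 R n M2 by apply: SO1_mul => //; exact: SO1_hrot.
have M2el : M2 *m el = M1 *m el.
  by rewrite M1el -mulmxA hrot_el// mulmxDr -!scalemxAr tu uv (SO_fix_el St) cq.
apply/esym/act_eqP => // a b /andP[aj jb].
rewrite -mulmx_e.
have [->|bl] := eqVneq b last.
  rewrite -mulmxA -/M1 -M2el mulmxA SO1_linvl// mul1mx coord_e; case: eqP => // al.
  by move: aj; rewrite al/= ltnNge leq_subr.
have [bj bk] := lt_idx _ jb.
have M1b : M1 *m e R b = e R b.
  by rewrite -mulmxA !hrot_fix// coord_e; apply/eqP; rewrite pnatr_eq0 eqb0 eq_sym.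
pose y := linv t *m e R b.
have ty : t *m y = e R b by rewrite mulmxA SO1_linvr// mul1mx.
have y0 (c : 'I_n.+1) : (c < n - j)%N -> y c 0 = 0.
  move: c; apply: (stabP _ _).1; first exact: SO_stab_linv.
  by move=> c cj; rewrite coord_e; case: eqP => // cb; rewrite cb ltnNge jb in cj.
have yl : y last 0 = 0.
  rewrite mulmx_e linvE eqxx (negbTE bl) -mulmx_e (SO_fix_el St) coord_e.
  by rewrite (negbTE bl) mulr0.
have M2y : M2 *m y = e R b.
  rewrite -mulmxA hrot_fix//; apply: y0; rewrite idxE; have := ltn_ord j; lia.
by rewrite -mulmxA -/M1 M1b -M2y mulmxA SO1_linvl// mul1mx y0.
Qed.

End rotations.

(** * Frames and polar coordinates of a geodesic submanifold *)

Section frames.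
Variables (R : realType) (n : nat).
Local Notation vec := 'cV[R]_n.+1.
Local Notation mat := 'M[R]_n.+1.
Local Notation last := (@ord_max n).
Local Notation el := (e R last).
Implicit Types (x y u v w : vec) (A B : mat) (k : 'I_n).

Lemma mem_Rk k x : x \in Rk R n k <->
  (forall a : 'I_n.+1, (a < n - k)%N -> x a 0 = 0) /\ x last 0 = 0.
Proof.
split=> [/mem_coordspan h|[h hl]].
  split=> [a ak|]; apply: h; first by rewrite negb_and -ltnNge ak.
  by rewrite /= ltnn andbF.
apply/mem_coordspan => a; rewrite negb_and -ltnNge => /orP[|]; first exact: h.
by rewrite ord_lt_last negbK => /eqP ->.
Qed.

Lemma dim_Rk k : \dim (Rk R n k) = k.
Proof.
rewrite dim_coordspan -sum1_card.
rewrite (eq_bigl (fun i : 'I_n.+1 => (n - k <= i < n)%N))// big_mkcond big_ord_recr/=.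
rewrite ltnn andbF addn0 -big_mkcond/=.
rewrite (eq_bigl (fun i : 'I_n => (n - k <= i)%N)); last by move=> i; rewrite ltn_ord andbT.
rewrite -(big_geq_mkord _ _ predT (fun=> 1%N)).
by rewrite sum_nat_const_nat muln1 subKn// ltnW.
Qed.

(** The boost fixes R^k pointwise and sends e_(n+1) to cosh r (e_(n+1) + tanh r e_(n-k)). This
    matches polar coordinates with the description of z by eta and v, and shows that |v| = tanh
    ||z||. *)
Lemma val_act_polar k A r (eta : {vspace vec}) v :
  SO R n n A -> (fun x => A *m x) @` [set x | x \in Rk R n k] = [set x | x \in eta] ->
  v = tanh r *: (A *m e R (idx k)) ->
  \val (act (A *m hrot (idx k) r) (Hsub_pt R k)) = hyperboloid R n `&`
    [set x | forall W : {vspace vec}, (forall y, y \in eta -> y + v + el \in W) -> x \in W].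
Proof.
move=> SA Aeta vE; have SA1 := SO_SO1 SA.
have SM : SO1 R n (A *m hrot (idx k) r).
  by apply: SO1_mul => //; exact/SO1_hrot/idx_neq_last.
have kn : (k <= n)%N by exact/ltnW.
have Mel : A *m hrot (idx k) r *m el = cosh r *: (v + el).
  rewrite -mulmxA hrot_el ?idx_neq_last// mulmxDr -!scalemxAr (SO_fix_el SA) vE.
  by rewrite scalerDr scalerA /tanh mulrCA divff ?mulr1// cosh_neq0.
have MRk y : y \in Rk R n k -> A *m hrot (idx k) r *m y = A *m y.
  move=> /mem_Rk[y0 yl]; rewrite -mulmxA hrot_fix ?idx_neq_last//.
  by apply: y0; rewrite idxE; have := ltn_ord k; lia.
rewrite val_act//; apply/seteqP; split.
  move=> _ [y /(HsubP _ kn)[Hy y0] <-]; split; first exact: SO1_hyperboloid.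
  move=> W hW.
  have vW : v + el \in W by rewrite -[v]add0r; apply: hW; exact: mem0v.
  pose y' := y - y last 0 *: el.
  have y'R : y' \in Rk R n k.
    have y'E a : y' a 0 = y a 0 - y last 0 * (a == last)%:R by rewrite /y' !mxE eqxx andbT.
    apply/mem_Rk; split=> [a ak|]; rewrite y'E.
      rewrite y0// sub0r; case: eqP => [al|_]; last by rewrite mulr0 oppr0.
      by move: ak; rewrite al/= ltnNge leq_subr.
    by rewrite eqxx mulr1 subrr.
  have -> : y = y' + y last 0 *: el by rewrite subrK.
  rewrite mulmxDr -scalemxAr Mel MRk//; apply: memvD; last exact/memvZ/memvZ.
  have : [set x | x \in eta] (A *m y') by rewrite -Aeta; exists y'.
  move=> /= /hW; rewrite -addrA => /memvB/(_ vW); by rewrite addrK.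
move=> x [Hx xW].
have /memv_addP[x1 x1eta [_ /vlineP[c ->] xE]] : x \in (eta + <[v + el]>)%VS.
  apply: xW => y yeta; rewrite -addrA; apply: memv_add => //; exact: memv_line.
have [y' y'R y'E] : ((fun x => A *m x) @` [set x | x \in Rk R n k]) x1 by rewrite Aeta.
pose y := y' + (c / cosh r) *: el.
have yE : A *m hrot (idx k) r *m y = x.
  by rewrite mulmxDr MRk// -scalemxAr Mel y'E scalerA divfK ?cosh_neq0// xE.
exists y => //; apply/HsubP => //; split.
  have -> : y = linv (A *m hrot (idx k) r) *m x by rewrite -yE mulmxA SO1_linvl// mul1mx.
  by apply: SO1_hyperboloid => //; exact: SO1_linv.
move=> a ak; have /mem_Rk[h _] := y'R.
rewrite mxE h// add0r mxE coord_e; case: eqP => [al|_]; last by rewrite mulr0.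
by move: ak; rewrite al/= ltnNge leq_subr.
Qed.

Lemma is_frame_polar k (z : GammaH R k) A : is_frame z A ->
  [/\ SO R n n A, 0 <= gdist z & act (A *m hrot (idx k) (gdist z)) (Hsub_pt R k) = z].
Proof.
move=> [SA [eta [v [deta etaP [vl v1] zE [Aeta Av]]]]].
have nv0 : 0 <= enorm v by exact: sqrtr_ge0.
have [r r0 rE] := tanh_exist nv0 v1.
have vE : v = tanh r *: (A *m e R (idx k)).
  have [v0|vn] := eqVneq v 0.
    suff -> : tanh r = 0 by rewrite scale0r.
    by rewrite rE v0 /enorm /dot mulmx0 mxE sqrtr0.
  rewrite Av// rE scalerA divff ?scale1r//.
  apply/eqP => /eqP; rewrite sqrtr_eq0 => vv; move/eqP: vn; apply.
  apply: dot_eq0; apply/eqP; rewrite eq_le vv dotE sumr_ge0// => i _.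
  by rewrite -expr2 sqr_ge0.
have zA : act (A *m hrot (idx k) r) (Hsub_pt R k) = z.
  by apply: val_inj; rewrite (val_act_polar SA Aeta vE) zE.
have gr : gdist z = r by rewrite -zA gdist_polar.
by split; rewrite ?gr.
Qed.

Lemma polar_is_frame k A r : SO R n n A -> 0 <= r ->
  is_frame (act (A *m hrot (idx k) r) (Hsub_pt R k)) A.
Proof.
move=> SA r0; split => //.
pose f : 'Hom(vec, vec) := linfun (mulmx A).
have fE y : f y = A *m y by rewrite lfunE.
have SA1 := SO_SO1 SA; have [AA _ _] := SA.
have kerf : lker f == 0%VS.
  apply/lker0P => y z; rewrite !fE => /(congr1 (mulmx (linv A))).
  by rewrite !mulmxA SO1_linvl// !mul1mx.
pose v := tanh r *: (A *m e R (idx k)).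
have Aeta : (fun x => A *m x) @` [set x | x \in Rk R n k] = [set x | x \in (f @: Rk R n k)%VS].
  apply/seteqP; split=> [_ [y yR <-]|x /= /memv_imgP[y yR ->]] /=.
    by rewrite -fE memv_img.
  by exists y; rewrite ?fE.
have Alast y : (A *m y) last 0 = y last 0.
  rewrite mxE (bigD1 last)//= (SO_last_row _ SA) eqxx mul1r big1 ?addr0// => b bl.
  by rewrite (SO_last_row _ SA) (negbTE bl) mul0r.
have ev : enorm v = tanh r.
  rewrite /enorm /v dotZl dotZr dot_orth// dot_e coord_e eqxx mulr1 -expr2.
  by rewrite sqrtr_sqr ger0_norm// tanh_ge0.
exists (f @: Rk R n k)%VS, v; split.
- by rewrite limg_dim_eq ?dim_Rk// (eqP kerf) capv0.
- move=> x /memv_imgP[y /mem_Rk[y0 yl] ->]; rewrite fE Alast yl; split => //.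
  rewrite dotZr dot_orth// dot_e y0 ?mulr0// idxE; have := ltn_ord k; lia.
- rewrite ev tanh_lt1; split => //.
  by rewrite mxE Alast coord_e eq_sym (negbTE (idx_neq_last k)) mulr0.
- exact: val_act_polar.
- split => // vn; rewrite ev scalerA mulVf ?scale1r//.
  by apply: contraNneq vn => t0; rewrite /v t0 scale0r.
Qed.

(** With A e_(n+1) = sinh r u + cosh r e_(n+1) and t1 a rotation sending e_(n-k) to u, one has A =
    t1 g(r) h with h in SO(n). Alignment says that h^T e_(n-k) lies in the first n - k coordinates,
    so some t2 preserving H^k makes h t2 fix e_(n-k) and therefore commute with g(r). *)
Lemma aligned_polar k A : (2 <= n)%N -> SO1 R n A -> aligned k A ->
  exists t r, [/\ SO R n n t, 0 <= r &
    act A (Hsub_pt R k) = act (t *m hrot (idx k) r) (Hsub_pt R k)].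
Proof.
move=> n2 SA hA; have il := idx_neq_last k.
have He : hyperboloid R n (A *m el) by apply: SO1_hyperboloid => //; exact: hyperboloid_el.
have A1 : 1 <= A last last by rewrite -mulmx_e; exact: hyperboloid_ge1.
pose r := arcosh (A last last).
have r0 : 0 <= r by exact: arcosh_ge0.
have cr : cosh r = A last last by exact: arcoshK.
(* At r = 0 the direction u is undetermined, but A itself is a rotation. *)
have [rE|rn] := eqVneq r 0.
  exists A, 0; split => //; last by rewrite hrot0 mulmx1.
  apply: SO1_fix_el => //.
  have := hyperboloid_last He; rewrite mulmx_e -cr rE cosh0 expr1n => /esym/eqP.
  rewrite -subr_eq0 addrAC subrr add0r psumr_eq0 => [/allP h|i _]; last exact: sqr_ge0.
  apply/matrixP => a b; rewrite (ord1 b) coord_e.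
  have [->|al] := eqVneq a last; first by rewrite mulmx_e -cr rE cosh0.
  by have := h a; rewrite mem_index_enum al sqrf_eq0 => /(_ isT)/eqP.
have rgt0 : 0 < r by rewrite lt0r rn.
have sn : sinh r != 0 by rewrite gt_eqF// sinh_gt0.
pose u := (sinh r)^-1 *: (A *m el - cosh r *: el).
have Ael : A *m el = sinh r *: u + cosh r *: el.
  by rewrite scalerA divff// scale1r subrK.
have ul : u last 0 = 0.
  rewrite mxE [(_ - _ : vec) _ _]mxE [(- _ : vec) _ _]mxE [(_ *: _ : vec) _ _]mxE mulmx_e coord_e eqxx.
  by rewrite mulr1 cr subrr mulr0.
have uu : dot u u = 1.
  have ss : \sum_(i < n.+1 | i != last) (A *m el) i 0 ^+ 2 = sinh r ^+ 2.
    have := hyperboloid_last He; rewrite mulmx_e -cr cosh_sqrE; lra.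
  rewrite dotE (bigD1 last)//= ul mulr0 add0r.
  rewrite (eq_bigr (fun i => sinh r ^- 2 * (A *m el) i 0 ^+ 2)); last first.
    move=> i li; rewrite mxE [(_ - _ : vec) _ _]mxE [(- _ : vec) _ _]mxE [(_ *: _ : vec) _ _]mxE coord_e.
    by rewrite (negbTE li) mulr0 subr0; field.
  by rewrite -mulr_sumr ss mulVf// expf_neq0.
have [t1 [St1 t1u _]] := SO_rotate k n2 ul uu.
have S1 := SO_SO1 St1.
pose h := hrot (idx k) (- r) *m linv t1 *m A.
have Sh1 : SO1 R n h.
  by apply: SO1_mul => //; apply: SO1_mul; [exact: SO1_hrot|exact: SO1_linv].
have hel : h *m el = el.
  rewrite /h -(mulmxA _ A el) Ael -t1u -[X in cosh r *: X](SO_fix_el St1) !scalemxAr -mulmxDr.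
  by rewrite mulmxA -(mulmxA _ (linv t1)) SO1_linvl// mulmx1 -hrot_el// mulmxA hrotD// addNr hrot0 mul1mx.
have Sh : SO R n n h by exact: SO1_fix_el.
have AE : A = t1 *m hrot (idx k) r *m h.
  by rewrite /h !mulmxA -(mulmxA t1) hrotD// subrr hrot0 mulmx1 SO1_linvr// mul1mx.
have hk (b : 'I_n.+1) : (n - k <= b)%N -> h (idx k) b = 0.
  move=> kb; have [->|bl] := eqVneq b last.
    by rewrite -mulmx_e hel coord_e (negbTE il).
  have bn : (b < n)%N by rewrite ord_lt_last.
  have := hA b; rewrite kb bn => /(_ isT).
  rewrite AE -mulmxA mxE (bigD1 last)//= (SO_last_row _ St1) eqxx mul1r big1; last first.
    by move=> c cl; rewrite (SO_last_row _ St1) (negbTE cl) mul0r.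
  rewrite addr0 mul_hrotE// eq_sym (negbTE il) eqxx (SO_last_row _ Sh) (negbTE bl) mulr0 addr0.
  by move=> /eqP; rewrite mulf_eq0 (negbTE sn) => /eqP.
pose w := h^T *m e R (idx k).
have [hh _ _] := SO_tr Sh.
have wE a : w a 0 = h (idx k) a by rewrite mulmx_e mxE.
have [t2 [St2 t2w st2]] : exists t, [/\ SO R n n t, t *m e R (idx k) = w &
    (forall a : 'I_n.+1, (n - k <= a)%N -> w a 0 = 0) -> stab k t].
  apply: SO_rotate => //; first by rewrite wE hk// leq_subr.
  by rewrite dot_orth// dot_e coord_e eqxx.
have {}st2 : stab k t2 by apply: st2 => a ka; rewrite wE hk.
have S2 := SO_SO1 St2.
have St : SO R n n (h *m t2) by exact: SO_mul.
exists (t1 *m (h *m t2)), r; split => //; first exact: SO_mul.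
rewrite -[in LHS](act_stab S2 st2) act_mul//; congr (act _ _).
rewrite [in LHS]AE -2!(mulmxA t1) -(mulmxA _ h t2) -(mulmxA t1); congr (t1 *m _).
rewrite hrot_comm// -mulmxA t2w /w mulmxA.
by rewrite trmxK in hh; rewrite hh mul1mx.
Qed.

End frames.

(** * Haar measure and measurability *)

Section matrix_measurability.
Variables (R : realType) (n : nat).
Local Notation mat := 'M[R]_n.+1.
Local Notation last := (@ord_max n).
Local Notation el := (e R last).
Implicit Types (A B : mat).

Lemma measurable_mulmx d0 (T : measurableType d0) (F G : T -> matB R n) :
  measurable_fun setT F -> measurable_fun setT G ->
  measurable_fun setT (fun t => ((F t : mat) *m (G t : mat)) : matB R n).
Proof.
move=> mF mG; apply: measurable_toMat => a b; under eq_fun do rewrite mxE.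
apply: measurable_sum => l; apply: measurable_funM.
  exact: (measurableT_comp (measurable_entry a l) mF).
exact: (measurableT_comp (measurable_entry l b) mG).
Qed.

Lemma measurable_trmx : measurable_fun setT (fun A : matB R n => (A : mat)^T : matB R n).
Proof.
apply: measurable_toMat => a b; under eq_fun do rewrite mxE.
exact: measurable_entry.
Qed.

Lemma measurable_det : measurable_fun setT (fun A : matB R n => \det (A : mat)).
Proof.
apply: measurable_sum => s; apply: measurable_funM => //.
apply: measurable_prod => i _; exact: measurable_entry.
Qed.

Lemma measurable_mx_eq d0 (T : measurableType d0) (F : T -> matB R n) (A : mat) :
  measurable_fun setT F -> measurable [set t | F t = A].
Proof.
move=> mF; pose g t := \sum_a \sum_b ((F t : mat) a b - A a b) ^+ 2.
have mg : measurable_fun setT g.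
  apply: measurable_sum => a; apply: measurable_sum => b; apply: measurable_funX.
  apply: measurable_funB => //; exact: (measurableT_comp (measurable_entry a b) mF).
rewrite (_ : [set t | F t = A] = g @^-1` [set 0]).
  by rewrite -[X in measurable X]setTI; exact: mg.
apply/seteqP; split => t /=.
  by move=> Ft; rewrite /g big1// => a _; rewrite big1// => b _; rewrite Ft subrr expr0n.
move=> /eqP; rewrite psumr_eq0 => [/allP h|a _]; last by apply: sumr_ge0 => b _; exact: sqr_ge0.
apply/matrixP => a b; have /implyP/(_ isT) := h a (mem_index_enum _).
rewrite psumr_eq0 => [/allP h'|c _]; last exact: sqr_ge0.
have /implyP/(_ isT) := h' b (mem_index_enum _).
by rewrite sqrf_eq0 subr_eq0 => /eqP.
Qed.

Lemma measurable_SO1 : measurable (SO1 R n : set (matB R n)).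
Proof.
have -> : SO1 R n = [set A | A^T *m lorentz_mx R n *m A = lorentz_mx R n] `&`
    ((fun A : matB R n => \det (A : mat)) @^-1` [set 1] `&`
     (fun A : matB R n => (A : mat) last last) @^-1` `]0, +oo[).
  apply/seteqP; split => A /=.
    by move=> /SO1P[? ? ?]; split => //; split => //; rewrite in_itv/= andbT.
  by rewrite in_itv/= andbT => -[? [? ?]]; apply/SO1P.
apply: measurableI; [|apply: measurableI].
- apply: (measurable_mx_eq (F := fun A : matB R n => (A : mat)^T *m lorentz_mx R n *m A : matB R n)).
  apply: measurable_mulmx => //; apply: measurable_mulmx => //.
  exact: measurable_trmx.
- by rewrite -[X in measurable X]setTI; exact: measurable_det.
- rewrite -[X in measurable X]setTI; exact: measurable_entry.
Qed.

Lemma measurable_SO m : measurable (SO R n m : set (matB R n)).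
Proof.
have -> : SO R n m = [set A | A^T *m A = 1%:M] `&`
    ((fun A : matB R n => \det (A : mat)) @^-1` [set 1] `&`
     \bigcap_(i in [set i : 'I_n.+1 | ~~ (n - m <= i < n)%N]) [set A : mat | A *m e R i = e R i]).
  apply/seteqP; split => A /= [h1 h2]; [move=> h3|case: h2 => h2 h3]; split => //.
apply: measurableI; [|apply: measurableI].
- apply: (measurable_mx_eq (F := fun A : matB R n => (A : mat)^T *m A : matB R n)).
  apply: measurable_mulmx => //; exact: measurable_trmx.
- by rewrite -[X in measurable X]setTI; exact: measurable_det.
- apply: fin_bigcap_measurable => // i _.
  (* [measurable_mx_eq] concerns square matrices, so the vector equation is multiplied on the right
     by the transpose of e_i. *)
  have -> : [set A : mat | A *m e R i = e R i] =
      [set A | A *m (e R i *m (e R i)^T) = e R i *m (e R i)^T].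
    apply/seteqP; split => A /=; first by rewrite mulmxA => ->.
    move=> /(congr1 (mulmx^~ (e R i))); rewrite -!mulmxA.
    suff -> : (e R i)^T *m e R i = 1%:M by rewrite mulmx1.
    by apply/matrixP => a b; rewrite (ord1 a) (ord1 b) mulmx_e !mxE !eqxx.
  apply: (measurable_mx_eq (F := fun A : matB R n => (A : mat) *m (e R i *m (e R i)^T) : matB R n)).
  exact: measurable_mulmx.
Qed.

End matrix_measurability.

(** * A measurable choice of aligned representatives *)

Section alignment.
Variables (R : realType) (n : nat).
Local Notation mat := 'M[R]_n.+1.
Local Notation last := (@ord_max n).
Local Notation el := (e R last).
Implicit Types (A B : mat) (k : 'I_n).

Definition artanh (x : R) : R := ln ((1 + x) / (1 - x)) / 2.

Lemma artanhK x : -1 < x < 1 -> tanh (artanh x) = x.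
Proof.
move=> /andP[x1 x2].
have p1 : 0 < 1 + x by lra.
have p2 : 0 < 1 - x by lra.
pose a := expR (artanh x).
have a0 : 0 < a by exact: expR_gt0.
have aa : a ^+ 2 = (1 + x) / (1 - x).
  by rewrite expr2 -expRD /artanh -splitr lnK// posrE divr_gt0.
rewrite /tanh /sinh /cosh expRN -/a.
have -> : (a - a^-1) / 2 / ((a + a^-1) / 2) = (a ^+ 2 - 1) / (a ^+ 2 + 1).
  field.
  by rewrite !gt_eqF// ?ltr_pwDl// ?exprn_ge0// ?mulr_gt0//; lra.
rewrite aa; field.
by rewrite !gt_eqF//; lra.
Qed.

Lemma measurable_artanh : measurable_fun setT artanh.
Proof.
apply: measurable_funM => //; apply: (measurableT_comp (@measurable_ln R)).
apply: measurable_funM; first exact: measurable_funD.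
by apply: (measurableT_comp (@measurable_inv R)); exact: measurable_funB.
Qed.

(** The boost parameter is chosen so that the entry of the bottom row in column i becomes 0. *)
Definition align1 (i : 'I_n.+1) A : mat :=
  A *m hrot i (artanh (- A last i / A last last)).

(** Right multiplication by boosts preserving H^k clears the bottom row column by column. Each boost
    changes only its own column and the last one, so zeros already obtained survive. Unlike [frame],
    the result is an explicit function of the entries. *)
Definition align k A : mat :=
  foldr align1 A [seq i : 'I_n.+1 <- enum 'I_n.+1 | (n - k <= i < n)%N].

Lemma measurable_align k : measurable_fun setT (align k : matB R n -> matB R n).
Proof.
rewrite /align; elim: [seq _ <- _ | _] => [|i s IH]; first exact: measurable_id.
have m1 : measurable_fun setT (align1 i : matB R n -> matB R n).
  apply: measurable_mulmx => //.
  apply: (measurableT_comp (@measurable_hrot R n i)); apply: (measurableT_comp measurable_artanh).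
  apply: measurable_funM.
    by apply: measurableT_comp => //; exact: measurable_entry.
  apply: (measurableT_comp (@measurable_inv R)); exact: measurable_entry.
exact: (measurableT_comp m1 IH).
Qed.

Lemma align1_0 i A : i != last -> SO1 R n A -> align1 i A last i = 0.
Proof.
move=> il SA; have /SO1P[hA _ A0] := SA.
rewrite /align1 mulr_hrotE// eqxx.
set x := - A last i / A last last.
have x1 : -1 < x < 1.
  rewrite -ltr_norml /x normrM normrN normfV (gtr0_norm A0) ltr_pdivrMr// mul1r.
  rewrite -[ltRHS](gtr0_norm A0) -ltr_sqr ?nnegrE// !real_normK ?num_real//.
  rewrite lorentz_row// (bigD1 i)//= addrCA ltrDl ltr_pwDl// sumr_ge0// => c _.
  exact: sqr_ge0.
have := artanhK x1; rewrite /tanh => /(canRL (mulfVK (cosh_neq0 _))) ->.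
by rewrite /x; field; rewrite gt_eqF.
Qed.

Lemma alignP k A : SO1 R n A -> [/\ SO1 R n (align k A), aligned k (align k A) &
  act (align k A) (Hsub_pt R k) = act A (Hsub_pt R k)].
Proof.
move=> SA; rewrite /align.
set s := [seq _ <- _ | _].
suff [h1 h2 h3] : [/\ SO1 R n (foldr align1 A s),
    (forall i, i \in s -> foldr align1 A s last i = 0) &
    act (foldr align1 A s) (Hsub_pt R k) = act A (Hsub_pt R k)].
  by split => // b kb; apply: h2; rewrite mem_filter kb mem_enum.
have : all (fun i : 'I_n.+1 => (n - k <= i < n)%N) s by exact: filter_all.
elim: s => //= i s IH /andP[/andP[ki il] als]; have [S1 z1 a1] := IH als.
rewrite ord_lt_last in il.
have Sh r : SO1 R n (hrot i r) by exact: SO1_hrot.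
split; first exact: SO1_mul.
- move=> b; rewrite inE => /predU1P[->|bs]; first exact: align1_0.
  have [->|bi] := eqVneq b i; first exact: align1_0.
  have /andP[_ bl] := allP als b bs; rewrite ord_lt_last in bl.
  by rewrite /align1 mulr_hrotE// (negbTE bi) (negbTE bl) z1.
- by rewrite /align1 -act_mul// act_stab//; exact: stab_hrot.
Qed.

(** The sigma-algebra is coinduced by the orbit map, so measurability is tested on matrices B; those
    outside [SO1] act trivially and form a separate piece. *)
Lemma measurable_act (d : 'I_n) A : measurable_fun setT (@act R n d A).
Proof.
have [SA|nSA] := pselect (SO1 R n A); last first.
  rewrite (_ : @act R n d A = id); first exact: measurable_id.
  by apply/funext => t; exact: act_out.
move=> _ S mS; rewrite setTI.
suff : measurable ((fun B : matB R n => act B (Hsub_pt R d)) @^-1` (act A @^-1` S)) by [].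
have -> : (fun B : matB R n => act B (Hsub_pt R d)) @^-1` (act A @^-1` S) =
    (SO1 R n `&` (fun B : matB R n => act (A *m B) (Hsub_pt R d)) @^-1` S) `|`
    (~` SO1 R n `&` [set _ | S (act A (Hsub_pt R d))]).
  apply/seteqP; split => B /=.
    have [SB|nSB] := pselect (SO1 R n B); first by rewrite act_mul//; left.
    by rewrite (act_out _ nSB); right.
  by move=> [[SB]|[nSB]]; [rewrite act_mul|rewrite (act_out _ nSB)].
apply: measurableU; apply: measurableI.
- exact: measurable_SO1.
- have mm : measurable_fun setT (fun B : matB R n => A *m (B : mat) : matB R n).
    exact: measurable_mulmx.
  rewrite -[X in measurable X]setTI.
  exact: (measurableT_comp (@measurable_orbit R n d) mm measurableT mS).
- by apply: measurableC; exact: measurable_SO1.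
- have [h|h] := pselect (S (act A (Hsub_pt R d))).
    by rewrite (_ : [set _ | _] = setT)//; apply/seteqP; split.
  by rewrite (_ : [set _ | _] = set0)//; apply/seteqP; split.
Qed.

(** The infimum is replaced by its closed form at the aligned representative, a measurable function
    of the matrix. *)
Lemma measurable_gdist (d : 'I_n) : measurable_fun setT (@gdist R n d).
Proof.
move=> _ Y mY; rewrite setTI.
suff : measurable ((fun B : matB R n => act B (Hsub_pt R d)) @^-1` (@gdist R n d @^-1` Y)) by [].
have gE (B : matB R n) : gdist (act B (Hsub_pt R d)) =
    if B \in SO1 R n then arcosh (align d B last last) else gdist (Hsub_pt R d).
  case: ifPn => [|/negP]; rewrite inE => SB; last by rewrite act_out// => /mem_set.
  by have [S1 a1 <-] := alignP d SB; rewrite gdist_aligned.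
rewrite (_ : _ @^-1` _ = (fun B : matB R n => if B \in SO1 R n then arcosh (align d B last last)
   else gdist (Hsub_pt R d)) @^-1` Y); last first.
  by apply/seteqP; split => B /=; rewrite gE.
rewrite -[X in measurable X]setTI; apply: (measurable_fun_ifT _ _ _ measurableT mY) => //.
- apply: (measurable_fun_bool true); rewrite setTI.
  rewrite (_ : _ @^-1` _ = SO1 R n); first exact: measurable_SO1.
  by apply/seteqP; split => B /=; [move=> /set_mem|move=> /mem_set].
- have mar : measurable_fun setT (@arcosh R).
    apply: (measurableT_comp (@measurable_ln R)); apply: measurable_funD => //.
    apply: (measurableT_comp (continuous_measurable_fun (@sqrt_continuous R))).
    by apply: measurable_funB => //; exact: measurable_funX.
  apply: (measurableT_comp mar).
  exact: (measurableT_comp (measurable_entry last last) (measurable_align d)).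
Qed.

End alignment.

(** * Invariance properties deduced from left invariance *)

Section haar.
Variables (R : realType) (n m : nat) (mu : probability (matB R n) R).
Hypothesis Hmu : is_haar m mu.
Local Notation mat := 'M[R]_n.+1.
Local Open Scope ereal_scope.
Implicit Types (f g : matB R n -> \bar R) (A : mat).

Lemma haar_ae (P : matB R n -> Prop) : (forall X, SO R n m X -> P X) -> {ae mu, forall X, P X}.
Proof.
move=> h; exists (~` SO R n m); split.
- by apply: measurableC; exact: measurable_SO.
- rewrite probability_setC; last exact: measurable_SO.
  by have -> : mu (SO R n m) = 1 := Hmu.1; rewrite subee.
- by move=> X /= nP SX; apply: nP; exact: h.
Qed.

Lemma haar_eq_integral f g : measurable_fun setT f -> measurable_fun setT g ->
  (forall X, 0 <= f X) -> (forall X, 0 <= g X) ->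
  (forall X, SO R n m X -> f X = g X) -> \int[mu]_X f X = \int[mu]_X g X.
Proof.
move=> mf mg f0 g0 fg; apply: ge0_ae_eq_integral => //.
by apply: haar_ae => X SX _; exact: fg.
Qed.

Lemma haar_left f A : SO R n m A -> measurable_fun setT f -> (forall X, 0 <= f X) ->
  \int[mu]_X f (A *m (X : mat)) = \int[mu]_X f X.
Proof.
move=> SA mf f0.
pose phi (X : matB R n) : matB R n := A *m (X : mat).
have mphi : measurable_fun setT phi by exact: measurable_mulmx.
transitivity (\int[pushforward mu phi]_X f X).
  by rewrite ge0_integral_pushforward.
by apply: eq_measure_integral => //= S mS _; exact: Hmu.2.
Qed.

(* Evaluating the integral of f (c(X)^T Y) in both orders: the inner integral is
   constant by left invariance, first in Y and then in X. *)
Lemma haar_twist (c : matB R n -> matB R n) f :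
  measurable_fun setT c -> (forall X, SO R n m X -> SO R n m (c X)) ->
  (forall Y, SO R n m Y -> exists2 Y', SO R n m Y' &
     forall X, (Y : mat)^T *m (c X : mat) = c (Y' *m (X : mat))) ->
  measurable_fun setT f -> (forall X, 0 <= f X) ->
  \int[mu]_X f X = \int[mu]_X f ((c X : mat)^T).
Proof.
move=> mc Sc tw mf f0.
pose F (p : matB R n * matB R n) := f ((c p.1 : mat)^T *m (p.2 : mat)).
have mF : measurable_fun setT F.
  apply: (measurableT_comp mf); apply: measurable_mulmx => //.
  apply: (measurableT_comp (@measurable_trmx R n)); exact: (measurableT_comp mc measurable_fst).
have F0 p : 0 <= F p by exact: f0.
have mfc : measurable_fun setT (fun X : matB R n => f ((c X : mat)^T)).
  by apply: (measurableT_comp mf); exact: (measurableT_comp (@measurable_trmx R n) mc).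
have := fubini_tonelli (m1 := mu) (m2 := mu) F mF F0.
rewrite (haar_eq_integral (f := fun X => \int[mu]_Y F (X, Y))
  (g := cst (\int[mu]_X f X))); last 5 first.
- exact: measurable_fun_fubini_tonelli_F.
- exact: measurable_cst.
- by move=> X; exact: integral_ge0.
- by move=> X; exact: integral_ge0.
- by move=> X SX; exact: (haar_left (SO_tr (Sc _ SX)) mf f0).
rewrite (haar_eq_integral (f := fun Y => \int[mu]_X F (X, Y))
  (g := cst (\int[mu]_X f ((c X : mat)^T)))); last 5 first.
- exact: measurable_fun_fubini_tonelli_G.
- exact: measurable_cst.
- by move=> X; exact: integral_ge0.
- by move=> X; exact: integral_ge0.
- move=> Y SY; have [Y' SY' YE] := tw Y SY.
  rewrite -(haar_left SY' mfc)//; apply: eq_integral => X _.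
  by rewrite /F/= -YE trmx_mul trmxK.
have E (a : \bar R) : \int[mu]_X (cst a X) = a.
  by rewrite integral_cst// -[RHS]mule1; congr (a * _); exact: probability_setT.
by rewrite !E.
Qed.

(** The case where c is the identity in [haar_twist]. On SO(m) transposition is inversion, so right
    invariance follows. *)
Lemma haar_tr f : measurable_fun setT f -> (forall X, 0 <= f X) ->
  \int[mu]_X f ((X : mat)^T) = \int[mu]_X f X.
Proof.
move=> mf f0; rewrite -(haar_twist (c := id))//.
by move=> Y SY; exists (Y : mat)^T => //; exact: SO_tr.
Qed.

Lemma haar_right f A : SO R n m A -> measurable_fun setT f -> (forall X, 0 <= f X) ->
  \int[mu]_X f ((X : mat) *m A) = \int[mu]_X f X.
Proof.
move=> SA mf f0.
have mt : measurable_fun setT (fun X : matB R n => f ((X : mat)^T)).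
  exact: (measurableT_comp mf (@measurable_trmx R n)).
rewrite -haar_tr//; last first.
  apply: (measurableT_comp mf); exact: measurable_mulmx.
transitivity (\int[mu]_X f ((A^T *m (X : mat))^T)).
  by apply: eq_integral => X _; rewrite trmx_mul trmxK.
by rewrite (haar_left (f := fun X => f ((X : mat)^T)))// ?haar_tr//; exact: SO_tr.
Qed.

(** Here A may be a reflection, so that conjugation by it is not a product of translations by
    elements of SO(m). Taking c(X) = A X A in [haar_twist] avoids an appeal to uniqueness of Haar
    measure. *)
Lemma haar_conj f A : A *m A = 1%:M ->
  (forall X, SO R n m X -> SO R n m (A *m X *m A)) -> A^T = A ->
  measurable_fun setT f -> (forall X, 0 <= f X) ->
  \int[mu]_X f (A *m (X : mat) *m A) = \int[mu]_X f X.
Proof.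
move=> AA SA At mf f0.
have mt : measurable_fun setT (fun X : matB R n => f ((X : mat)^T)).
  exact: (measurableT_comp mf (@measurable_trmx R n)).
pose c (X : matB R n) : matB R n := A *m (X : mat) *m A.
have mc : measurable_fun setT c.
  by apply: measurable_mulmx => //; exact: measurable_mulmx.
rewrite -[RHS]haar_tr// (haar_twist (c := c) (f := fun X => f ((X : mat)^T)))//.
  by apply: eq_integral => X _; rewrite trmxK.
move=> Y SY; exists (A *m (Y : mat)^T *m A); first exact/SA/SO_tr.
by move=> X; rewrite /c !mulmxA AA mul1mx.
Qed.

End haar.

(** * Integration in polar coordinates *)

Section polar_integration.
Variable R : realType.
Local Notation lambda := (@lebesgue_measure R).
Local Notation D := (`[0%R, +oo[%classic : set R).
Local Open Scope ereal_scope.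

Lemma norm_radial_weight_le (m d N : nat) (r : R) : (0 <= r <= N%:R)%R ->
  (`|radial_weight m d r| <= sphere_area R (m - d) * expR N%:R ^+ (m - d - 1) * expR N%:R ^+ d)%R.
Proof.
move=> /andP[r0 rN].
have cN : (cosh r <= expR N%:R)%R by rewrite (le_trans (cosh_le_expR r0))// ler_expR.
have sN : (`|sinh r| <= expR N%:R)%R by rewrite (le_trans (norm_sinh_le_cosh r)).
rewrite /radial_weight; have := sphere_area_ge0 R (m - d).
move: (sphere_area R (m - d)) => S S0; rewrite !normrM (ger0_norm S0) !normrX.
apply: ler_pM.
- by rewrite mulr_ge0 ?exprn_ge0.
- by rewrite exprn_ge0.
- rewrite ler_wpM2l//.
  by apply: lerXn2r => //; rewrite nnegrE expR_ge0.
- by rewrite (ger0_norm (cosh_ge0 r)); apply: lerXn2r => //; rewrite nnegrE ?cosh_ge0 ?expR_ge0.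
Qed.

(** Tonelli on the product with Haar measure asks for this; the weight is bounded on bounded
    intervals. *)
Lemma radial_sigma_finite (m d : nat) : sigma_finite setT (@radial R m d).
Proof.
exists (fun N : nat => `[(- N%:R)%R, (N%:R)%R]%classic).
  apply/seteqP; split => // x _; exists (Num.Def.archi_bound x) => //=.
  rewrite in_itv/= -ler_norml ltW//; exact: unstable.ltr_norm_bound.
move=> N; split; first exact: measurable_itv.
rewrite /radial.
set M := (sphere_area R (m - d) * expR N%:R ^+ (m - d - 1) * expR N%:R ^+ d)%R.
have mI : measurable (`[(- N%:R)%R, (N%:R)%R] `&` D : set (measurableTypeR R)) by apply: measurableI; exact: measurable_itv.
apply: (@le_lt_trans _ _ (\int[lambda]_(r in `[(- N%:R)%R, (N%:R)%R] `&` D) M%:E)).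
  apply: ge0_le_integral => //.
  - by move=> r [_ /=]; rewrite in_itv/= andbT => r0; rewrite lee_fin radial_weight_ge0.
  - by apply/measurable_EFinP; apply: measurable_funTS; exact: measurable_radial_weight.
  - move=> r [/=]; rewrite !in_itv/= andbT => /andP[_ rN] r0; rewrite lee_fin.
    by rewrite (le_trans (ler_norm _))// norm_radial_weight_le// r0.
rewrite integral_cst//.
apply: (@le_lt_trans _ _ (M%:E * lambda `[(- N%:R)%R, (N%:R)%R]%classic)).
  apply: lee_wpmul2l.
    rewrite lee_fin /M; have := sphere_area_ge0 R (m - d).
    by move: (sphere_area R (m - d)) => S S0; rewrite !mulr_ge0 ?exprn_ge0 ?expR_ge0.
  by apply: le_measure; rewrite ?inE//.
by rewrite lebesgue_measure_itv/=; case: ifPn => _; rewrite ?mule0// -EFinB -EFinM ltry.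
Qed.

HB.instance Definition _ (m d : nat) :=
  @Measure_isSigmaFinite.Build _ _ _ (@radial R m d) (radial_sigma_finite m d).

Lemma radial_integral (m d : nat) (f : R -> \bar R) :
  measurable_fun setT f -> (forall r, 0 <= f r) ->
  \int[@radial R m d]_r f r = \int[lambda]_(r in D) (f r * (radial_weight m d r)%:E).
Proof.
move=> mf f0.
have mD : measurable (D : set R) by [].
have mw : measurable_fun D (@radial_weight R m d).
  by apply: measurable_funTS; exact: measurable_radial_weight.
have w0 r : D r -> (0 <= radial_weight m d r)%R.
  by move=> /=; rewrite in_itv/= andbT => r0; exact: radial_weight_ge0.
(* For r < 0 the weight may be negative, hence the absolute value. The image under [id] below passes
   between the two measurable types carried by the real line. *)
have mw' : measurable_fun (setT : set (measurableTypeR R)) (fun r => `|@radial_weight R m d r|%R).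
  by apply: (measurableT_comp (@normr_measurable R setT)); exact: measurable_radial_weight.
have w0' r : (0 <= `|@radial_weight R m d r|)%R by [].
have nuE : @radial R m d = pushforward (density_measure lambda mD mw' w0') (id : measurableTypeR R -> R).
  apply/funext => A; apply: eq_integral => r; rewrite inE => -[_ Dr].
  by rewrite ger0_norm// w0.
have mid : measurable_fun (setT : set (measurableTypeR R)) (id : measurableTypeR R -> R).
  by move=> _ Y mY; rewrite setTI.
rewrite nuE ge0_integral_pushforward//.
transitivity (\int[lambda]_(r in D) (f r * (`|radial_weight m d r|)%:E)); last first.
  by apply: eq_integral => r; rewrite inE => Dr; rewrite ger0_norm// w0.
by apply: (@ge0_integral_density _ (measurableTypeR R) R lambda (density_measure lambda mD mw' w0')) => //;
  exact: measurable_funTS.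
Qed.

Variable n : nat.
Local Notation mat := 'M[R]_n.+1.

Lemma polar_integral (m : nat) (d : 'I_n) (haar : probability (matB R n) R)
    (psi : GammaH R d -> \bar R) :
  measurable_fun setT psi -> (forall t, 0 <= psi t) ->
  \int[polar_measure m haar]_t psi t = \int[lambda]_(r in D)
    ((\int[haar]_X psi (act ((X : mat) *m hrot (idx d) r) (Hsub_pt R d))) *
     (radial_weight m d r)%:E).
Proof.
move=> mpsi psi0.
have mp : measurable_fun setT (@polar_map R n d) by exact: measurable_polar_map.
transitivity (\int[(@radial R m d \x haar)]_p psi (polar_map d p)).
  by rewrite ge0_integral_pushforward.
rewrite fubini_tonelli1//; last exact: (measurableT_comp mpsi mp).
rewrite radial_integral//.
- by apply: measurable_fun_fubini_tonelli_F => //; exact: (measurableT_comp mpsi mp).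
- by move=> r; exact: integral_ge0.
Qed.

End polar_integration.

(** * Rotations preserving H^k *)

Section stabilizer.
Variables (R : realType) (n : nat) (k j : 'I_n).
Hypothesis ltjk : (j < k)%N.
Local Notation mat := 'M[R]_n.+1.
Local Notation last := (@ord_max n).
Local Notation el := (e R last).
Local Notation Hj := (Hsub_pt R j).
Implicit Types (A X : mat).

Lemma act_eq_el A X : j = 0%N :> nat -> SO1 R n A -> SO1 R n X -> A *m el = X *m el ->
  act A Hj = act X Hj.
Proof.
move=> j0 SA SX AX; apply/act_eqP => // a b /andP[aj jb].
have -> : b = last by apply/eqP; rewrite -[_ == _]negbK -ord_lt_last -leqNgt; move: jb; rewrite j0 subn0.
rewrite -mulmx_e -mulmxA -AX mulmxA SO1_linvl// mul1mx coord_e; case: eqP => // al.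
by move: aj; rewrite al/= ltnNge leq_subr.
Qed.

(* An element h of SO(n) preserving R^k acts on R^k through some c in O(k); when
   det c = -1 it is corrected by a reflection a fixing e_(n-j), which commutes with
   the boost and preserves H^j. *)
Lemma stab_decomposition (h : mat) : (k != 1%N :> nat) -> SO R n n h -> stab k h ->
  exists c a : mat, [/\ SO R n k (c *m a), a^T = a, a *m a = 1%:M,
    (forall X, SO R n k X -> SO R n k (a *m X *m a)) &
    forall X r, SO R n k X ->
      act (h *m (X *m hrot (idx j) r)) Hj = act ((c *m a) *m (a *m X *m a) *m hrot (idx j) r) Hj].
Proof.
move=> k1 Sh sh; have kn := ltn_ord k; have jn := ltn_ord j.
have S1 := SO_SO1 Sh; have [hh dh _] := Sh.
have sh' : stab k h^T by rewrite -(SO_linv Sh); exact: SO_stab_linv.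
(* c is h on the span of H^k and the identity on the other coordinates. *)
pose c : mat := \matrix_(a, b) if (n - k <= a)%N && (n - k <= b)%N then h a b else (a == b)%:R.
have ch (y : 'cV[R]_n.+1) : (forall a : 'I_n.+1, (a < n - k)%N -> y a 0 = 0) -> c *m y = h *m y.
  move=> y0; apply/matrixP => a b; rewrite (ord1 b) !mxE; apply: eq_bigr => i _.
  have [ik|ki] := ltnP i (n - k)%N; first by rewrite y0// !mulr0.
  rewrite mxE ki andbT; case: leqP => // ak; rewrite sh ?ak//.
  by case: eqP => // ai; rewrite ai ltnNge ki in ak.
have cfix (b : 'I_n.+1) : ~~ (n - k <= b < n)%N -> c *m e R b = e R b.
  rewrite negb_and -ltnNge => /orP[bk|].
    apply/matrixP => a i; rewrite (ord1 i) mulmx_e mxE coord_e.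
    by rewrite [(n - k <= b)%N]leqNgt bk andbF.
  rewrite ord_lt_last negbK => /eqP ->; rewrite ch; first exact: SO_fix_el Sh.
  by move=> a ak; rewrite coord_e; case: eqP => // al; move: ak; rewrite al/= ltnNge leq_subr.
have cc : c^T *m c = 1%:M.
  apply/matrixP => a b; rewrite -mulmx_e -mulmxA.
  have [ka|ak] := leqP (n - k)%N a; have [kb|bk] := leqP (n - k)%N b; last first.
  - rewrite cfix ?negb_and -?ltnNge ?bk// mulmx_e mxE [c b a]mxE.
    by rewrite [(n - k <= b)%N]leqNgt bk /= mxE eq_sym.
  - rewrite mxE (bigD1 a)//= mxE; have caa i : c i a = (i == a)%:R.
      by rewrite mxE [(n - k <= a)%N]leqNgt ak andbF.
    rewrite caa eqxx mul1r big1 ?addr0; last by move=> i ia; rewrite mxE caa (negbTE ia) mul0r.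
    rewrite mulmx_e mxE [(n - k <= a)%N]leqNgt ak/= mxE.
    by [].
  - rewrite cfix ?negb_and -?ltnNge ?bk// mulmx_e mxE [c b a]mxE.
    by rewrite [(n - k <= b)%N]leqNgt bk /= mxE eq_sym.
  - have eb0 (i : 'I_n.+1) : (i < n - k)%N -> e R b i 0 = 0.
      by move=> ik; rewrite coord_e; case: eqP => // ib; rewrite ib ltnNge kb in ik.
    rewrite ch//; have <- : (h^T *m (h *m e R b)) a 0 = (1%:M : mat) a b.
      by rewrite mulmxA hh mul1mx coord_e mxE.
    rewrite !mxE; apply: eq_bigr => i _; rewrite !mxE ka andbT.
    case: leqP => // ik; rewrite (_ : \sum_(j0 < n.+1) h i j0 * e R b j0 0 = 0) ?mulr0//.
    by have := mulmx_e h b i; rewrite mxE => ->; rewrite sh// ik.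
have dc : \det c ^+ 2 = 1 by rewrite expr2 -[X in (X * _) ]det_tr -det_mulmx cc det1.
have [a [at_ aa da afix ae]] : exists a : mat, [/\ a^T = a, a *m a = 1%:M, \det a = \det c,
    (forall b : 'I_n.+1, ~~ (n - k <= b < n)%N || (b == idx j) -> a *m e R b = e R b) &
    (forall b, exists s : R, a *m e R b = s *: e R b)].
  move/eqP: dc; rewrite sqrf_eq1 => /orP[|] /eqP dc.
    exists 1%:M; split; rewrite ?trmx1 ?mulmx1 ?det1 ?dc//; first by move=> b _; rewrite mul1mx.
    by move=> b; exists 1 ; rewrite mul1mx scale1r.
  (* A coordinate direction of R^k other than e_(n-j) exists because k >= 2. *)
  have [l [kl ll lj]] : exists l : 'I_n.+1, [/\ (n - k <= l)%N, (l < n)%N & l != idx j].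
    have [e0|e0] := eqVneq (idx j : nat) (n - k)%N.
      have l1 : ((n - k).+1 < n.+1)%N by lia.
      by exists (Ordinal l1); rewrite -val_eqE /= -[X in _ != X]/(idx j : nat) e0; split; lia.
    have l1 : ((n - k) < n.+1)%N by lia.
    by exists (Ordinal l1); rewrite -val_eqE /= -[X in _ != X]/(idx j : nat) eq_sym; split => //=; lia.
  exists (reflection (e R l)); split.
  - exact: reflection_tr.
  - exact: reflectionK.
  - by rewrite det_reflection_e dc.
  - move=> b hb; rewrite reflection_e; case: eqP => [bl|]; last by rewrite scale1r.
    by move: hb; rewrite bl kl ll (negbTE lj).
  - by move=> b; eexists; exact: reflection_e.
have det2 : (\det a * \det a)  = 1 by rewrite -det_mulmx aa det1.
have Sca : SO R n k (c *m a).
  split.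
  - by rewrite trmx_mul -mulmxA (mulmxA _ c) cc mul1mx at_.
  - by rewrite det_mulmx -da.
  - by move=> i hi; rewrite -mulmxA afix ?hi// cfix.
have SaXa X : SO R n k X -> SO R n k (a *m X *m a).
  move=> [XX dX fX]; split.
  - by rewrite !trmx_mul at_ -!mulmxA (mulmxA a a) aa mul1mx (mulmxA _ X) XX mul1mx.
  - by rewrite !det_mulmx dX mulr1.
  - by move=> i hi; rewrite -!mulmxA afix ?hi// fX// afix ?hi.
exists c, a; split => // X r SX.
have il := idx_neq_last j; have Shr : SO1 R n (hrot (idx j) r) by exact: SO1_hrot.
have E : (c *m a) *m (a *m X *m a) *m hrot (idx j) r = c *m X *m (a *m hrot (idx j) r).
  by rewrite !mulmxA -(mulmxA c a a) aa mulmx1.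
have SM1 : SO1 R n (h *m (X *m hrot (idx j) r)).
  by apply: SO1_mul => //; apply: SO1_mul => //; exact: SO_SO1 SX.
have SM2 : SO1 R n ((c *m a) *m (a *m X *m a) *m hrot (idx j) r).
  by apply: SO1_mul => //; apply: SO1_mul; [exact: SO_SO1 Sca|exact: SO_SO1 (SaXa _ SX)].
apply/act_eqP => // i b /andP[ij jb].
(* Each vector g(r) e_b is an eigenvector of a: the boost of e_(n+1) lies in a plane fixed by a, and
   the other e_b are eigenvectors left unchanged by the boost. Scalar factors do not affect the
   image of the subspace. *)
have [s sE] : exists s : R, a *m (hrot (idx j) r *m e R b) = s *: (hrot (idx j) r *m e R b).
  have [->|bl] := eqVneq b last.
    exists 1 ; rewrite scale1r hrot_el// mulmxDr -!scalemxAr !afix ?eqxx ?orbT//.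
    by rewrite ltnn andbF.
  have [s sE] := ae b; exists s; rewrite hrot_fix// coord_e.
    case: eqP => // bi; move: jb; rewrite -bi idxE; lia.
  by rewrite eq_sym (negbTE bl).
have Xy (i0 : 'I_n.+1) : (i0 < n - k)%N -> (X *m (hrot (idx j) r *m e R b)) i0 0 = 0.
  move: i0; apply: (stabP _ _).1; first exact: (SO_stab (ltnW kn) SX).
  apply: (stabP _ _).1; first by apply: stab_hrot => //; rewrite idxE; lia.
  by move=> i0 ik; rewrite coord_e; case: eqP => // ib; move: ik; rewrite ib; lia.
have M2b : (c *m a) *m (a *m X *m a) *m hrot (idx j) r *m e R b =
    s *: (h *m (X *m hrot (idx j) r) *m e R b).
  by rewrite E -!mulmxA sE -!scalemxAr ch.
rewrite -mulmx_e -(mulmxA (linv _)) M2b -scalemxAr (mulmxA (linv _)) SO1_linvl// mul1mx mxE coord_e.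
by case: eqP => [ib|_]; [move: ij; rewrite ib ltnNge jb|rewrite mulr0].
Qed.

End stabilizer.

(** * Invariance and measurability of integrals over subgeodesics *)

Section subgeodesic_measure.
Variables (R : realType) (n : nat) (k j : 'I_n).
Variable haark : probability (matB R n) R.
Hypotheses (ltjk : (j < k)%N) (Hk : is_haar k haark).
Local Notation mat := 'M[R]_n.+1.
Local Notation last := (@ord_max n).
Local Notation el := (e R last).
Local Notation lambda := (@lebesgue_measure R).
Local Notation D := (`[0%R, +oo[%classic : set R).
Local Notation Hj := (Hsub_pt R j).
Local Open Scope ereal_scope.
Implicit Types (A X : mat).

Section with_function.
Variable psi : GammaH R j -> \bar R.
Hypotheses (mpsi : measurable_fun setT psi) (psi0 : forall t, 0 <= psi t).

Lemma measurable_psi_orbit : measurable_fun setT (fun B : matB R n => psi (act B Hj)).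
Proof. exact: (measurableT_comp mpsi (@measurable_orbit R n j)). Qed.

Lemma dm_polar A : SO1 R n A -> k != 1%N :> nat ->
  \int[dm k j haark]_t psi (act A t) = \int[lambda]_(r in D)
    ((\int[haark]_X psi (act (A *m ((X : mat) *m hrot (idx j) r)) Hj)) *
     (radial_weight k j r)%:E).
Proof.
move=> SA k1; rewrite /dm (negbTE k1).
have mA : measurable_fun setT (fun t => psi (act A t)).
  exact: (measurableT_comp mpsi (measurable_act A)).
rewrite (polar_integral k haark mA (fun t => psi0 (act A t))).
apply: eq_integral => r _; congr (_ * _).
apply: (haar_eq_integral Hk).
- apply: (measurableT_comp (measurableT_comp mA (@measurable_orbit R n j))).
  exact: measurable_mulmx.
- apply: (measurableT_comp measurable_psi_orbit).
  by apply: measurable_mulmx => //; exact: measurable_mulmx.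
- by [].
- by [].
- move=> X SX; rewrite act_mul//; apply: SO1_mul; first exact: SO_SO1 SX.
  exact/SO1_hrot/idx_neq_last.
Qed.

Lemma dm_line A : SO1 R n A -> k = 1%N :> nat ->
  \int[dm k j haark]_t psi (act A t) =
  \int[lambda]_r psi (act (A *m hrot (idx j) r) Hj).
Proof.
move=> SA k1; rewrite /dm k1 eqxx.
have mA : measurable_fun setT (fun t => psi (act A t)).
  exact: (measurableT_comp mpsi (measurable_act A)).
have ml := @measurable_line_map R n j.
transitivity (\int[lambda]_r psi (act A (line_map j r))).
  by rewrite ge0_integral_pushforward.
apply: eq_integral => r _; rewrite act_mul//; exact/SO1_hrot/idx_neq_last.
Qed.

(** Tonelli gives measurability of the explicit radial formula. Agreement is claimed on [SO1] only,
    where [act_mul] allows A to be merged with the matrix of the orbit map. *)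
Lemma measurable_dm_act : exists Theta : matB R n -> \bar R,
  [/\ measurable_fun setT Theta, (forall A, 0 <= Theta A) &
    forall A, SO1 R n A -> \int[dm k j haark]_t psi (act A t) = Theta A].
Proof.
have mh : measurable_fun setT (fun p : matB R n * R => hrot (idx j) p.2 : matB R n).
  exact: (measurableT_comp (@measurable_hrot R n (idx j)) measurable_snd).
have [k1|k1] := eqVneq (k : nat) 1%N.
  exists (fun A : matB R n => \int[lambda]_r psi (act ((A : mat) *m hrot (idx j) r) Hj)).
  split; [|by move=> A; exact: integral_ge0|by move=> A SA; rewrite dm_line].
  pose f (p : matB R n * measurableTypeR R) := psi (act ((p.1 : mat) *m hrot (idx j) p.2) Hj).
  have mf : measurable_fun setT f.
    apply: (measurableT_comp measurable_psi_orbit); apply: measurable_mulmx => //.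
  apply: (@measurable_fun_fubini_tonelli_F _ _ _ _ _ lambda f) => // p; exact: psi0.
exists (fun A : matB R n => \int[lambda]_(r in D)
    ((\int[haark]_X psi (act ((A : mat) *m ((X : mat) *m hrot (idx j) r)) Hj)) *
     (`|radial_weight k j r|%R)%:E)).
have mR : measurable_fun setT (fun r : R => (`|@radial_weight R k j r|%R)).
  by apply: (measurableT_comp (@normr_measurable R setT)); exact: measurable_radial_weight.
split.
- pose g (q : (matB R n * R) * matB R n) :=
    psi (act ((q.1.1 : mat) *m ((q.2 : mat) *m hrot (idx j) q.1.2)) Hj).
  have mg : measurable_fun setT g.
    apply: (measurableT_comp measurable_psi_orbit); apply: measurable_mulmx.
      exact: (measurableT_comp measurable_fst measurable_fst).
    apply: measurable_mulmx => //; exact: (measurableT_comp mh measurable_fst).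
  pose f (p : matB R n * R) := (\int[haark]_X g (p, X)) * (`|radial_weight k j p.2|%R)%:E.
  have mf : measurable_fun setT f.
    apply: emeasurable_funM.
      by apply: measurable_fun_fubini_tonelli_F => // q; exact: psi0.
    by apply/measurable_EFinP; exact: (measurableT_comp mR measurable_snd).
  have f0 p : 0 <= f p.
    by apply: mule_ge0; [apply: integral_ge0 => X _; exact: psi0|rewrite lee_fin].
  rewrite (_ : (fun A => _) = (fun A => \int[lambda]_(r in D) f (A, r))); last by [].
  exact: measurable_integral_in.
- move=> A; apply: integral_ge0 => r _; apply: mule_ge0; last by rewrite lee_fin.
  exact: integral_ge0.
- move=> A SA; rewrite (dm_polar SA k1); apply: eq_integral => r; rewrite inE/= in_itv/= andbT => r0.
  by rewrite ger0_norm// radial_weight_ge0.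
Qed.

(** This is the independence of R_H from the frame. For k >= 2, h acts on R^k as an orthogonal map
    of either sign, handled by conjugation with a reflection and a left translation. For k = 1 it
    acts on the line by a sign, and Lebesgue measure is even. *)
Lemma dm_stab h : SO R n n h -> stab k h ->
  \int[dm k j haark]_t psi (act h t) = \int[dm k j haark]_t psi t.
Proof.
move=> Sh sh; have S1 := SO_SO1 Sh.
rewrite -[RHS](_ : \int[dm k j haark]_t psi (act 1%:M t) = _); last first.
  by apply: eq_integral => t _; rewrite act1.
have il := idx_neq_last j.
have [k1|k1] := eqVneq (k : nat) 1%N; last first.
  rewrite (dm_polar S1 k1) (dm_polar (@SO1_1 R n) k1).
  apply: eq_integral => r _; congr (_ * _).
  have [c [a [Sca at_ aa SaXa E]]] := stab_decomposition ltjk k1 Sh sh.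
  have mg : measurable_fun setT (fun X : matB R n => psi (act ((X : mat) *m hrot (idx j) r) Hj)).
    by apply: (measurableT_comp measurable_psi_orbit); exact: measurable_mulmx.
  have mf : measurable_fun setT (fun X : matB R n => psi (act ((c *m a) *m (X : mat) *m hrot (idx j) r) Hj)).
    apply: (measurableT_comp measurable_psi_orbit); apply: measurable_mulmx => //.
    exact: measurable_mulmx.
  transitivity (\int[haark]_X psi (act ((c *m a) *m (a *m (X : mat) *m a) *m hrot (idx j) r) Hj)).
    apply: (haar_eq_integral Hk) => //.
    - apply: (measurableT_comp measurable_psi_orbit).
      by apply: measurable_mulmx => //; exact: measurable_mulmx.
    - apply: (measurableT_comp measurable_psi_orbit); apply: measurable_mulmx => //.
      apply: measurable_mulmx => //; apply: measurable_mulmx => //; exact: measurable_mulmx.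
    - by move=> X SX; rewrite E.
  apply: etrans (haar_conj Hk aa SaXa at_ mf (fun=> psi0 _)) _.
  apply: etrans (haar_left Hk Sca mg (fun=> psi0 _)) _.
  by apply: eq_integral => X _; rewrite mul1mx.
have j0 : j = 0%N :> nat by move: ltjk; rewrite k1; case: (j : nat).
rewrite (dm_line S1 k1) (dm_line (@SO1_1 R n) k1).
have mf : measurable_fun setT (fun r : measurableTypeR R => psi (act (hrot (idx j) r) Hj)).
  by apply: (measurableT_comp measurable_psi_orbit); exact: measurable_hrot.
(* H^1 has a single space direction, which h multiplies by c; orthogonality gives c = 1 or c =
   -1. *)
pose c := h (idx j) (idx j).
have he : h *m e R (idx j) = (c *: e R (idx j))%R.
  apply/matrixP => a b; rewrite (ord1 b) mulmx_e mxE coord_e.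
  case: (eqVneq a (idx j)) => [->|ai]; first by rewrite mulr1.
  rewrite mulr0; have [->|al] := eqVneq a last.
    by rewrite (SO_last_row _ Sh) (negbTE il).
  apply: sh; rewrite k1 idxE j0 leqnn andbT.
  have : (a < n)%N by rewrite ord_lt_last.
  by move: ai; rewrite -val_eqE /= -[X in _ != X]/(idx j : nat) idxE j0; lia.
have cc : (c ^+ 2 = 1)%R.
  have [hh _ _] := Sh.
  have := dot_orth (e R (idx j)) (e R (idx j)) hh.
  by rewrite he dotZl dotZr dot_e coord_e eqxx mulr1 expr2.
have cosc r : cosh (c * r)%R = cosh r.
  by move/eqP: cc; rewrite sqrf_eq1 => /orP[] /eqP ->; rewrite ?mul1r ?mulN1r ?coshN.
have sinc r : sinh (c * r)%R = (c * sinh r)%R.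
  by move/eqP: cc; rewrite sqrf_eq1 => /orP[] /eqP ->; rewrite ?mul1r ?mulN1r ?sinhN.
transitivity (\int[lambda]_r psi (act (hrot (idx j) (c * r)%R) Hj)).
  apply: eq_integral => r _; congr psi; apply: act_eq_el => //.
  - by apply: SO1_mul => //; exact: SO1_hrot.
  - exact: SO1_hrot.
  - rewrite -mulmxA !hrot_el// mulmxDr -!scalemxAr he (SO_fix_el Sh) cosc sinc.
    by rewrite scalerA mulrC.
under [RHS]eq_integral do rewrite mul1mx.
move/eqP: cc; rewrite sqrf_eq1 => /orP[] /eqP ->.
  by apply: eq_integral => r _; rewrite mul1r.
under [LHS]eq_integral do rewrite mulN1r.
have mN : measurable_fun (setT : set (measurableTypeR R)) (-%R : measurableTypeR R -> measurableTypeR R).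
  exact: oppr_measurable.
transitivity (\int[pushforward lambda (-%R : measurableTypeR R -> measurableTypeR R)]_r
    psi (act (hrot (idx j) r) Hj)).
  by rewrite ge0_integral_pushforward.
by apply: eq_measure_integral => //= S mS _; exact: lebesgue_measureN.
Qed.

End with_function.

End subgeodesic_measure.

Lemma measurable_from_orbit (R : realType) (n : nat) (d : 'I_n) d0 (T : measurableType d0)
    (F : GammaH R d -> T) (g : matB R n -> T) : measurable_fun setT g ->
  (forall A, SO1 R n A -> F (act A (Hsub_pt R d)) = g A) -> measurable_fun setT F.
Proof.
move=> mg Fg _ Y mY; rewrite setTI.
suff : measurable ((fun B : matB R n => act B (Hsub_pt R d)) @^-1` (F @^-1` Y)) by [].
have -> : (fun B : matB R n => act B (Hsub_pt R d)) @^-1` (F @^-1` Y) =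
    (SO1 R n `&` g @^-1` Y) `|` (~` SO1 R n `&` [set _ | Y (F (Hsub_pt R d))]).
  apply/seteqP; split => B /=.
    by have [SB|nSB] := pselect (SO1 R n B); [rewrite Fg//; left|rewrite act_out//; right].
  by move=> [[SB]|[nSB]]; [rewrite Fg|rewrite act_out].
apply: measurableU; apply: measurableI.
- exact: measurable_SO1.
- by rewrite -[X in measurable X]setTI; exact: mg.
- by apply: measurableC; exact: measurable_SO1.
- have [h|h] := pselect (Y (F (Hsub_pt R d))).
    by rewrite (_ : [set _ | _] = setT)//; apply/seteqP; split.
  by rewrite (_ : [set _ | _] = set0)//; apply/seteqP; split.
Qed.

(** Folds arc length on H^1 onto the half-line; this is the origin of the 2 in [dm_mass]. *)
Lemma ge0_even_integral (R : realType) (f : R -> \bar R) :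
  measurable_fun setT f -> (forall x, (0 <= f x)%E) -> (forall x, f (- x) = f x) ->
  (\int[@lebesgue_measure R]_x f x = 2%:E * \int[@lebesgue_measure R]_(x in `[0%R, +oo[) f x)%E.
Proof.
move=> mf f0 fN.
have E : (`]-oo, 0%R[ `|` `[0%R, +oo[ = setT :> set R).
  apply/seteqP; split => // x _ /=; rewrite !in_itv/= andbT.
  by case: ltP; [left|right].
rewrite -[X in (\int[_]_(x in X) _)%E]E ge0_integral_setU//=.
- rewrite (integral_itv_bndo_bndc (r := 0%R)); last exact: measurable_funTS.
  have := @ge0_integration_by_substitution0 R f mf f0.
  under [X in _ = X -> _]eq_integral do rewrite fN.
  by move=> <-; rewrite mule_natl mule2n.
- by rewrite E.
- apply/disj_setPS => x [] /=; rewrite !in_itv/= andbT => x0.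
  by rewrite leNgt x0.
Qed.

(** * Means over K of the transform of a nonnegative function *)

Section averages.
Variables (R : realType) (n : nat) (k j : 'I_n).
Variables haarn haark : probability (matB R n) R.
Hypotheses (n_ge2 : (2 <= n)%N) (ltjk : (j < k)%N).
Hypotheses (Hn : is_haar n haarn) (Hk : is_haar k haark).
Local Notation mat := 'M[R]_n.+1.
Local Notation last := (@ord_max n).
Local Notation el := (e R last).
Local Notation lambda := (@lebesgue_measure R).
Local Notation D := (`[0%R, +oo[%classic : set R).
Local Notation Hj := (Hsub_pt R j).
Local Notation Hkz := (Hsub_pt R k).
Local Open Scope ereal_scope.
Implicit Types (A X : mat).

Variable psi : GammaH R j -> \bar R.
Hypotheses (mpsi : measurable_fun setT psi) (psi0 : forall t, 0 <= psi t).

Lemma measurable_dm_integral_act : measurable_fun setT (fun A : matB R n => \int[dm k j haark]_t psi (act A t)).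
Proof.
have [Th [mT T0 TE]] := measurable_dm_act Hk mpsi psi0.
have -> : (fun A : matB R n => \int[dm k j haark]_t psi (act A t)) =
    (fun A => if A \in SO1 R n then Th A else \int[dm k j haark]_t psi t).
  apply/funext => A; case: ifPn => [/set_mem|/negP h]; first exact: TE.
  by apply: eq_integral => t _; rewrite act_out// => /mem_set.
apply: measurable_fun_ifT => //.
apply: (measurable_fun_bool true); rewrite setTI.
rewrite (_ : _ @^-1` _ = SO1 R n); first exact: measurable_SO1.
by apply/seteqP; split => B /=; [move=> /set_mem|move=> /mem_set].
Qed.

(** The transform of a nonnegative function, kept in the extended reals so that divergence is
    visible. For measurable f, [RH_exists] amounts to finiteness of this integral for |f|. *)
Definition frame_integral (z : GammaH R k) : \bar R :=
  \int[dm k j haark]_t psi (act (frame z *m hrot (idx k) (gdist z)) t).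

(** The matrix of the chosen frame differs from A by a rotation preserving H^k, which [dm_stab]
    removes. *)
Lemma frame_integral_aligned A : SO1 R n A -> aligned k A ->
  frame_integral (act A Hkz) = \int[dm k j haark]_t psi (act A t).
Proof.
move=> SA hA; set z := act A Hkz.
have [t [r [St r0 zE]]] := aligned_polar n_ge2 SA hA.
have fz : is_frame z (frame z).
  rewrite /frame; case: xgetP => // h; exfalso; apply: (h t).
  by rewrite /z zE; exact: polar_is_frame.
have [Sf g0 fE] := is_frame_polar fz.
set M := frame z *m hrot (idx k) (gdist z).
have SM : SO1 R n M by apply: SO1_mul; [exact: SO_SO1 Sf|exact/SO1_hrot/idx_neq_last].
have aM : aligned k M by exact: aligned_hrot.
have [h [Sh sh ME]] := aligned_stab SA SM hA aM (esym fE).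
rewrite /frame_integral -/M ME.
transitivity (\int[dm k j haark]_t0 psi (act A (act h t0))).
  by apply: eq_integral => t0 _; rewrite act_mul//; exact: SO_SO1 Sh.
rewrite (dm_stab ltjk Hk (psi := fun t => psi (act A t)))//.
exact: (measurableT_comp mpsi (measurable_act A)).
Qed.

(** The uncontrolled frame is traded for the measurable representative [align k A]. *)
Lemma measurable_frame_integral : measurable_fun setT frame_integral.
Proof.
apply: (measurable_from_orbit (g := fun A => \int[dm k j haark]_t psi (act (align k A) t))).
  exact: (measurableT_comp measurable_dm_integral_act (measurable_align k)).
by move=> A SA; have [S1 a1 <-] := alignP k SA; exact: frame_integral_aligned.
Qed.

(** The mean over all t with cosh ||t|| = x. In this variable, composing two boosts as in
    [hrot_hrot] becomes multiplication. *)
Definition average (x : R) : \bar R :=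
  \int[haarn]_A psi (act ((A : mat) *m hrot (idx j) (arcosh x)) Hj).

Lemma measurable_arcosh : measurable_fun setT (@arcosh R).
Proof.
apply: (measurableT_comp (@measurable_ln R)); apply: measurable_funD => //.
apply: (measurableT_comp (continuous_measurable_fun (@sqrt_continuous R))).
by apply: measurable_funB => //; exact: measurable_funX.
Qed.

Lemma measurable_average : measurable_fun setT average.
Proof.
pose f (p : R * matB R n) := psi (act ((p.2 : mat) *m hrot (idx j) (arcosh p.1)) Hj).
apply: (@measurable_fun_fubini_tonelli_F _ _ _ _ _ haarn f); last by move=> p; exact: psi0.
apply: (measurableT_comp (measurable_psi_orbit mpsi)); apply: measurable_mulmx => //.
apply: (measurableT_comp (@measurable_hrot R n (idx j))).
exact: (measurableT_comp measurable_arcosh measurable_fst).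
Qed.

Lemma average_ge0 x : 0 <= average x.
Proof. exact: integral_ge0. Qed.

(** The rotation t of [hrot_hrot] is absorbed by right invariance. *)
Lemma average_hrot_hrot r s :
  \int[haarn]_A psi (act ((A : mat) *m (hrot (idx k) r *m hrot (idx j) s)) Hj) =
  average (cosh r * cosh s).
Proof.
have [t [q [St q0 cq E]]] := hrot_hrot r s n_ge2 ltjk.
have S1 := SO_SO1 St.
have Sj q0' : SO1 R n (hrot (idx j) q0') := SO1_hrot q0' (idx_neq_last j).
have Sk q0' : SO1 R n (hrot (idx k) q0') := SO1_hrot q0' (idx_neq_last k).
rewrite /average -cq (coshK q0).
have mf : measurable_fun setT (fun X : matB R n => psi (act ((X : mat) *m hrot (idx j) q) Hj)).
  by apply: (measurableT_comp (measurable_psi_orbit mpsi)); exact: measurable_mulmx.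
apply: etrans (haar_right Hn St mf (fun=> psi0 _)).
apply: (haar_eq_integral Hn) (fun=> psi0 _) (fun=> psi0 _) _.
- by apply: (measurableT_comp (measurable_psi_orbit mpsi)); exact: measurable_mulmx.
- apply: (measurableT_comp (measurable_psi_orbit mpsi)); apply: measurable_mulmx => //.
  exact: measurable_mulmx.
- move=> X SX; rewrite -mulmxA -(act_mul _ (SO_SO1 SX) (SO1_mul (Sk r) (Sj s))).
  by rewrite E (act_mul _ (SO_SO1 SX) (SO1_mul S1 (Sj q))).
Qed.

(** The angular factor of [dm]. For k = 1 the two half-lines give 2, which is the value of sigma_0,
    without evaluating Gamma at 1/2. *)
Definition dm_mass : R := (if k == 1%N :> nat then 2 else sphere_area R (k - j))%R.

(** A rotation X in SO(k) fixes e_(n-k), so it commutes with the outer boost and, once the integrals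
    are exchanged, is absorbed by right invariance on K. The inner integral then depends on r and s
    only. *)
Lemma haar_dm_average r :
  \int[haarn]_A \int[dm k j haark]_t psi (act ((A : mat) *m hrot (idx k) r) t) =
  dm_mass%:E * \int[lambda]_(s in D)
    (average (cosh r * cosh s)%R * (sinh s ^+ (k - j - 1) * cosh s ^+ j)%:E).
Proof.
have kl := idx_neq_last k.
have SAr A : SO R n n A -> SO1 R n (A *m hrot (idx k) r).
  by move=> SA; apply: SO1_mul; [exact: SO_SO1 SA|exact: SO1_hrot].
have mavg : measurable_fun setT (fun s : R => average (cosh r * cosh s)%R).
  apply: (measurableT_comp measurable_average); apply: measurable_funM => //.
  exact: measurable_cosh.
have mw1 : measurable_fun setT (fun s : R => (sinh s ^+ (k - j - 1) * cosh s ^+ j)%R).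
  apply: measurable_funM; apply: measurable_funX; [exact: measurable_sinh|exact: measurable_cosh].
have mdm : measurable_fun setT (fun A : matB R n =>
    \int[dm k j haark]_t psi (act ((A : mat) *m hrot (idx k) r) t)).
  have mr : measurable_fun setT (fun A : matB R n => (A : mat) *m hrot (idx k) r : matB R n).
    exact: measurable_mulmx.
  exact: (measurableT_comp measurable_dm_integral_act mr).
have mh : measurable_fun setT (fun p : matB R n * R => hrot (idx j) p.2 : matB R n).
  exact: (measurableT_comp (@measurable_hrot R n (idx j)) measurable_snd).
rewrite /dm_mass; case: ifPn => [/eqP|] k1.
  pose f (p : matB R n * measurableTypeR R) :=
    psi (act ((p.1 : mat) *m (hrot (idx k) r *m hrot (idx j) p.2)) Hj).
  have mf : measurable_fun setT f.
    apply: (measurableT_comp (measurable_psi_orbit mpsi)); apply: measurable_mulmx => //.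
    by apply: measurable_mulmx.
  have f0 p : 0 <= f p by exact: psi0.
  rewrite (haar_eq_integral Hn (g := fun A => \int[lambda]_s f (A, s)) mdm); last 4 first.
  - exact: measurable_fun_fubini_tonelli_F.
  - by move=> A; exact: integral_ge0.
  - by move=> A; exact: integral_ge0.
  - move=> A SA; rewrite (dm_line haark mpsi psi0 (SAr A SA) k1).
    by apply: eq_integral => s _; rewrite /f/= mulmxA.
  rewrite (fubini_tonelli f mf f0).
  under eq_integral do rewrite /f/= average_hrot_hrot.
  rewrite (ge0_even_integral mavg (fun=> average_ge0 _)); last by move=> s; rewrite coshN.
  congr (_ * _); apply: eq_integral => s _.
  have j0 : (j : nat) = 0%N by move: ltjk; rewrite k1; case: (j : nat).
  by rewrite k1 j0 !expr0 mulr1 mule1.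
pose w (s : R) : R := `|radial_weight k j s|%R.
have mw : measurable_fun setT w.
  by apply: (measurableT_comp (@normr_measurable R setT)); exact: measurable_radial_weight.
pose g (q : (matB R n * R) * matB R n) :=
  psi (act (((q.1.1 : mat) *m hrot (idx k) r) *m ((q.2 : mat) *m hrot (idx j) q.1.2)) Hj).
have mg : measurable_fun setT g.
  apply: (measurableT_comp (measurable_psi_orbit mpsi)); apply: measurable_mulmx.
    apply: measurable_mulmx => //; exact: (measurableT_comp measurable_fst measurable_fst).
  apply: measurable_mulmx => //; exact: (measurableT_comp mh measurable_fst).
have g0 q : 0 <= g q by exact: psi0.
pose f (p : matB R n * R) := (\int[haark]_X g (p, X)) * (w p.2)%:E.
have mf : measurable_fun setT f.
  apply: emeasurable_funM; first exact: measurable_fun_fubini_tonelli_F.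
  by apply/measurable_EFinP; exact: (measurableT_comp mw measurable_snd).
have f0 p : 0 <= f p.
  by apply: mule_ge0; [apply: integral_ge0 => X _; exact: g0|rewrite lee_fin /w].
rewrite (haar_eq_integral Hn (g := fun A => \int[lambda]_(s in D) f (A, s)) mdm); last 4 first.
- exact: measurable_integral_in.
- by move=> A; exact: integral_ge0.
- by move=> A; exact: integral_ge0.
- move=> A SA; rewrite (dm_polar Hk mpsi psi0 (SAr A SA) k1).
  apply: eq_integral => s; rewrite inE/= in_itv/= andbT => s0.
  by rewrite /f/= /w ger0_norm// radial_weight_ge0.
rewrite fubini_tonelli_in//.
rewrite -ge0_integralZl//; last 3 first.
- by apply: measurable_funTS; apply: emeasurable_funM => //; exact/measurable_EFinP.
- move=> s /=; rewrite in_itv/= andbT => s0; rewrite mule_ge0 ?average_ge0// lee_fin.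
  by rewrite mulr_ge0 ?exprn_ge0 ?sinh_ge0 ?cosh_ge0.
- by rewrite lee_fin sphere_area_ge0.
apply: eq_integral => s; rewrite inE/= in_itv/= andbT => s0.
rewrite /f/=.
pose G (p : matB R n * matB R n) := g ((p.1, s), p.2).
have mG : measurable_fun setT G.
  apply: (measurableT_comp mg); apply: measurable_fun_pair => //.
  exact: measurable_fun_pair.
rewrite ge0_integralZr//; last 3 first.
- exact: (measurable_fun_fubini_tonelli_F G mG (fun=> g0 _)).
- by move=> A _; exact: integral_ge0.
- by rewrite lee_fin /w.
rewrite (fubini_tonelli G mG (fun=> g0 _)).
rewrite (haar_eq_integral Hk (g := cst (average (cosh r * cosh s)))); last 5 first.
- exact: (measurable_fun_fubini_tonelli_G G mG (fun=> g0 _)).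
- exact: measurable_cst.
- by move=> X; apply: integral_ge0 => A _; exact: g0.
- by move=> X; exact: average_ge0.
- move=> X SX; have SXn := SO_widen SX.
  have mf' : measurable_fun setT (fun Y : matB R n =>
      psi (act ((Y : mat) *m (hrot (idx k) r *m hrot (idx j) s)) Hj)).
    by apply: (measurableT_comp (measurable_psi_orbit mpsi)); exact: measurable_mulmx.
  rewrite /= -average_hrot_hrot -(haar_right Hn SXn mf' (fun=> psi0 _)).
  apply: eq_integral => Y _; rewrite /G /g/=; congr (psi (act _ _)).
  have XE : X *m hrot (idx k) r = hrot (idx k) r *m X.
    apply: hrot_comm => //; have [_ _] := SX; apply.
    by rewrite idxE negb_and -ltnNge; apply/orP; left; have := ltn_ord k; lia.
  by rewrite -!mulmxA (mulmxA (hrot (idx k) r) X) -XE !mulmxA.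
have -> : \int[haark]_X cst (average (cosh r * cosh s)) X = average (cosh r * cosh s).
  by rewrite integral_cst// -[RHS]mule1; congr (_ * _); exact: probability_setT.
rewrite /w ger0_norm ?radial_weight_ge0// /radial_weight -mulrA.
by rewrite [in RHS]muleCA -EFinM.
Qed.

End averages.

(** * Boundedness of the Radon transform *)

Section gamma_function.
Context {R : realType}.
Local Notation lambda := (@lebesgue_measure R).
Local Notation D := (`[0%R, +oo[%classic : set R).

Lemma integral_expRN (c : R) : 0 < c ->
  (\int[lambda]_(x in D) (expR (- (c * x)))%:E = (c^-1)%:E)%E.
Proof.
move=> c0; pose F (x : R) := - c^-1 * expR (- (c * x)).
have dF (x : R) : is_derive x (1 : R) F (expR (- (c * x))).
  rewrite /F; apply: is_derive_eq; rewrite /GRing.scale/=; field.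
  by rewrite gt_eqF.
rewrite (@ge0_continuous_FTC2y _ _ F 0 0)//.
- by rewrite /F mulr0 oppr0 expR0 mulr1 EFinN oppeK add0e.
- apply: continuous_subspaceT => x; apply: continuous_comp; last exact: continuous_expR.
  by apply: cvgN; apply: cvgM; [exact: cvg_cst|exact: cvg_id].
- rewrite -[X in _ --> X](mulr0 (- c^-1)); apply: cvgM; first exact: cvg_cst.
  apply: (@cvg_comp _ _ _ (fun x => c * x) (fun x => expR (- x)) _ (pinfty_nbhs R)).
    exact: gt0_cvgMry.
  exact: cvgr_expR.
- apply: cvg_at_right_filter; apply/differentiable_continuous/derivable1_diffP.
  by have [] := dF 0.
- by move=> x _; rewrite derive1E; exact: derive_val.
Qed.

(** The integrand is unbounded at 0, so the antiderivative sqrt is used on [1 / (i + 2), 1] and the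
    bound passes to the monotone limit. *)
Lemma integral_inv_sqrt_lty :
  (\int[lambda]_(x in `]0%R, 1%R]) ((2 * Num.sqrt x)^-1)%:E < +oo)%E.
Proof.
pose F (i : nat) : set R := `[i.+2%:R^-1, 1%R]%classic.
have F0 i : 0 < i.+2%:R^-1 :> R by rewrite invr_gt0.
have F1 i : i.+2%:R^-1 < 1 :> R by rewrite invf_lt1// ltr1n.
have FU : \bigcup_i F i = `]0%R, 1%R]%classic.
  apply/seteqP; split => x /=.
    by move=> [i _]; rewrite /F/= !in_itv/= => /andP[/(lt_le_trans (F0 i)) -> ->].
  rewrite in_itv/= => /andP[x0 x1]; exists (Num.Def.archi_bound x^-1) => //.
  rewrite /F/= in_itv/= x1 andbT -[leRHS]invrK lef_pV2 ?posrE ?invr_gt0//.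
  by rewrite (le_trans (ltW (unstable.ltr_bound _)))// ler_nat; do 2 apply: leqW.
have mf i : measurable_fun (F i) (fun x : R => ((2 * Num.sqrt x)^-1)%:E).
  apply: measurable_funTS; apply/measurable_EFinP.
  apply: (measurableT_comp (@measurable_inv R)); apply: measurable_funM => //.
  exact: (continuous_measurable_fun (@sqrt_continuous R)).
have mF i : measurable (F i) by exact: measurable_itv.
have nd : nondecreasing_seq F.
  move=> i l il; apply/subsetPset => x; rewrite /F/= !in_itv/= => /andP[ix ->]; rewrite andbT.
  by rewrite (le_trans _ ix)// lef_pV2 ?posrE// ler_nat.
have f0 i x : F i x -> (0 <= ((2 * Num.sqrt x)^-1)%:E :> \bar R)%E.
  by move=> _; rewrite lee_fin invr_ge0 mulr_ge0// sqrtr_ge0.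
have cv := ge0_nondecreasing_set_cvg_integral (mu := lambda) nd mF mf f0.
rewrite -FU -(cvg_lim _ cv)//.
apply: (@le_lt_trans _ _ 1%E); last exact: ltry.
apply: lime_le; first by apply/cvg_ex; eexists; exact: cv.
apply: nearW => i.
rewrite (@continuous_FTC2 _ _ (@Num.sqrt R))//.
- by rewrite sqrtr1 -EFinB lee_fin lerBlDr lerDl sqrtr_ge0.
- apply: continuous_in_subspaceT => x; rewrite inE/= in_itv/= => /andP[ix _].
  have x0 : 0 < x := lt_le_trans (F0 i) ix.
  apply: cvgV; first by rewrite mulf_neq0// gt_eqF// sqrtr_gt0.
  by apply: cvgM; [exact: cvg_cst|exact: sqrt_continuous].
- split.
  + move=> x; rewrite in_itv/= => /andP[ix _].
    have x0 : 0 < x := lt_trans (F0 i) ix.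
    by have [] := is_derive1_sqrt x0.
  + by apply: cvg_at_right_filter; exact: sqrt_continuous.
  + by apply: cvg_at_left_filter; exact: sqrt_continuous.
- move=> x; rewrite in_itv/= => /andP[ix _].
  have x0 : 0 < x := lt_trans (F0 i) ix.
  by rewrite derive1E; have [_ ->] := is_derive1_sqrt x0.
Qed.

(** This is y <= exp y at y = x / (2 (N + 1)), raised to the power N + 1. *)
Lemma exprn_le_expR (N : nat) (x : R) : 0 <= x ->
  x ^+ N.+1 <= (2 * N.+1%:R) ^+ N.+1 * expR (x / 2).
Proof.
move=> x0.
have c0 : 0 < 2 * N.+1%:R :> R by rewrite mulr_gt0.
have -> : x / 2 = N.+1%:R * (x / (2 * N.+1%:R)).
  have : N.+1%:R != 0 :> R by rewrite pnatr_eq0.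
  by move: (N.+1%:R : R) => y y0; field.
rewrite expRM_natl -exprMn; apply: lerXn2r; rewrite ?nnegrE// ?mulr_ge0 ?expR_ge0//.
have xE : x = (2 * N.+1%:R) * (x / (2 * N.+1%:R)) by rewrite mulrCA divff ?mulr1// gt_eqF.
rewrite [leLHS]xE ler_pM2l//.
by rewrite (le_trans _ (expR_ge1Dx _))// lerDr.
Qed.

(** Finiteness matters as much as positivity, since [Rintegral] gives 0 on a divergent integral. The
    integrand is at most t^(-1/2) on ]0, 1], at most a constant times exp (-t / 2) beyond 1, and at
    least exp (-2) / 2 on [1, 2]. The threshold 1/2 is the least m / 2 with m >= 1. *)
Lemma Gamma_gt0 (s : R) : 2^-1 <= s -> 0 < Gamma s.
Proof.
move=> s2; rewrite /Gamma /Rintegral.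
pose f (t : R) := t `^ (s - 1) * expR (- t).
have f0 t : 0 <= f t by rewrite mulr_ge0 ?powR_ge0 ?expR_ge0.
have mf : measurable_fun setT f.
  apply: measurable_funM; first exact: measurable_powR.
  by apply: (measurableT_comp (@measurable_expR R)).
set I := (\int[_]_(_ in _) _)%E.
have IE : I = (\int[lambda]_(t in `]0%R, +oo[) (f t)%:E)%E by [].
have Ilty : (I < +oo)%E.
  have E : `]0, 1]%classic `|` `]1, +oo[%classic = `]0, +oo[%classic :> set R.
    apply/seteqP; split => t /=; rewrite !in_itv/= !andbT.
      by case=> [/andP[]//|]; exact: lt_trans.
    by move=> t0; rewrite t0/=; case: leP; [left|right].
  rewrite IE -E ge0_integral_setU//=.
  - apply: lte_add_pinfty.
      apply: (@le_lt_trans _ _ (\int[lambda]_(t in `]0%R, 1%R]) (2%:E * ((2 * Num.sqrt t)^-1)%:E))%E).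
        apply: ge0_le_integral => //.
        - by move=> t _; rewrite lee_fin.
        - exact/measurable_EFinP/measurable_funTS.
        - apply: measurable_funTS; apply/measurable_EFinP; apply: measurable_funM => //.
          apply: (measurableT_comp (@measurable_inv R)); apply: measurable_funM => //.
          exact: (continuous_measurable_fun (@sqrt_continuous R)).
        - move=> t /=; rewrite in_itv/= => /andP[t0 t1]; rewrite -EFinM lee_fin.
          have -> : 2 * (2 * Num.sqrt t)^-1 = t `^ (- 2^-1).
            by rewrite invfM mulrA divff// mul1r powRN powR12_sqrt// ltW.
          rewrite -[leRHS]mulr1 ler_pM ?powR_ge0 ?expR_ge0//.
            by apply: ger_powR; rewrite ?t0//; lra.
          by rewrite -expR0 ler_expR; lra.
      rewrite ge0_integralZl//.
      + by rewrite lte_mul_pinfty// integral_inv_sqrt_lty.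
      + apply: measurable_funTS; apply/measurable_EFinP.
        apply: (measurableT_comp (@measurable_inv R)); apply: measurable_funM => //.
        exact: (continuous_measurable_fun (@sqrt_continuous R)).
    pose N := Num.Def.archi_bound s.
    pose M : R := (2 * N.+1%:R) ^+ N.+1.
    have M0 : 0 <= M by rewrite exprn_ge0.
    have mexp : measurable_fun setT (fun t : R => (expR (- (2^-1 * t)))%:E).
      apply/measurable_EFinP; apply: (measurableT_comp (@measurable_expR R)).
      by apply: measurable_funN; exact: mulrl_measurable.
    apply: (@le_lt_trans _ _ (\int[lambda]_(t in D) (M%:E * (expR (- (2^-1 * t)))%:E))%E).
      apply: (@le_trans _ _ (\int[lambda]_(t in `]1%R, +oo[) (M%:E * (expR (- (2^-1 * t)))%:E))%E).
        apply: ge0_le_integral => //.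
        - by move=> t _; rewrite lee_fin.
        - exact/measurable_EFinP/measurable_funTS.
        - by apply: measurable_funTS; exact: measurable_funeM.
        - move=> t /=; rewrite in_itv/= andbT => t1; rewrite -EFinM lee_fin.
          have t0 : 0 <= t by lra.
          have h1 : t `^ (s - 1) <= t ^+ N.+1.
            rewrite -powR_mulrn//; apply: ler_powR; first exact: ltW.
            have := unstable.ltr_bound s; rewrite -/N -natr1; lra.
          have h2 := exprn_le_expR N t0.
          rewrite /f (_ : - (2^-1 * t) = t / 2 + (- t)) ?expRD ?mulrA; last by lra.
          by rewrite ler_wpM2r ?expR_ge0// (le_trans h1).
      apply: ge0_subset_integral => //.
      - by apply: measurable_funTS; exact: measurable_funeM.
      - by move=> t _; rewrite mule_ge0// lee_fin ?expR_ge0.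
      - by move=> t /=; rewrite !in_itv/= !andbT => t1; lra.
    rewrite ge0_integralZl//.
    + by rewrite integral_expRN// -EFinM ltry.
    + exact: measurable_funTS.
  - exact/measurable_EFinP/measurable_funTS.
  - by move=> t _; rewrite lee_fin.
  - apply/disj_setPS => t [] /=; rewrite !in_itv/= andbT => /andP[_ t1].
    by rewrite ltNge t1.
have Igt0 : (0 < I)%E.
  apply: (@lt_le_trans _ _ (\int[lambda]_(t in `[1%R, 2%R]) (expR (-2) / 2)%:E)%E).
    have -> : (\int[lambda]_(t in `[1%R, 2%R]) (expR (-2) / 2)%:E = (expR (-2) / 2)%:E)%E.
      apply: etrans (integral_cst lambda (measurable_itv _) _) _.
      apply: etrans _ (mule1 _); congr (_ * _)%E; apply: etrans (lebesgue_measure_itv _) _.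
      by rewrite /= lte_fin ltr1n -EFinB; congr EFin; lra.
    by rewrite lte_fin divr_gt0 ?expR_gt0.
  apply: (@le_trans _ _ (\int[lambda]_(t in `[1%R, 2%R]) (f t)%:E)%E).
    apply: ge0_le_integral => //.
    - exact/measurable_EFinP/measurable_funTS.
    - move=> t /=; rewrite in_itv/= => /andP[t1 t2]; rewrite lee_fin /f mulrC.
      apply: ler_pM => //; [|by rewrite ler_expR lerN2].
      have -> : 2^-1 = 2 `^ (-1) :> R by rewrite powR_inv1.
      apply: (@le_trans _ _ (t `^ (-1))).
        by rewrite !powR_inv1 ?lef_pV2 ?posrE//; lra.
      by apply: ler_powR => //; lra.
  apply: ge0_subset_integral => //.
  - exact/measurable_EFinP/measurable_funTS.
  - by move=> t _; rewrite lee_fin.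
  - by move=> t /=; rewrite !in_itv/= andbT => /andP[t1 _]; lra.
by rewrite fine_gt0// Igt0.
Qed.

Lemma sphere_area_gt0 m : (0 < m)%N -> 0 < sphere_area R m.
Proof.
move=> m0; rewrite /sphere_area divr_gt0//.
  by rewrite mulr_gt0// powR_gt0// pi_gt0.
apply: Gamma_gt0; rewrite -[leLHS]mul1r ler_pM2r ?invr_gt0// ler1n.
by [].
Qed.

End gamma_function.

(** * The norm inequality for nonnegative functions *)

Section radon_bound.
Variables (R : realType) (n : nat).
Variables haarn haark : probability (matB R n) R.
Hypotheses (n_ge2 : (2 <= n)%N) (Hn : is_haar n haarn).
Local Notation mat := 'M[R]_n.+1.
Local Notation lambda := (@lebesgue_measure R).
Local Notation D := (`[0%R, +oo[%classic : set R).
Local Open Scope ereal_scope.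

(** The distance equals r along the whole orbit K g(r) H^d, so the weight leaves the inner
    integral. *)
Lemma dt_radial_integral (d : 'I_n) (h : GammaH R d -> \bar R) (w : R -> R) :
  measurable_fun setT h -> (forall t, 0 <= h t) ->
  measurable_fun setT w -> (forall r, (0 <= w r)%R) ->
  \int[dt d haarn]_t (h t * (w (gdist t))%:E) =
  \int[lambda]_(r in D) ((\int[haarn]_X h (act ((X : mat) *m hrot (idx d) r) (Hsub_pt R d))) *
    (w r * radial_weight n d r)%:E).
Proof.
move=> mh h0 mw w0.
have mhw : measurable_fun setT (fun t => h t * (w (gdist t))%:E).
  apply: emeasurable_funM => //; apply/measurable_EFinP.
  exact: (measurableT_comp mw (@measurable_gdist R n d)).
have hw0 t : 0 <= h t * (w (gdist t))%:E by rewrite mule_ge0// lee_fin.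
rewrite (polar_integral n haarn mhw hw0).
apply: eq_integral => r; rewrite inE/= in_itv/= andbT => r0.
have mX : measurable_fun setT (fun X : matB R n => (X : mat) *m hrot (idx d) r : matB R n).
  exact: measurable_mulmx.
have mhX := measurableT_comp (measurableT_comp mh (@measurable_orbit R n d)) mX.
rewrite (EFinM (w r)) muleA; congr (_ * _).
rewrite (haar_eq_integral Hn (g := fun X => h (act ((X : mat) *m hrot (idx d) r) (Hsub_pt R d)) * (w r)%:E)); last 5 first.
- exact: (measurableT_comp (measurableT_comp mhw (@measurable_orbit R n d)) mX).
- by apply: emeasurable_funM.
- by [].
- by move=> X; rewrite mule_ge0// lee_fin.
- by move=> X SX; rewrite gdist_polar.
by apply: ge0_integralZr; rewrite ?lee_fin.
Qed.

Lemma powR_cosh_nat (m l : nat) (r : R) : (m <= l)%N ->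
  (cosh r `^ (- (l%:R - m%:R)) = (cosh r ^+ (l - m))^-1)%R.
Proof. by move=> ml; rewrite -natrB// powR_invn ?cosh_ge0. Qed.

Variables (k j : 'I_n).
Hypotheses (ltjk : (j < k)%N) (Hk : is_haar k haark).

(** [dm_mass] and sigma_(n-k-1) normalize the two measures on the left of the inequality,
    sigma_(n-j-1) the one on the right; pi / 2 is that of [polar_bound]. *)
Definition radon_const : R :=
  (dm_mass R k j * sphere_area R (n - k) * (pi / 2) / sphere_area R (n - j))%R.

Lemma radon_const_ge0 : (0 <= radon_const)%R.
Proof.
rewrite /radon_const; have := sphere_area_ge0 R (n - k); have := sphere_area_ge0 R (n - j).
have : (0 <= dm_mass R k j)%R.
  by rewrite /dm_mass; case: ifP => // _; exact: sphere_area_ge0.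
move: (sphere_area R _) (sphere_area R _) (dm_mass _ _ _) => S S' M M0 S0 S0'.
by rewrite divr_ge0 ?mulr_ge0 ?invr_ge0 ?pi_ge0.
Qed.

Lemma measurable_powR_cosh (p : R) : measurable_fun setT (fun r : R => (cosh r `^ p)%R).
Proof. exact: (measurableT_comp (measurable_powR _) (@measurable_cosh R)). Qed.

(** [haar_dm_average] expresses the mean over K of the transform through the mean of psi, so both
    sides are radial integrals of one function of one variable. *)
Lemma frame_integral_bound (psi : GammaH R j -> \bar R) :
  measurable_fun setT psi -> (forall t, 0 <= psi t) ->
  \int[dt k haarn]_z (frame_integral haark psi z * (cosh (gdist z) `^ (- (n%:R - j%:R)))%:E) <=
  radon_const%:E * \int[dt j haarn]_t (psi t * (cosh (gdist t) `^ (- (n%:R - k%:R)))%:E).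
Proof.
move=> mpsi psi0; have kn := ltn_ord k; have jn := ltn_ord j.
have mI := measurable_frame_integral n_ge2 ltjk Hk mpsi psi0.
have I0 (z : GammaH R k) : 0 <= frame_integral haark psi z by exact: integral_ge0.
rewrite (dt_radial_integral mI I0 (measurable_powR_cosh _) (fun=> powR_ge0 _ _)).
rewrite (dt_radial_integral mpsi psi0 (measurable_powR_cosh _) (fun=> powR_ge0 _ _)).
set Phi := average haarn psi.
have mPhi : measurable_fun setT Phi := measurable_average haarn mpsi psi0.
have Phi0 x : 0 <= Phi x := average_ge0 haarn psi0 x.
have := @polar_bound R n k j Phi; rewrite ltjk kn => /(_ isT mPhi Phi0).
set A := (X in X <= _); set B := (X in _ <= _ * X) => AB.
have Sj0 : (0 < sphere_area R (n - j))%R by rewrite sphere_area_gt0// subn_gt0.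
have Sk0 : (0 < sphere_area R (n - k))%R by rewrite sphere_area_gt0// subn_gt0.
have M0 : (0 <= dm_mass R k j)%R.
  by rewrite /dm_mass; case: ifP => // _; exact: sphere_area_ge0.
have -> : \int[lambda]_(r in D) ((\int[haarn]_X psi (act ((X : mat) *m hrot (idx j) r) (Hsub_pt R j))) *
    (cosh r `^ (- (n%:R - k%:R)) * radial_weight n j r)%:E) = (sphere_area R (n - j))%:E * B.
  rewrite -ge0_integralZl//; last 3 first.
  - apply: measurable_funTS; apply: emeasurable_funM.
      exact: (measurableT_comp mPhi (@measurable_cosh R)).
    apply/measurable_EFinP; apply: measurable_funM.
      by apply: measurable_funM; apply: measurable_funX; [exact: measurable_sinh|exact: measurable_cosh].
    by apply: (measurableT_comp (@measurable_inv R)); apply: measurable_funX; exact: measurable_cosh.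
  - move=> r /=; rewrite in_itv/= andbT => r0; rewrite mule_ge0// lee_fin.
    by rewrite mulr_ge0 ?mulr_ge0 ?invr_ge0 ?exprn_ge0 ?sinh_ge0 ?cosh_ge0.
  - by rewrite lee_fin ltW.
  apply: eq_integral => r; rewrite inE/= in_itv/= andbT => r0.
  rewrite muleCA -EFinM /Phi /average (coshK r0) powR_cosh_nat ?(ltnW kn)//.
  congr (_ * _%:E); rewrite /radial_weight; move: (sphere_area R (n - j)) (cosh r) (sinh r) => S c s.
  by rewrite mulrC !mulrA.
have -> : \int[lambda]_(r in D) ((\int[haarn]_X frame_integral haark psi (act ((X : mat) *m hrot (idx k) r) (Hsub_pt R k))) *
    (cosh r `^ (- (n%:R - j%:R)) * radial_weight n k r)%:E) =
    (dm_mass R k j * sphere_area R (n - k))%:E * A.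
  rewrite -ge0_integralZl//; last 3 first.
  - apply: measurable_funTS; apply: emeasurable_funM.
      pose f (p : R * R) := (Phi (cosh p.1 * cosh p.2)%R *
        (`|sinh p.2| ^+ (k - j - 1) * cosh p.2 ^+ j)%:E)%E.
      have mc2 := measurableT_comp (@measurable_cosh R) (@measurable_snd _ _ R R).
      have mc1 := measurableT_comp (@measurable_cosh R) (@measurable_fst _ _ R R).
      have ms2 := measurableT_comp (@measurable_sinh R) (@measurable_snd _ _ R R).
      have mf : measurable_fun setT f.
        apply: emeasurable_funM.
          by apply: (measurableT_comp mPhi); exact: measurable_funM.
        apply/measurable_EFinP; apply: measurable_funM; apply: measurable_funX => //.
        exact: (measurableT_comp (@normr_measurable _ setT) ms2).
      have f0 p : (0 <= f p)%E.
        rewrite mule_ge0// lee_fin.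
        by apply: mulr_ge0; apply: exprn_ge0 => //; exact: cosh_ge0.
      rewrite (_ : (fun x => _) = (fun x => \int[lambda]_(y in D) f (x, y))%E).
        exact: measurable_integral_in.
      apply/funext => x; apply: eq_integral => s; rewrite inE/= in_itv/= andbT => s0.
      by rewrite /f/= ger0_norm// sinh_ge0.
    apply/measurable_EFinP; apply: measurable_funM.
      by apply: measurable_funM; apply: measurable_funX; [exact: measurable_sinh|exact: measurable_cosh].
    by apply: (measurableT_comp (@measurable_inv R)); apply: measurable_funX; exact: measurable_cosh.
  - move=> r /=; rewrite in_itv/= andbT => r0; rewrite mule_ge0//.
      by apply: integral_ge0 => s /=; rewrite in_itv/= andbT => s0; rewrite mule_ge0// lee_fin mulr_ge0 ?exprn_ge0 ?sinh_ge0 ?cosh_ge0.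
    by rewrite lee_fin mulr_ge0 ?mulr_ge0 ?invr_ge0 ?exprn_ge0 ?sinh_ge0 ?cosh_ge0.
  - by rewrite lee_fin mulr_ge0// ltW.
  apply: eq_integral => r; rewrite inE/= in_itv/= andbT => r0.
  have mX : measurable_fun setT (fun X : matB R n => (X : mat) *m hrot (idx k) r : matB R n).
    exact: measurable_mulmx.
  rewrite (haar_eq_integral Hn (g := fun X => \int[dm k j haark]_t psi (act ((X : mat) *m hrot (idx k) r) t))); last 5 first.
  - exact: (measurableT_comp (measurableT_comp mI (@measurable_orbit R n k)) mX).
  - exact: (measurableT_comp (measurable_dm_integral_act Hk mpsi psi0) mX).
  - by [].
  - by move=> X; exact: integral_ge0.
  - move=> X SX; apply: (frame_integral_aligned n_ge2 ltjk Hk mpsi psi0); last exact: aligned_hrot.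
    by apply: SO1_mul; [exact: SO_SO1 SX|exact/SO1_hrot/idx_neq_last].
  rewrite (haar_dm_average n_ge2 ltjk Hn Hk mpsi psi0) powR_cosh_nat ?(ltnW jn)//.
  rewrite -/Phi [in RHS]EFinM -!muleA; congr (_ * _); rewrite [RHS]muleCA; congr (_ * _).
  rewrite -EFinM; congr EFin; rewrite /radial_weight.
  move: (sphere_area R (n - k)) (cosh r) (sinh r) => S c s.
  by rewrite mulrC !mulrA.
rewrite /radon_const muleA -EFinM mulfVK ?gt_eqF//.
rewrite (EFinM (_ * _)%R (pi / 2)) -[leRHS]muleA; apply: lee_wpmul2l => //.
by rewrite lee_fin mulr_ge0// ltW.
Qed.

End radon_bound.

(** * Complex-valued integrals *)

Section complex_valued.
Variable R : realType.
Implicit Types z : R[i].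

Lemma cabsE z : cabs z = Num.sqrt (complex.Re z ^+ 2 + complex.Im z ^+ 2).
Proof. by case: z. Qed.

Lemma cabs_ge0 z : 0 <= cabs z.
Proof. by rewrite cabsE sqrtr_ge0. Qed.

Lemma norm_Re_le_cabs z : `|complex.Re z| <= cabs z.
Proof. by rewrite cabsE -sqrtr_sqr ler_wsqrtr// lerDl sqr_ge0. Qed.

Lemma norm_Im_le_cabs z : `|complex.Im z| <= cabs z.
Proof. by rewrite cabsE -sqrtr_sqr ler_wsqrtr// lerDr sqr_ge0. Qed.

Lemma cabs_le_normD z : cabs z <= `|complex.Re z| + `|complex.Im z|.
Proof.
rewrite cabsE -[leRHS]ger0_norm ?addr_ge0// -sqrtr_sqr ler_wsqrtr//.
rewrite sqrrD !real_normK ?num_real// lerD2r lerDl mulrn_wge0// mulr_ge0//.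
Qed.

Lemma cabs_real (x : R) : 0 <= x -> cabs (Complex x 0) = x.
Proof. by move=> x0; rewrite cabsE/= expr0n/= addr0 sqrtr_sqr ger0_norm. Qed.

Section integral.
Context d (T : measurableType d) (mu : {measure set T -> \bar R}).
Implicit Types f g : T -> R[i].

Lemma measurable_cabs f : cmeasurable f -> measurable_fun setT (fun t => cabs (f t)).
Proof.
move=> [mre mim]; under eq_fun do rewrite cabsE.
apply: (measurableT_comp (continuous_measurable_fun (@sqrt_continuous R))).
by apply: measurable_funD; exact: measurable_funX.
Qed.

Lemma cintegrable_Re f : cintegrable mu f -> mu.-integrable setT (EFin \o (fun t => complex.Re (f t))).
Proof.
move=> [mf If]; have [mre _] := mf; apply/integrableP; split; first exact/measurable_EFinP.
apply: le_lt_trans If; apply: ge0_le_integral => //.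
- exact/measurable_EFinP/measurableT_comp.
- exact/measurable_EFinP/measurable_cabs.
- by move=> t _; rewrite /= lee_fin norm_Re_le_cabs.
Qed.

Lemma cintegrable_Im f : cintegrable mu f -> mu.-integrable setT (EFin \o (fun t => complex.Im (f t))).
Proof.
move=> [mf If]; have [_ mim] := mf; apply/integrableP; split; first exact/measurable_EFinP.
apply: le_lt_trans If; apply: ge0_le_integral => //.
- exact/measurable_EFinP/measurableT_comp.
- exact/measurable_EFinP/measurable_cabs.
- by move=> t _; rewrite /= lee_fin norm_Im_le_cabs.
Qed.

Lemma abse_fine_le (x : \bar R) : (`|fine x|%:E <= `|x|)%E.
Proof. by case: x => [r| |]//=; rewrite normr0 leey. Qed.

(** Integrability of f is not assumed: [fine] sends infinite values to 0, which only lowers the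
    left-hand side. Bounds on R_H f thus hold at every z, even where it fails to exist. *)
Lemma norm_Rintegral_le (f : T -> R) (g : T -> \bar R) : measurable_fun setT f ->
  measurable_fun setT g -> (forall t, (`|f t|%:E <= g t)%E) ->
  (`|Rintegral mu setT f|%:E <= \int[mu]_t g t)%E.
Proof.
move=> mf mg fg; apply: (le_trans (abse_fine_le _)).
apply: (le_trans (le_abse_integral _ _ _)) => //; first exact/measurable_EFinP.
apply: ge0_le_integral => //.
- by apply: (measurableT_comp (@abse_measurable R setT)); exact/measurable_EFinP.
- by move=> t _; exact: fg.
Qed.

(** Treating real and imaginary parts separately costs a factor 2. *)
Lemma cabs_cintegral_le f : cmeasurable f ->
  ((cabs (cintegral mu f))%:E <= 2%:E * \int[mu]_t (cabs (f t))%:E)%E.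
Proof.
move=> mf; have [mre mim] := mf.
have mc : measurable_fun setT (fun t => (cabs (f t))%:E) by exact/measurable_EFinP/measurable_cabs.
rewrite mule_natl mule2n.
apply: (@le_trans _ _ (`|complex.Re (cintegral mu f)|%:E + `|complex.Im (cintegral mu f)|%:E)%E).
  by rewrite -EFinD lee_fin cabs_le_normD.
apply: leeD; apply: norm_Rintegral_le => // t; rewrite lee_fin.
  exact: norm_Re_le_cabs.
exact: norm_Im_le_cabs.
Qed.

Lemma cintegral_linear (c : R[i]) f g : cintegrable mu f -> cintegrable mu g ->
  cintegral mu (fun t => c * f t + g t) = c * cintegral mu f + cintegral mu g.
Proof.
move=> If Ig.
have Zi (a : R) (h : T -> R) : mu.-integrable setT (EFin \o h) ->
    mu.-integrable setT (EFin \o (fun t => a * h t)).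
  move=> Ih; rewrite (_ : EFin \o _ = (fun t => a%:E * (EFin \o h) t)%E) //.
  exact: integrableZl.
have fr := cintegrable_Re If; have fi := cintegrable_Im If.
have gr := cintegrable_Re Ig; have gi := cintegrable_Im Ig.
have Di (h1 h2 : T -> R) : mu.-integrable setT (EFin \o h1) -> mu.-integrable setT (EFin \o h2) ->
    mu.-integrable setT (EFin \o (fun t => h1 t + h2 t)).
  move=> I1 I2; rewrite (_ : EFin \o _ = (EFin \o h1) \+ (EFin \o h2))%E //.
  exact: integrableD.
have comb (a b : R) (h1 h2 h3 : T -> R) : mu.-integrable setT (EFin \o h1) ->
    mu.-integrable setT (EFin \o h2) -> mu.-integrable setT (EFin \o h3) ->
    Rintegral mu setT (fun t => a * h1 t + b * h2 t + h3 t) =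
    a * Rintegral mu setT h1 + b * Rintegral mu setT h2 + Rintegral mu setT h3.
  move=> I1 I2 I3; rewrite RintegralD//; last by apply: Di; exact: Zi.
  rewrite RintegralD//; [|exact: Zi|exact: Zi].
  by rewrite !RintegralZl.
case: c => a b; rewrite /cintegral.
have -> : (fun t => complex.Re (Complex a b * f t + g t)) =
    (fun t => a * complex.Re (f t) + (- b) * complex.Im (f t) + complex.Re (g t)).
  by apply/funext => t; case: (f t) (g t) => u v [u' v']/=; rewrite mulNr.
have -> : (fun t => complex.Im (Complex a b * f t + g t)) =
    (fun t => a * complex.Im (f t) + b * complex.Re (f t) + complex.Im (g t)).
  by apply/funext => t; case: (f t) (g t) => u v [u' v'].
by rewrite !comb// mulNr.
Qed.

End integral.

End complex_valued.

(** * Existence, linearity and boundedness for complex functions *)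

Section radon_transform.
Variables (R : realType) (n : nat) (k j : 'I_n).
Variables haarn haark : probability (matB R n) R.
Hypotheses (n_ge2 : (2 <= n)%N) (ltjk : (j < k)%N).
Hypotheses (Hn : is_haar n haarn) (Hk : is_haar k haark).
Local Open Scope ereal_scope.
Implicit Types f g : GammaH R j -> R[i].

Let cabsf f := fun t => (cabs (f t))%:E.

Let mcabsf f : cmeasurable f -> measurable_fun setT (cabsf f).
Proof. by move=> mf; exact/measurable_EFinP/measurable_cabs. Qed.

Let cabsf0 f t : 0 <= cabsf f t.
Proof. by rewrite lee_fin cabs_ge0. Qed.

Lemma cmeasurable_pullback f (z : GammaH R k) : cmeasurable f -> cmeasurable (pullback f z).
Proof.
by move=> [mre mim]; split; [apply: (measurableT_comp mre)|apply: (measurableT_comp mim)];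
  exact: measurable_act.
Qed.

(** Positive and negative parts are each a [frame_integral], and the signed integral is [fine] of
    their difference. *)
Lemma measurable_Rintegral_frame (h : GammaH R j -> R) : measurable_fun setT h ->
  measurable_fun setT (fun z : GammaH R k => Rintegral (dm k j haark) setT
    (fun t => h (act (frame z *m hrot (idx k) (gdist z)) t))).
Proof.
move=> mh; have mE : measurable_fun setT (EFin \o h) by exact/measurable_EFinP.
have -> : (fun z : GammaH R k => Rintegral (dm k j haark) setT
    (fun t => h (act (frame z *m hrot (idx k) (gdist z)) t))) =
  (fun z => fine (frame_integral haark (EFin \o h)^\+ z - frame_integral haark (EFin \o h)^\- z)).
  by apply/funext => z; rewrite /Rintegral integralE; congr (fine (_ - _)); apply: eq_integral => t _; rewrite ?funeposE ?funenegE.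
apply: (measurableT_comp (@fine_measurable R setT measurableT)).
apply: emeasurable_funB.
- apply: (measurable_frame_integral n_ge2 ltjk Hk); first exact: measurable_funepos.
  by move=> t; exact: funepos_ge0.
- apply: (measurable_frame_integral n_ge2 ltjk Hk); first exact: measurable_funeneg.
  by move=> t; exact: funeneg_ge0.
Qed.

Lemma cmeasurable_RH f : cmeasurable f -> cmeasurable (RH (k := k) haark f).
Proof. by move=> [mre mim]; split; [exact: (measurable_Rintegral_frame mre)|exact: (measurable_Rintegral_frame mim)]. Qed.

Lemma wnorm_RH_le f : cmeasurable f ->
  wnorm (dt k haarn) (n%:R - j%:R) (RH haark f) <=
  (2 * radon_const R k j)%:E * wnorm (dt j haarn) (n%:R - k%:R) f.
Proof.
move=> mf; have mI := measurable_frame_integral n_ge2 ltjk Hk (mcabsf mf) (cabsf0 f).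
have mw : measurable_fun setT (fun z : GammaH R k => (cosh (gdist z) `^ (- (n%:R - j%:R)))%:E).
  apply/measurable_EFinP.
  exact: (measurableT_comp (measurable_powR_cosh _) (@measurable_gdist R n k)).
have I0 (z : GammaH R k) : 0 <= frame_integral haark (cabsf f) z by exact: integral_ge0.
apply: (@le_trans _ _ (\int[dt k haarn]_z (2%:E * (frame_integral haark (cabsf f) z *
    (cosh (gdist z) `^ (- (n%:R - j%:R)))%:E)))).
  apply: ge0_le_integral => //.
  - by move=> z _; rewrite lee_fin mulr_ge0 ?cabs_ge0 ?powR_ge0.
  - under eq_fun do rewrite EFinM; apply: emeasurable_funM => //.
    exact/measurable_EFinP/measurable_cabs/cmeasurable_RH.
  - by apply: measurable_funeM; exact: emeasurable_funM.
  - move=> z _; rewrite EFinM muleA; apply: lee_wpmul2r; first by rewrite lee_fin powR_ge0.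
    exact/cabs_cintegral_le/cmeasurable_pullback.
rewrite ge0_integralZl//; last 2 first.
- exact: emeasurable_funM.
- by move=> z _; rewrite mule_ge0// lee_fin powR_ge0.
rewrite (EFinM 2) -muleA; apply: lee_wpmul2l => //.
apply: le_trans (frame_integral_bound n_ge2 Hn ltjk Hk (mcabsf mf) (cabsf0 f)) _.
apply: lee_wpmul2l; first by rewrite lee_fin; exact: radon_const_ge0.
by under eq_integral do rewrite -EFinM.
Qed.

(** R_H |f| times a positive weight is integrable, hence finite almost everywhere, and the weight
    can be divided out. *)
Lemma ae_RH_exists f : L1 (dt j haarn) (n%:R - k%:R) f ->
  {ae dt k haarn, forall z, RH_exists haark f z}.
Proof.
move=> [mf Wf]; have mI := measurable_frame_integral n_ge2 ltjk Hk (mcabsf mf) (cabsf0 f).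
have mw : measurable_fun setT (fun z : GammaH R k => (cosh (gdist z) `^ (- (n%:R - j%:R)))%:E).
  apply/measurable_EFinP.
  exact: (measurableT_comp (measurable_powR_cosh _) (@measurable_gdist R n k)).
have I0 (z : GammaH R k) : 0 <= frame_integral haark (cabsf f) z by exact: integral_ge0.
have Iint : (dt k haarn).-integrable setT
    (fun z => frame_integral haark (cabsf f) z * (cosh (gdist z) `^ (- (n%:R - j%:R)))%:E).
  apply/integrableP; split; first exact: emeasurable_funM.
  under eq_integral => z _ do rewrite gee0_abs ?mule_ge0 ?lee_fin ?powR_ge0//.
  apply: le_lt_trans (frame_integral_bound n_ge2 Hn ltjk Hk (mcabsf mf) (cabsf0 f)) _.
  apply: lte_mul_pinfty; [by rewrite lee_fin; exact: radon_const_ge0|by []|].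
  by under eq_integral do rewrite -EFinM.
have := integrable_ae measurableT Iint; apply: filterS => z /(_ I) fz.
split; first exact: cmeasurable_pullback.
rewrite ltey; have w0 : (0 < cosh (gdist z) `^ (- (n%:R - j%:R)))%R.
  by rewrite powR_gt0 ?cosh_gt0.
have nI : frame_integral haark (cabsf f) z != +oo.
  by apply/eqP => E; move: fz; rewrite E gt0_mulye// lte_fin.
exact: nI.
Qed.

(** Almost everywhere only: where an integral diverges, [RH] is built from default values of [fine],
    which are not additive. *)
Lemma RH_linear (c : R[i]) f g : 
  L1 (dt j haarn) (n%:R - k%:R) f -> L1 (dt j haarn) (n%:R - k%:R) g ->
  {ae dt k haarn, forall z,
    RH haark (fun t => c * f t + g t)%R z = (c * RH haark f z + RH haark g z)%R}.
Proof.
move=> /ae_RH_exists ef /ae_RH_exists eg; near=> z.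
apply: (@cintegral_linear R _ _ (dm k j haark) c (pullback f z) (pullback g z)).
- by near: z.
- by near: z.
Unshelve. all: by end_near. Qed.

(** Since cosh >= 1, the weight decreases as its exponent grows. The spaces increase with the
    exponent, so every exponent below n - k reduces to n - k. *)
Lemma L1_weight_le (d : 'I_n) (a b : R) (f : GammaH R d -> R[i]) : (a <= b)%R ->
  L1 (dt d haarn) a f -> L1 (dt d haarn) b f.
Proof.
move=> ab [mf Wf]; split => //; apply: le_lt_trans Wf.
have mw c : measurable_fun setT (fun t : GammaH R d => (cabs (f t) * cosh (gdist t) `^ (- c))%:E).
  apply/measurable_EFinP/measurable_funM; first exact: measurable_cabs.
  exact: (measurableT_comp (measurable_powR_cosh _) (@measurable_gdist R n d)).
apply: ge0_le_integral => //.
- by move=> t _; rewrite lee_fin mulr_ge0 ?cabs_ge0 ?powR_ge0.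
- move=> t _; rewrite lee_fin ler_wpM2l ?cabs_ge0//; apply: ler_powR; last by rewrite lerN2.
  exact: cosh_ge1.
Qed.

End radon_transform.

(** * Sharpness *)

Section counterexample.
Variables (R : realType) (n : nat) (k j : 'I_n).
Variables haarn haark : probability (matB R n) R.
Hypotheses (n_ge2 : (2 <= n)%N) (ltjk : (j < k)%N).
Hypotheses (Hn : is_haar n haarn) (Hk : is_haar k haark).
Local Notation mat := 'M[R]_n.+1.
Local Notation lambda := (@lebesgue_measure R).
Local Notation D := (`[0%R, +oo[%classic : set R).
Local Notation el := (e R (@ord_max n)).
Local Open Scope ereal_scope.

(** Serves twice: for the divergence over z, and for the infinite measure of the set of all such
    z. *)
Lemma integral_ge_cst_infty (f : R -> R) (c : R) : measurable_fun D f ->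
  (forall s, (0 <= s)%R -> (0 <= f s)%R) -> (0 < c)%R -> (forall s, (1 <= s)%R -> (c <= f s)%R) ->
  \int[lambda]_(s in D) (f s)%:E = +oo.
Proof.
move=> mf f0 c0 cf; apply/eqP; rewrite -leye_eq.
have mf' : measurable_fun D (fun s => (f s)%:E) by exact/measurable_EFinP.
have sub : `[1%R, +oo[%classic `<=` D.
  by move=> s /=; rewrite !in_itv/= !andbT; apply: le_trans.
have <- : \int[lambda]_(s in `[1%R, +oo[) (cst c%:E s) = +oo.
  rewrite integral_cst//; apply: etrans (congr1 _ (lebesgue_measure_itv _)) _.
  by rewrite /= ltry gt0_muley ?lte_fin.
apply: (@le_trans _ _ (\int[lambda]_(s in `[1%R, +oo[) (f s)%:E)).
  apply: ge0_le_integral => //.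
  - by move=> s _; rewrite lee_fin ltW.
  - exact: (measurable_funS _ sub).
  - by move=> s /=; rewrite in_itv/= andbT => s1; rewrite lee_fin cf.
apply: ge0_subset_integral => //.
by move=> s /=; rewrite in_itv/= andbT => s0; rewrite lee_fin f0.
Qed.

Lemma tanh_exprn_le_sinh (m l : nat) (s : R) : (m <= l)%N -> (1 <= s)%R ->
  (tanh 1 ^+ m <= sinh s ^+ m * cosh s ^+ (l - m))%R.
Proof.
move=> ml s1; have s0 : (0 <= s)%R by rewrite (le_trans _ s1).
have t1 : (tanh 1 <= sinh s)%R.
  apply: (@le_trans _ _ (tanh s)).
    by move: s1; rewrite le_eqVlt => /predU1P[<-//|/ltr_tanh/ltW].
  by rewrite /tanh ler_pdivrMr ?cosh_gt0// ler_peMr ?sinh_ge0// cosh_ge1.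
rewrite -[leLHS]mulr1; apply: ler_pM.
- by rewrite exprn_ge0// tanh_ge0.
- by [].
- by apply: lerXn2r; rewrite ?nnegrE ?tanh_ge0 ?sinh_ge0.
- by rewrite exprn_ege1 ?cosh_ge1.
Qed.

Lemma gdist_SO (d : 'I_n) (A : mat) (t : GammaH R d) : SO R n n A -> gdist (act A t) = gdist t.
Proof.
move=> SA; have S1 := SO_SO1 SA; have [LA _ _] := S1.
have AE x : hdist el (A *m x) = hdist el x.
  by rewrite /hdist -[X in lform X _](SO_fix_el SA) LA.
rewrite /gdist val_act//; congr inf; apply/seteqP; split => y /=.
  by move=> [_ [x tx <-] <-]; exists x => //; rewrite AE.
by move=> [x tx <-]; exists (A *m x); [exists x|rewrite AE].
Qed.

(** One function, independent of lambda, serves for every lambda > n - k. *)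
Definition slow : GammaH R j -> R := fun t => ((cosh (gdist t) ^+ (k - 1))^-1)%R.

Lemma slow_ge0 t : (0 <= slow t)%R.
Proof. by rewrite invr_ge0 exprn_ge0 ?cosh_ge0. Qed.

Lemma measurable_slow : measurable_fun setT slow.
Proof.
apply: (measurableT_comp (@measurable_inv R)); apply: measurable_funX.
exact: (measurableT_comp (@measurable_cosh R) (@measurable_gdist R n j)).
Qed.

Lemma average_slow x : (1 <= x)%R ->
  average haarn (EFin \o slow) x = ((x ^+ (k - 1))^-1)%:E.
Proof.
move=> x1; have mS : measurable_fun setT (EFin \o slow) by apply/measurable_EFinP; exact: measurable_slow.
rewrite /average (haar_eq_integral Hn (g := cst ((x ^+ (k - 1))^-1)%:E)); last 5 first.
- apply: (measurableT_comp (measurable_psi_orbit mS)); exact: measurable_mulmx.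
- exact: measurable_cst.
- by move=> X; rewrite lee_fin slow_ge0.
- by move=> X; rewrite lee_fin invr_ge0 exprn_ge0// (le_trans _ x1).
- by move=> X SX; rewrite /= /slow gdist_polar ?arcoshK ?arcosh_ge0.
rewrite integral_cst// -[RHS]mule1; congr (_ * _); exact: probability_setT.
Qed.

(** [slow] is invariant under K, so its integral over z equals the mean over rotations given by
    [haar_dm_average]. The exponent 1 - k makes the powers of cosh s cancel down to (tanh s)^(k - j
    - 1), bounded below for s >= 1. *)
Lemma frame_integral_slow (r : R) (A : mat) : (0 <= r)%R -> SO R n n A ->
  frame_integral haark (EFin \o slow) (act (A *m hrot (idx k) r) (Hsub_pt R k)) = +oo.
Proof.
move=> r0 SA; have kn := ltn_ord k.
have mS : measurable_fun setT (EFin \o slow) by apply/measurable_EFinP; exact: measurable_slow.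
have S0 t : 0 <= (EFin \o slow) t by rewrite lee_fin slow_ge0.
have Sk : SO1 R n (hrot (idx k) r) := SO1_hrot r (idx_neq_last k).
have inv X : SO R n n X -> \int[dm k j haark]_t (EFin \o slow) (act (X *m hrot (idx k) r) t) =
    \int[dm k j haark]_t (EFin \o slow) (act (hrot (idx k) r) t).
  move=> SX; apply: eq_integral => t _; congr EFin; rewrite /slow.
  by rewrite -(act_mul _ (SO_SO1 SX) Sk) (gdist_SO _ SX).
rewrite (frame_integral_aligned n_ge2 ltjk Hk mS S0 (SO1_mul (SO_SO1 SA) Sk) (aligned_hrot _ _ SA))//.
rewrite inv//.
have mX : measurable_fun setT (fun X : matB R n => (X : mat) *m hrot (idx k) r : matB R n).
  exact: measurable_mulmx.
have := haar_dm_average n_ge2 ltjk Hn Hk mS S0 r.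
rewrite (haar_eq_integral Hn (g := cst (\int[dm k j haark]_t (EFin \o slow) (act (hrot (idx k) r) t)))); last 5 first.
- exact: (measurableT_comp (measurable_dm_integral_act Hk mS S0) mX).
- exact: measurable_cst.
- by move=> X; exact: integral_ge0.
- by move=> X; exact: integral_ge0.
- by move=> X SX; rewrite /= -(inv X SX).
have cstE c : \int[haarn]_X cst c X = c.
  by rewrite integral_cst// -[RHS]mule1; congr (_ * _); exact: probability_setT.
rewrite cstE => ->.
have cr := cosh_ge1 r.
have -> : \int[lambda]_(s in D) (average haarn (EFin \o slow) (cosh r * cosh s)%R *
    (sinh s ^+ (k - j - 1) * cosh s ^+ j)%:E) = \int[lambda]_(s in D)
    ((cosh r ^+ (k - 1))^-1 * ((cosh s ^+ (k - 1))^-1 * (sinh s ^+ (k - j - 1) * cosh s ^+ j)))%:E.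
  apply: eq_integral => s _; rewrite average_slow; last first.
    by rewrite -[leLHS]mulr1 ler_pM// cosh_ge1.
  rewrite -EFinM; congr EFin; move: (cosh r) (cosh s) (sinh s) => c c' s'.
  by rewrite exprMn invfM mulrA.
rewrite (@integral_ge_cst_infty _ ((cosh r ^+ (k - 1))^-1 * tanh 1 ^+ (k - j - 1))).
- rewrite gt0_muley// lte_fin /dm_mass; case: ifP => // _.
  by rewrite sphere_area_gt0// subn_gt0.
- apply: measurable_funTS; apply: measurable_funM; first exact: measurable_cst.
  apply: measurable_funM.
    by apply: (measurableT_comp (@measurable_inv R)); apply: measurable_funX; exact: measurable_cosh.
  by apply: measurable_funM; apply: measurable_funX; [exact: measurable_sinh|exact: measurable_cosh].
- move=> s s0.
  by rewrite !mulr_ge0 ?invr_ge0 ?exprn_ge0 ?sinh_ge0 ?cosh_ge0.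
- by rewrite mulr_gt0 ?invr_gt0 ?exprn_gt0 ?tanh_gt0 ?cosh_gt0.
- move=> s s1; have s0 : (0 <= s)%R by rewrite (le_trans _ s1).
  rewrite ler_pM2l ?invr_gt0 ?exprn_gt0 ?cosh_gt0//.
  have -> : (k - 1 = (k - j - 1) + j)%N by lia.
  have t1 : (tanh 1 <= tanh s)%R.
    by move: s1; rewrite le_eqVlt => /predU1P[<-//|/ltr_tanh/ltW].
  apply: (@le_trans _ _ (tanh s ^+ (k - j - 1))%R).
    by apply: lerXn2r; rewrite ?nnegrE ?tanh_ge0.
  rewrite /tanh; have := cosh_neq0 s; move: (cosh s) (sinh s) => c q c0.
  rewrite exprMn exprVn exprD.
  have : (c ^+ j != 0)%R by rewrite expf_neq0.
  have : (c ^+ (k - j - 1) != 0)%R by rewrite expf_neq0.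
  move: (c ^+ j)%R (c ^+ (k - j - 1))%R (q ^+ (k - j - 1))%R => x y u y0 x0.
  by rewrite le_eqVlt; apply/orP; left; apply/eqP; field; rewrite y0 x0.
Qed.

(** Divergence holds at every radius and every rotation, so the preimage of an exceptional set under
    the polar map contains all of [0, +oo[ x SO(n), which has infinite measure. *)
Lemma slow_not_exists : ~ {ae dt k haarn, forall z, RH_exists haark (fun t => Complex (slow t) 0%R) z}.
Proof.
have kn := ltn_ord k.
move=> [N [mN N0 subN]].
have DN : (D `*` SO R n n : set (R * matB R n)) `<=` @polar_map R n k @^-1` N.
  move=> [r A] [/=]; rewrite in_itv/= andbT => r0 SA; apply: subN => -[_].
  rewrite /= (_ : \int[_]_t _ = frame_integral haark (EFin \o slow) (act (A *m hrot (idx k) r) (Hsub_pt R k))).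
    by rewrite frame_integral_slow// ltxx.
  by apply: eq_integral => t _; congr EFin; exact: (cabs_real (slow_ge0 _)).
have mp := @measurable_polar_map R n k measurableT N mN.
rewrite setTI in mp.
have mD : measurable (D `*` SO R n n : set (R * matB R n)).
  by apply: measurableX; [exact: measurable_itv|exact: measurable_SO].
have : (@radial R n k \x haarn) (D `*` SO R n n) <= 0.
  by rewrite -N0; apply: le_measure; rewrite ?inE.
rewrite product_measure1E//; last exact: measurable_SO.
rewrite (_ : _ * _ = radial n k D); last first.
  by rewrite -[RHS]mule1; congr (_ * _); have [] := Hn.
rewrite /radial setIid.
rewrite (@integral_ge_cst_infty _ (sphere_area R (n - k) * tanh 1 ^+ (n - k - 1)))//.
- by apply: measurable_funTS; exact: measurable_radial_weight.
- by move=> s; exact: radial_weight_ge0.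
- by rewrite mulr_gt0 ?exprn_gt0 ?tanh_gt0// sphere_area_gt0// subn_gt0.
- move=> s s1; rewrite /radial_weight -mulrA; apply: ler_wpM2l; first exact: sphere_area_ge0.
  by have := @tanh_exprn_le_sinh (n - k - 1) ((n - k - 1) + k) s (leq_addr _ _) s1; rewrite addKn.
Qed.

(** Bounding sinh by cosh, the exponents add up to (n - j - 1) + j - (k - 1) - lambda = -d with d =
    lambda - (n - k) > 0. Then cosh r >= exp r / 2 gives the integrable bound 2^d exp (-d r). *)
Lemma slow_L1 (lam : R) : (n%:R - k%:R < lam)%R ->
  L1 (dt j haarn) lam (fun t => Complex (slow t) 0%R).
Proof.
move=> lamE; have kn := ltn_ord k; have jn := ltn_ord j; split.
  by split; [exact: measurable_slow|exact: measurable_cst].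
pose w (r : R) : R := ((cosh r ^+ (k - 1))^-1 * cosh r `^ (- lam))%R.
have w0 r : (0 <= w r)%R by rewrite mulr_ge0 ?powR_ge0 ?invr_ge0 ?exprn_ge0 ?cosh_ge0.
have mw : measurable_fun setT w.
  apply: measurable_funM; last exact: measurable_powR_cosh.
  by apply: (measurableT_comp (@measurable_inv R)); apply: measurable_funX; exact: measurable_cosh.
rewrite /wnorm (_ : \int[_]_t _ = \int[dt j haarn]_t (cst 1 t * (w (gdist t))%:E)); last first.
  by apply: eq_integral => t _; rewrite cabs_real ?slow_ge0// mul1e.
rewrite (dt_radial_integral Hn _ _ mw w0)//.
pose d := (lam - (n%:R - k%:R))%R; have d0 : (0 < d)%R by rewrite subr_gt0.
pose S := sphere_area R (n - j).
have S0 : (0 <= S)%R by exact: sphere_area_ge0.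
have mE : measurable_fun setT (fun r : R => (expR (- (d * r)))%:E).
  apply/measurable_EFinP; apply: (measurableT_comp (@measurable_expR R)).
  by apply: measurable_funN; exact: mulrl_measurable.
apply: (@le_lt_trans _ _ (\int[lambda]_(r in D) ((S * 2 `^ d)%:E * (expR (- (d * r)))%:E))); last first.
  rewrite ge0_integralZl//; last 2 first.
  - exact: measurable_funTS.
  - by rewrite lee_fin mulr_ge0 ?powR_ge0.
  by rewrite integral_expRN// -EFinM ltry.
rewrite (_ : \int[_]_(r in _) _ = \int[lambda]_(r in D) (w r * radial_weight n j r)%:E); last first.
  apply: eq_integral => r _; rewrite integral_cst// mul1e -[RHS]mul1e; congr (_ * _).
  exact: probability_setT.
apply: ge0_le_integral => //.
- move=> r /=; rewrite in_itv/= andbT => r0; rewrite lee_fin mulr_ge0// radial_weight_ge0//.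
- apply: measurable_funTS; apply/measurable_EFinP/measurable_funM => //.
  exact: measurable_radial_weight.
- by apply: measurable_funTS; exact: measurable_funeM.
move=> r /=; rewrite in_itv/= andbT => r0; rewrite -EFinM lee_fin.
have c0 := cosh_gt0 r; have c0' := ltW c0.
apply: (@le_trans _ _ (S * cosh r `^ (- d))%R).
  have -> : (w r * radial_weight n j r = S * (sinh r ^+ (n - j - 1) *
      (cosh r ^+ j * ((cosh r ^+ (k - 1))^-1 * cosh r `^ (- lam)))))%R.
    by rewrite /w /radial_weight -/S; rewrite mulrC !mulrA.
  rewrite ler_wpM2l//.
  apply: (@le_trans _ _ (cosh r ^+ (n - j - 1) *
      (cosh r ^+ j * ((cosh r ^+ (k - 1))^-1 * cosh r `^ (- lam))))%R).
    rewrite ler_wpM2r//; first by rewrite !mulr_ge0 ?powR_ge0 ?invr_ge0 ?exprn_ge0.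
    apply: lerXn2r; rewrite ?nnegrE ?sinh_ge0//.
    by rewrite (le_trans (ler_norm _))// norm_sinh_le_cosh.
  have cn := cosh_neq0 r.
  have h1 : ((n - j - 1)%:R = n%:R - j%:R - 1 :> R)%R by rewrite !natrB ?subn_gt0 ?(ltnW jn).
  have h2 : ((k - 1)%:R = k%:R - 1 :> R)%R by rewrite natrB// (leq_trans _ ltjk).
  rewrite -!powR_mulrn// -!powRN -!powRD ?cn ?implybT// h1 h2.
  by rewrite le_eqVlt; apply/orP; left; apply/eqP; congr (_ `^ _)%R; rewrite /d; ring.
rewrite -(mulrA S); apply: ler_wpM2l => //.
have -> : (2 `^ d * expR (- (d * r)) = (expR r / 2) `^ (- d))%R.
  rewrite powRM ?expR_ge0 ?invr_ge0// -expRM mulrN mulrC (mulrC r).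
  by rewrite -powR_inv1// -powRrM mulN1r opprK.
have e0 : (0 < expR r / 2)%R by rewrite divr_gt0 ?expR_gt0.
have ec : (expR r / 2 <= cosh r)%R by rewrite /cosh ler_wpM2r ?invr_ge0// lerDl expR_ge0.
rewrite !powRN lef_pV2 ?posrE ?powR_gt0//.
by apply: ge0_ler_powR => //; rewrite ?nnegrE ?(ltW d0) ?(ltW e0).
Qed.

End counterexample.

Theorem theorem5p8 (R : realType) (n : nat) (j k : 'I_n)
    (haarn haark : probability (matB R n) R)
    (n_ge2 : (2 <= n)%N) (ltjk : (j < k)%N)
    (Hn : is_haar n haarn) (Hk : is_haar k haark) :
  [/\ forall f : GammaH R j -> R[i],
        L1 (dt j haarn) (n%:R - k%:R) f ->
        {ae dt k haarn, forall z, RH_exists haark f z} /\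
        L1 (dt k haarn) (n%:R - j%:R) (RH haark f),
      forall (c : R[i]) (f g : GammaH R j -> R[i]),
        L1 (dt j haarn) (n%:R - k%:R) f ->
        L1 (dt j haarn) (n%:R - k%:R) g ->
        {ae dt k haarn, forall z,
          RH haark (fun t => c * f t + g t) z = c * RH haark f z + RH haark g z},
      exists C : R, forall f : GammaH R j -> R[i],
        L1 (dt j haarn) (n%:R - k%:R) f ->
        (wnorm (dt k haarn) (n%:R - j%:R) (RH haark f) <=
         C%:E * wnorm (dt j haarn) (n%:R - k%:R) f)%E,
      forall (lam : R) (f : GammaH R j -> R[i]), lam <= n%:R - k%:R ->
        L1 (dt j haarn) lam f ->
        {ae dt k haarn, forall z, RH_exists haark f z} &
      forall lam : R, n%:R - k%:R < lam ->
        exists2 f : GammaH R j -> R[i],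
          L1 (dt j haarn) lam f &
          ~ {ae dt k haarn, forall z, RH_exists haark f z}].
Proof.
have kn := ltn_ord k; split.
- move=> f Lf; split; first exact: (ae_RH_exists n_ge2 ltjk Hn Hk Lf).
  split; first exact: (cmeasurable_RH n_ge2 ltjk Hk Lf.1).
  apply: le_lt_trans (wnorm_RH_le n_ge2 ltjk Hn Hk Lf.1) _.
  apply: (lte_mul_pinfty _ _ Lf.2) => //.
  by rewrite lee_fin mulr_ge0// radon_const_ge0.
- by move=> c f g Lf Lg; exact: RH_linear.
- by exists (2 * radon_const R k j) => f [mf _]; exact: wnorm_RH_le.
- by move=> lam f lamE Lf; apply: ae_RH_exists => //; exact: (L1_weight_le lamE Lf).
- move=> lam lamE; exists (fun t => Complex (slow k t) 0); first exact: slow_L1.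
  exact: slow_not_exists.
Qed.
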